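(* Let $b,c\in\mathbb{N}$ satisfy $1<c\le b$. Then for every $\varepsilon>0$, as $T\to\infty$, $$I_{1,b,c}(T)=\zeta\Big(\frac{1+b}{2}\Big)\zeta\Big(\frac{1+c}{2}\Big)T+O\Big(T^{3/4}(\log T)^2+T^{\frac12+\frac1{2b}+\varepsilon}\Big).$$
   Context: $\zeta$ is the Riemann zeta function and, for $a,b,c\in\mathbb{R}^+$ and $T>1$, $$I_{a,b,c}(T)=\int_0^T\zeta(1/2+ait)\,\zeta(1/2-bit)\,\zeta(1/2-cit)\,dt.$$ Implicit constants may depend on $b,c,\varepsilon$. *)

(* Defs.v *)
From Stdlib Require Import Reals Lra Lia.
From Coquelicot Require Import Coquelicot.

Open Scope R_scope.

Definition Cexp (z : C) : C :=
  (exp (Re z) * cos (Im z), exp (Re z) * sin (Im z)).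

(** [x ^ z] for [x > 0], with the real logarithm of [x]. *)
Definition Rcpow (x : R) (z : C) : C := Cexp (z * RtoC (ln x))%C.

(** [zeta_approx s N] is
    [\sum_(1 <= n <= N + 1) n ^ (- s) - (N + 1) ^ (1 - s) / (1 - s)]. *)
Definition zeta_approx (s : C) (N : nat) : C :=
  (sum_n (fun n => Rcpow (INR (S n)) (- s)%C) N
   - Rcpow (INR (S N)) (1 - s) / (1 - s))%C.

(** The Riemann zeta function on [{s | 0 < Re s, s <> 1}], as the limit of
    [zeta_approx s].  That this is the analytic continuation of the Dirichlet
    series is proved below: [zeta_dirichlet] and [zeta_holomorphic].  Outside
    this domain the value has no meaning. *)
Definition zeta (s : C) : C :=
  (real (Lim_seq (fun N => Re (zeta_approx s N))),
   real (Lim_seq (fun N => Im (zeta_approx s N)))).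

(** [I_(a,b,c)(T)].  The integrand is continuous in [t] (by [zeta_holomorphic]),
    so the total operator [RInt] takes the value of the Riemann integral. *)
Definition zeta_triple_integral (a b c T : R) : C :=
  RInt (V := C_R_CompleteNormedModule)
    (fun t => (zeta (1/2 + Ci * (a * t)) * zeta (1/2 - Ci * (b * t))
               * zeta (1/2 - Ci * (c * t)))%C) 0 T.

(** * The complex exponential *)

Lemma Cexp_0 : Cexp 0 = 1%C.
Proof. unfold Cexp, RtoC; simpl; rewrite exp_0, cos_0, sin_0; f_equal; ring. Qed.

Lemma Cexp_plus u v : Cexp (u + v) = (Cexp u * Cexp v)%C.
Proof.
  destruct u as [a b], v as [a' b']; unfold Cexp, Cplus, Cmult; simpl.
  rewrite exp_plus, cos_plus, sin_plus; f_equal; ring.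
Qed.

Lemma Cmod_Cexp z : Cmod (Cexp z) = exp (Re z).
Proof.
  unfold Cmod, Cexp; simpl fst; simpl snd.
  replace (_ + _) with (Rsqr (exp (Re z))).
  - apply sqrt_Rsqr, Rlt_le, exp_pos.
  - generalize (sin2_cos2 (Im z)); unfold Rsqr; intros H; nra.
Qed.

Lemma Re_le_Cmod z : Re z <= Cmod z.
Proof. generalize (re_le_Cmod z), (Rle_abs (Re z)); lra. Qed.

(** * Derivatives of complex functions of a real variable *)

Definition cder (f : R -> C) (x : R) (l : C) : Prop :=
  is_derive (fun t => Re (f t)) x (Re l) /\
  is_derive (fun t => Im (f t)) x (Im l).

Lemma cder_eq f x l l' : l = l' -> cder f x l -> cder f x l'.
Proof. now intros ->. Qed.

Lemma cder_const z x : cder (fun _ => z) x 0.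
Proof. split; simpl; auto_derive; trivial. Qed.

Lemma cder_plus f g x l m :
  cder f x l -> cder g x m -> cder (fun t => f t + g t)%C x (l + m)%C.
Proof.
  intros [a b] [c d]; split.
  - exact (is_derive_plus _ _ _ _ _ a c).
  - exact (is_derive_plus _ _ _ _ _ b d).
Qed.

Lemma cder_opp f x l : cder f x l -> cder (fun t => - f t)%C x (- l)%C.
Proof.
  intros [a b]; split.
  - exact (is_derive_opp _ _ _ a).
  - exact (is_derive_opp _ _ _ b).
Qed.

Lemma cder_minus f g x l m :
  cder f x l -> cder g x m -> cder (fun t => f t - g t)%C x (l - m)%C.
Proof. intros a b; apply cder_plus; [exact a | now apply cder_opp]. Qed.

Lemma Rder_mult (f g : R -> R) x l m :
  is_derive f x l -> is_derive g x m ->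
  is_derive (fun t => f t * g t) x (l * g x + f x * m).
Proof.
  rewrite !is_derive_Reals; apply (derivable_pt_lim_mult f g).
Qed.

Lemma Rder_plus (f g : R -> R) x l m :
  is_derive f x l -> is_derive g x m ->
  is_derive (fun t => f t + g t) x (l + m).
Proof.
  rewrite !is_derive_Reals; apply (derivable_pt_lim_plus f g).
Qed.

Lemma Rder_minus (f g : R -> R) x l m :
  is_derive f x l -> is_derive g x m ->
  is_derive (fun t => f t - g t) x (l - m).
Proof.
  rewrite !is_derive_Reals; apply (derivable_pt_lim_minus f g).
Qed.

Lemma Rder_comp (f g : R -> R) x l m :
  is_derive f x l -> is_derive g (f x) m ->
  is_derive (fun t => g (f t)) x (m * l).
Proof.
  rewrite !is_derive_Reals; apply (derivable_pt_lim_comp f g).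
Qed.

Lemma Rder_eq (f : R -> R) (x l l' : R) :
  l = l' -> is_derive f x l -> is_derive f x l'.
Proof. now intros ->. Qed.

Lemma cder_mult f g x l m :
  cder f x l -> cder g x m ->
  cder (fun t => f t * g t)%C x (l * g x + f x * m)%C.
Proof.
  intros [a b] [c d]; split.
  - refine (Rder_eq _ _ _ _ _ (Rder_minus _ _ _ _ _
              (Rder_mult _ _ _ _ _ a c) (Rder_mult _ _ _ _ _ b d))).
    rewrite re_plus, !re_mult; ring.
  - refine (Rder_eq _ _ _ _ _ (Rder_plus _ _ _ _ _
              (Rder_mult _ _ _ _ _ a d) (Rder_mult _ _ _ _ _ b c))).
    rewrite im_plus, !im_mult; ring.
Qed.

Lemma cder_scal z f x l : cder f x l -> cder (fun t => z * f t)%C x (z * l)%C.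
Proof.
  intros H; eapply cder_eq; [| apply cder_mult; [apply cder_const | exact H]].
  simpl; ring.
Qed.

Lemma cder_RtoC f x l : is_derive f x l -> cder (fun t => RtoC (f t)) x l.
Proof. intros H; split; simpl; [exact H | auto_derive; trivial]. Qed.

Lemma cder_Cexp f x l :
  cder f x l -> cder (fun t => Cexp (f t)) x (l * Cexp (f x))%C.
Proof.
  intros [a b].
  assert (e := Rder_comp _ _ _ _ _ a (is_derive_exp _)).
  split.
  - refine (Rder_eq _ _ _ _ _ (Rder_mult _ _ _ _ _ e
              (Rder_comp _ _ _ _ _ b (is_derive_cos _)))).
    rewrite re_mult; simpl; ring.
  - refine (Rder_eq _ _ _ _ _ (Rder_mult _ _ _ _ _ e
              (Rder_comp _ _ _ _ _ b (is_derive_sin _)))).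
    rewrite im_mult; simpl; ring.
Qed.

Lemma Cmod_le_sum z : Cmod z <= Rabs (Re z) + Rabs (Im z).
Proof.
  replace z with (RtoC (Re z) + Ci * RtoC (Im z))%C at 1.
  - eapply Rle_trans; [apply Cmod_triangle |].
    rewrite Cmod_mult, Cmod_Ci, !Cmod_R; lra.
  - destruct z; unfold Cplus, Cmult; simpl; f_equal; ring.
Qed.

Lemma Rmvt_le (f f' : R -> R) a b M :
  a <= b -> (forall x, a <= x <= b -> is_derive f x (f' x)) ->
  (forall x, a <= x <= b -> Rabs (f' x) <= M) ->
  Rabs (f b - f a) <= M * (b - a).
Proof.
  intros Hab Hd HM.
  destruct (MVT_gen f a b f') as [c [Hc ->]].
  - rewrite Rmin_left, Rmax_right by lra; intros; apply Hd; lra.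
  - rewrite Rmin_left, Rmax_right by lra; intros x Hx.
    apply derivable_continuous_pt, ex_derive_Reals_0.
    exists (f' x); apply Hd; lra.
  - rewrite Rmin_left, Rmax_right in Hc by lra.
    rewrite Rabs_mult, (Rabs_right (b - a)) by lra.
    apply Rmult_le_compat_r; [lra | apply HM; lra].
Qed.

Lemma Cmvt_le (f f' : R -> C) a b M :
  a <= b -> (forall x, a <= x <= b -> cder f x (f' x)) ->
  (forall x, a <= x <= b -> Cmod (f' x) <= M) ->
  Cmod (f b - f a) <= 2 * M * (b - a).
Proof.
  intros Hab Hd HM.
  eapply Rle_trans; [apply Cmod_le_sum |].
  assert (H1 : Rabs (Re (f b - f a)) <= M * (b - a)).
  { apply (Rmvt_le (fun t => Re (f t)) (fun t => Re (f' t))); auto.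
    - intros x Hx; apply Hd, Hx.
    - intros x Hx; eapply Rle_trans; [| apply (HM x Hx)].
      eapply Rle_trans; [| apply Rmax_Cmod]; apply Rmax_l. }
  assert (H2 : Rabs (Im (f b - f a)) <= M * (b - a)).
  { apply (Rmvt_le (fun t => Im (f t)) (fun t => Im (f' t))); auto.
    - intros x Hx; apply Hd, Hx.
    - intros x Hx; eapply Rle_trans; [| apply (HM x Hx)].
      eapply Rle_trans; [| apply Rmax_Cmod]; apply Rmax_r. }
  lra.
Qed.

Lemma cder_line z x : cder (fun t => z * RtoC t)%C x z.
Proof.
  eapply cder_eq.
  2: apply cder_scal, (cder_RtoC (fun t => t)), (is_derive_id x).
  change (z * 1 = z)%C; ring.
Qed.

Lemma Cmod_Cexp_line z t :
  0 <= t <= 1 -> Cmod (Cexp (z * RtoC t)) <= exp (Cmod z).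
Proof.
  intros Ht; rewrite Cmod_Cexp, re_scal_r.
  generalize (Re_le_Cmod z) (Cmod_ge_0 z); intros H1 H2.
  assert (H : Re z * t <= Cmod z) by nra.
  destruct H as [H | ->]; [apply Rlt_le, exp_increasing, H | apply Rle_refl].
Qed.

Lemma Cexp_sub1_le z : Cmod (Cexp z - 1) <= 2 * (Cmod z * exp (Cmod z)).
Proof.
  assert (H := Cmvt_le (fun t => Cexp (z * RtoC t))
                 (fun t => z * Cexp (z * RtoC t))%C 0 1
                 (Cmod z * exp (Cmod z))).
  simpl in H; rewrite Cmult_1_r, Cmult_0_r, Cexp_0 in H.
  rewrite Rminus_0_r, Rmult_1_r in H; apply H; [lra | |].
  - intros x _; apply (cder_Cexp (fun t => z * RtoC t)%C), cder_line.
  - intros x Hx; rewrite Cmod_mult.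
    apply Rmult_le_compat_l; [apply Cmod_ge_0 | apply Cmod_Cexp_line, Hx].
Qed.

Lemma Cexp_sub2_le z :
  Cmod (Cexp z - 1 - z) <= 4 * (Cmod z * Cmod z * exp (Cmod z)).
Proof.
  assert (Hz := Cmod_ge_0 z).
  assert (H := Cmvt_le (fun t => Cexp (z * RtoC t) - z * RtoC t)%C
                 (fun t => z * Cexp (z * RtoC t) - z)%C 0 1
                 (2 * (Cmod z * Cmod z * exp (Cmod z)))).
  simpl in H; rewrite Cmult_1_r, Cmult_0_r, Cexp_0 in H.
  replace (Cexp z - 1 - z)%C with (Cexp z - z - (1 - 0))%C by ring.
  eapply Rle_trans; [apply H; [lra | |] | lra].
  - intros x _; apply cder_minus; [| apply cder_line].
    apply (cder_Cexp (fun t => z * RtoC t)%C), cder_line.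
  - intros x Hx.
    replace (z * Cexp (z * RtoC x) - z)%C with (z * (Cexp (z * RtoC x) - 1))%C
      by ring.
    rewrite Cmod_mult.
    assert (Hx' : Cmod (z * RtoC x) <= Cmod z).
    { rewrite Cmod_mult, Cmod_R, Rabs_right by lra; nra. }
    assert (He : exp (Cmod (z * RtoC x)) <= exp (Cmod z)).
    { destruct Hx' as [Hx' | ->]; [apply Rlt_le, exp_increasing, Hx' | lra]. }
    generalize (Cexp_sub1_le (z * RtoC x)) (Cmod_ge_0 (z * RtoC x))
      (exp_pos (Cmod (z * RtoC x))); intros.
    assert (Cmod (z * RtoC x) * exp (Cmod (z * RtoC x))
            <= Cmod z * exp (Cmod z)) by (apply Rmult_le_compat; lra).
    nra.
Qed.

(** * Complex powers of positive reals *)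

Lemma Rcpow_plus x u v : Rcpow x (u + v) = (Rcpow x u * Rcpow x v)%C.
Proof. unfold Rcpow; rewrite Cmult_plus_distr_r; apply Cexp_plus. Qed.

Lemma Rcpow_1 x : 0 < x -> Rcpow x 1 = RtoC x.
Proof.
  intros Hx; unfold Rcpow, Cexp; rewrite Cmult_1_l; simpl.
  rewrite exp_ln, cos_0, sin_0 by exact Hx; unfold RtoC; f_equal; ring.
Qed.

Lemma Rcpow_base1 z : Rcpow 1 z = 1%C.
Proof. unfold Rcpow; rewrite ln_1, Cmult_0_r; apply Cexp_0. Qed.

Lemma Cmod_Rcpow x z : Cmod (Rcpow x z) = Rpower x (Re z).
Proof. unfold Rcpow; rewrite Cmod_Cexp, re_scal_r; reflexivity. Qed.

Lemma cder_ln x : 0 < x -> cder (fun t => RtoC (ln t)) x (Rcpow x (- (1)))%C.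
Proof.
  intros Hx; eapply cder_eq; [| apply cder_RtoC, is_derive_ln, Hx].
  rewrite RtoC_inv by lra.
  assert (Hx0 : RtoC x <> 0) by (intros E; apply RtoC_inj in E; lra).
  assert (H : (Rcpow x (- (1)) * RtoC x = 1)%C).
  { rewrite <- (Rcpow_1 x Hx) at 1; rewrite <- Rcpow_plus.
    replace (- (1) + 1)%C with (RtoC 0) by ring.
    unfold Rcpow; rewrite Cmult_0_l; apply Cexp_0. }
  replace (/ x)%C with (Rcpow x (- (1)) * RtoC x * / x)%C by (rewrite H; ring).
  field; exact Hx0.
Qed.

Lemma cder_Rcpow z x :
  0 < x -> cder (fun t => Rcpow t z) x (z * Rcpow x (z - 1))%C.
Proof.
  intros Hx; eapply cder_eq.
  2: apply (cder_Cexp (fun t => z * RtoC (ln t))%C), cder_scal, cder_ln, Hx.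
  unfold Cminus; rewrite Rcpow_plus; unfold Rcpow; ring.
Qed.

Lemma exp_le x y : x <= y -> exp x <= exp y.
Proof. intros [H | ->]; [apply Rlt_le, exp_increasing, H | apply Rle_refl]. Qed.

(** * Summability of [n ^ (-1 - tau)] *)

Lemma INR_S_pos n : 0 < INR (S n).
Proof. apply lt_0_INR; lia. Qed.

Lemma lim_Rpower_neg tau :
  0 < tau -> is_lim_seq (fun n => Rpower (INR (S n)) (- tau)) 0.
Proof.
  intros Ht; unfold Rpower.
  apply (is_lim_comp_seq exp _ m_infty).
  - apply is_lim_exp_m.
  - exists 0%nat; intros; discriminate.
  - replace m_infty with (Rbar_mult (- tau) p_infty).
    + apply is_lim_seq_scal_l, (is_lim_comp_seq ln _ p_infty).
      * apply is_lim_ln_p.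
      * exists 0%nat; intros; discriminate.
      * apply (is_lim_seq_incr_1 INR), is_lim_seq_INR.
    + apply is_Rbar_mult_unique, is_Rbar_mult_sym, is_Rbar_mult_p_infty_neg.
      simpl; lra.
Qed.

Lemma Rpower_tele tau n :
  0 < tau ->
  Rpower (INR (S (S n))) (- 1 - tau)
  <= / tau * (Rpower (INR (S n)) (- tau) - Rpower (INR (S (S n))) (- tau)).
Proof.
  intros Ht.
  assert (Hx := INR_S_pos n); rewrite (S_INR (S n)).
  set (x := INR (S n)) in *.
  destruct (MVT_gen (fun t => Rpower t (- tau)) x (x + 1)
              (fun t => - tau * Rpower t (- 1 - tau))) as [c [Hc H]].
  - rewrite Rmin_left, Rmax_right by lra; intros y Hy.
    replace (- 1 - tau) with (- tau - 1) by ring.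
    apply is_derive_Reals, derivable_pt_lim_power; lra.
  - rewrite Rmin_left, Rmax_right by lra; intros y Hy.
    apply derivable_continuous_pt.
    eexists; apply derivable_pt_lim_power; lra.
  - rewrite Rmin_left, Rmax_right in Hc by lra.
    apply (Rmult_le_reg_l tau); [exact Ht |].
    rewrite <- Rmult_assoc, Rinv_r, Rmult_1_l by lra.
    assert (Hp : Rpower (x + 1) (- 1 - tau) <= Rpower c (- 1 - tau)).
    { unfold Rpower; apply exp_le.
      assert (ln c <= ln (x + 1)) by (apply ln_le; lra); nra. }
    simpl in H; nra.
Qed.

Lemma ex_series_Rpower tau :
  0 < tau -> ex_series (fun n => Rpower (INR (S n)) (- 1 - tau)).
Proof.
  intros Ht; apply ex_series_incr_1.
  apply (@ex_series_le R_AbsRing R_CompleteNormedModule) with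
    (b := fun n => / tau * (Rpower (INR (S n)) (- tau)
                            - Rpower (INR (S (S n))) (- tau))).
  - intros n; change (norm ?a) with (Rabs a).
    rewrite Rabs_right by (apply Rle_ge, Rlt_le, exp_pos).
    apply Rpower_tele, Ht.
  - exists (/ tau * (Rpower (INR 1) (- tau) - 0)).
    match goal with |- is_series ?a ?l =>
      change (is_lim_seq (sum_n a) (Finite l)) end.
    apply (is_lim_seq_ext (fun n =>
      / tau * (Rpower (INR 1) (- tau) - Rpower (INR (S (S n))) (- tau)))).
    + induction n as [|n IH].
      * rewrite sum_O; reflexivity.
      * rewrite sum_Sn, <- IH; change (plus ?a ?b) with (a + b); ring.
    + apply is_lim_seq_mult'; [apply is_lim_seq_const |].
      apply is_lim_seq_minus'; [apply is_lim_seq_const |].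
      apply (is_lim_seq_incr_1 (fun n => Rpower (INR (S n)) (- tau))).
      apply lim_Rpower_neg, Ht.
Qed.

(** * Termwise estimates *)

Definition zeta_term (s : C) (n : nat) : C :=
  (Rcpow (INR (S n) + 1) (- s)
   - (Rcpow (INR (S n) + 1) (1 - s) / (1 - s)
      - Rcpow (INR (S n)) (1 - s) / (1 - s)))%C.

(** The derivative of [zeta_term s n] in [s]. *)
Definition zeta_dterm (s : C) (n : nat) : C :=
  let p x := (- (RtoC (ln x) * Rcpow x (- s)))%C in
  let q x := (- (RtoC (ln x) * Rcpow x (1 - s)) / (1 - s)
              + Rcpow x (1 - s) / ((1 - s) * (1 - s)))%C in
  (p (INR (S n) + 1)%R - (q (INR (S n) + 1)%R - q (INR (S n))))%C.

Lemma step_bound (q p p' : R -> C) a M :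
  (forall x, a <= x <= a + 1 -> cder q x (p x)) ->
  (forall x, a <= x <= a + 1 -> cder p x (p' x)) ->
  (forall x, a <= x <= a + 1 -> Cmod (p' x) <= M) ->
  Cmod (p (a + 1)%R - (q (a + 1)%R - q a))%C <= 4 * M.
Proof.
  intros Hq Hp HM.
  assert (HM0 : 0 <= M).
  { eapply Rle_trans; [apply Cmod_ge_0 | apply (HM a); lra]. }
  assert (H := Cmvt_le (fun x => p (a + 1)%R * RtoC x - q x)%C
                 (fun x => p (a + 1)%R - p x)%C a (a + 1) (2 * M)).
  cbv beta in H; rewrite RtoC_plus in H.
  replace (p (a + 1)%R - (q (a + 1)%R - q a))%C with
    (p (a + 1)%R * (a + 1) - q (a + 1)%R - (p (a + 1)%R * a - q a))%C by ring.
  eapply Rle_trans; [apply H; [lra | |] | lra].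
  - intros x Hx; apply cder_minus; [apply cder_line | apply Hq, Hx].
  - intros x Hx.
    eapply Rle_trans; [apply (Cmvt_le p p' x (a + 1) M); [lra | |] |].
    + intros y Hy; apply Hp; lra.
    + intros y Hy; apply HM; lra.
    + nra.
Qed.

Lemma Cminus1_neq (s : C) : s <> 1%C -> (1 - s)%C <> 0.
Proof.
  intros H E; apply H; apply (proj2 (Ceq_minus s 1)).
  replace (s - 1)%C with (- (1 - s))%C by ring; rewrite E; ring.
Qed.

Lemma Rpower_neg_le x y z : 0 < x <= y -> z <= 0 -> Rpower y z <= Rpower x z.
Proof.
  intros Hx Hz; unfold Rpower; apply exp_le.
  assert (ln x <= ln y) by (apply ln_le; lra); nra.
Qed.

Lemma Rcpow_antider (s : C) x :
  s <> 1%C -> 0 < x ->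
  cder (fun t => Rcpow t (1 - s) / (1 - s))%C x (Rcpow x (- s)).
Proof.
  intros Hs Hx; unfold Cdiv.
  eapply cder_eq; [| apply cder_mult; [apply cder_Rcpow, Hx | apply cder_const]].
  replace (1 - s - 1)%C with (- s)%C by ring.
  field; now apply Cminus1_neq.
Qed.

Lemma Re_opp_sub1 (s : C) : Re (- s - 1) = - 1 - Re s.
Proof. unfold Re; simpl; ring. Qed.

Lemma zeta_term_le (s : C) n :
  0 < Re s -> s <> 1%C ->
  Cmod (zeta_term s n) <= 4 * (Cmod s * Rpower (INR (S n)) (- 1 - Re s)).
Proof.
  intros Hs H1; assert (Hn := INR_S_pos n).
  apply (step_bound (fun x => Rcpow x (1 - s) / (1 - s))%C
           (fun x => Rcpow x (- s)) (fun x => - s * Rcpow x (- s - 1))%C).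
  - intros x Hx; apply Rcpow_antider; [exact H1 | lra].
  - intros x Hx; apply cder_Rcpow; lra.
  - intros x Hx; rewrite Cmod_mult, Cmod_opp, Cmod_Rcpow.
    apply Rmult_le_compat_l; [apply Cmod_ge_0 |].
    rewrite Re_opp_sub1.
    apply Rpower_neg_le; lra.
Qed.

Lemma le_exp_div tau y : 0 < tau -> y <= / tau * exp (tau * y).
Proof.
  intros Ht; apply (Rmult_le_reg_l tau); [exact Ht |].
  rewrite <- Rmult_assoc, Rinv_r, Rmult_1_l by lra.
  destruct (Req_dec (tau * y) 0) as [-> | H].
  - apply Rlt_le, exp_pos.
  - generalize (exp_ineq1 _ H); lra.
Qed.

Lemma quad_bound (s h : C) x :
  0 < Re s -> Cmod h <= Re s / 4 -> 1 <= x ->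
  Cmod (Rcpow x (- s - 1)
        * (- s * (Cexp (- h * RtoC (ln x)) - 1 - - h * RtoC (ln x))
           - h * (Cexp (- h * RtoC (ln x)) - 1)))%C
  <= (256 * Cmod s / (Re s * Re s) + 16 / Re s) * (Cmod h * Cmod h)
     * Rpower x (- 1 - Re s / 2).
Proof.
  intros Hs Hh Hx.
  set (sg := Re s) in *; set (L := ln x).
  assert (HL : 0 <= L) by (rewrite <- ln_1; apply ln_le; lra).
  assert (Hh0 := Cmod_ge_0 h); assert (Hs0 := Cmod_ge_0 s).
  set (w := (- h * RtoC L)%C).
  assert (Hw : Cmod w = Cmod h * L).
  { unfold w; rewrite Cmod_mult, Cmod_opp, Cmod_R, Rabs_right; lra. }
  set (E := exp (sg / 8 * L)).
  assert (HE : 0 < E) by apply exp_pos.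
  assert (HLE : L <= 8 / sg * E).
  { replace (8 / sg) with (/ (sg / 8)) by (field; lra).
    apply le_exp_div; lra. }
  assert (HE1 : 1 <= E).
  { unfold E; rewrite <- exp_0; apply exp_le; nra. }
  assert (Hew : exp (Cmod w) <= E * E).
  { unfold E; rewrite <- exp_plus; apply exp_le; rewrite Hw; nra. }
  assert (Hpow : Cmod (Rcpow x (- s - 1)) * (E * E * (E * E))
                 = Rpower x (- 1 - sg / 2)).
  { rewrite Cmod_Rcpow, Re_opp_sub1; unfold Rpower, E; rewrite <- !exp_plus; f_equal.
    fold L sg; field. }
  assert (Hp0 := Cmod_ge_0 (Rcpow x (- s - 1))).
  rewrite Cmod_mult, <- Hpow.
  rewrite (Rmult_comm _ (_ * (E * E * (E * E)))), Rmult_assoc.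
  apply Rmult_le_compat_l; [exact Hp0 |].
  eapply Rle_trans; [apply Cmod_triangle |].
  rewrite Cmod_opp, !Cmod_mult, Cmod_opp.
  assert (A1 := Cexp_sub1_le w); assert (A2 := Cexp_sub2_le w).
  assert (Hew0 := exp_pos (Cmod w)).
  assert (B0 : 0 < 8 / sg) by (apply Rdiv_lt_0_compat; lra).
  assert (B1 : Cmod w * exp (Cmod w) <= Cmod h * (8 / sg) * (E * E * (E * E))).
  { rewrite Hw at 1; rewrite !Rmult_assoc; apply Rmult_le_compat_l; [exact Hh0 |].
    rewrite <- Rmult_assoc.
    apply Rle_trans with (8 / sg * E * (E * E)).
    - apply Rmult_le_compat; lra.
    - assert (1 * (E * E * E) <= E * (E * E * E))
        by (apply Rmult_le_compat_r; [| exact HE1];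
            repeat apply Rmult_le_pos; lra).
      nra. }
  assert (B2 : Cmod w * Cmod w * exp (Cmod w)
               <= Cmod h * Cmod h * (64 / (sg * sg)) * (E * E * (E * E))).
  { replace (Cmod w * Cmod w) with (Cmod h * Cmod h * (L * L))
      by (rewrite Hw; ring).
    rewrite !(Rmult_assoc (Cmod h * Cmod h)).
    apply Rmult_le_compat_l; [apply Rmult_le_pos; lra |].
    replace (64 / (sg * sg) * (E * E * (E * E))) with
      (8 / sg * E * (8 / sg * E) * (E * E)) by (field; lra).
    apply Rmult_le_compat; [apply Rmult_le_pos; lra | lra | | exact Hew].
    apply Rmult_le_compat; lra. }
  replace (E * E * (E * E) * ((256 * Cmod s / (sg * sg) + 16 / sg) * (Cmod h * Cmod h)))
    with (Cmod s * (4 * (Cmod h * Cmod h * (64 / (sg * sg)) * (E * E * (E * E))))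
          + Cmod h * (2 * (Cmod h * (8 / sg) * (E * E * (E * E))))) by (field; lra).
  apply Rplus_le_compat; apply Rmult_le_compat_l; lra.
Qed.

Lemma zeta_term_quad (s h : C) n :
  0 < Re s -> s <> 1%C -> (s + h)%C <> 1%C -> Cmod h <= Re s / 4 ->
  Cmod (zeta_term (s + h) n - zeta_term s n - h * zeta_dterm s n)
  <= 4 * ((256 * Cmod s / (Re s * Re s) + 16 / Re s) * (Cmod h * Cmod h)
          * Rpower (INR (S n)) (- 1 - Re s / 2)).
Proof.
  intros Hs H1 H2 Hh; assert (Hn := INR_S_pos n).
  assert (Hn1 : 1 <= INR (S n)) by (rewrite S_INR; generalize (pos_INR n); lra).
  assert (N1 := Cminus1_neq s H1).
  set (q := fun x => (Rcpow x (1 - (s + h)) / (1 - (s + h))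
    - Rcpow x (1 - s) / (1 - s)
    - h * (- (RtoC (ln x) * Rcpow x (1 - s)) * / (1 - s)
           + Rcpow x (1 - s) * / ((1 - s) * (1 - s))))%C).
  set (p := fun x => (Rcpow x (- (s + h)) - Rcpow x (- s)
    - h * (- (RtoC (ln x) * Rcpow x (- s))))%C).
  replace (zeta_term (s + h) n - zeta_term s n - h * zeta_dterm s n)%C with
    (p (INR (S n) + 1)%R - (q (INR (S n) + 1)%R - q (INR (S n))))%C.
  2: { unfold p, q, zeta_term, zeta_dterm, Cdiv; ring. }
  set (M := (_ * Rpower _ _)%R).
  apply (step_bound q p
    (fun x => Rcpow x (- s - 1)
        * (- s * (Cexp (- h * RtoC (ln x)) - 1 - - h * RtoC (ln x))
           - h * (Cexp (- h * RtoC (ln x)) - 1)))%C).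
  - intros x Hx; assert (Hx0 : 0 < x) by lra.
    eapply cder_eq.
    2: { apply cder_minus; [apply cder_minus; apply Rcpow_antider; assumption |].
         apply cder_scal, cder_plus.
         - apply (cder_mult (fun t => - (RtoC (ln t) * Rcpow t (1 - s)))%C
                    (fun _ => / (1 - s))%C); [| apply cder_const].
           apply cder_opp, (cder_mult (fun t => RtoC (ln t))
             (fun t => Rcpow t (1 - s)));
             [apply cder_ln, Hx0 | apply cder_Rcpow, Hx0].
         - apply (cder_mult (fun t => Rcpow t (1 - s))
                    (fun _ => / ((1 - s) * (1 - s)))%C);
             [apply cder_Rcpow, Hx0 | apply cder_const]. }
    unfold p.
    replace (1 - s - 1)%C with (- s)%C by ring.
    replace (Rcpow x (1 - s)) with (Rcpow x 1 * Rcpow x (- s))%C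
      by (rewrite <- Rcpow_plus; reflexivity).
    assert (E : (Rcpow x (- (1)) * Rcpow x 1 = 1)%C).
    { rewrite <- Rcpow_plus; replace (- (1) + 1)%C with (RtoC 0) by ring.
      unfold Rcpow; rewrite Cmult_0_l; apply Cexp_0. }
    rewrite !(Cmult_assoc (Rcpow x (- (1)))), E.
    field; exact N1.
  - intros x Hx; assert (Hx0 : 0 < x) by lra.
    eapply cder_eq.
    2: { apply cder_minus; [apply cder_minus; apply cder_Rcpow, Hx0 |].
         apply cder_scal, cder_opp, (cder_mult (fun t => RtoC (ln t))
           (fun t => Rcpow t (- s)));
           [apply cder_ln, Hx0 | apply cder_Rcpow, Hx0]. }
    replace (- (s + h) - 1)%C with (- s - 1 + - h)%C by ring.
    rewrite (Rcpow_plus x (- s - 1) (- h)).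
    replace (Rcpow x (- (1)) * Rcpow x (- s))%C with (Rcpow x (- s - 1))
      by (rewrite <- Rcpow_plus; f_equal; ring).
    replace (Cexp (- h * ln x)) with (Rcpow x (- h)) by reflexivity.
    ring.
  - intros x Hx.
    eapply Rle_trans; [apply quad_bound; [exact Hs | exact Hh | lra] |].
    apply Rmult_le_compat_l; [| apply Rpower_neg_le; lra].
    generalize (Cmod_ge_0 s), (Cmod_ge_0 h); intros.
    assert (0 < / Re s) by (apply Rinv_0_lt_compat; lra).
    apply Rmult_le_pos; [| nra].
    unfold Rdiv; rewrite Rinv_mult.
    apply Rplus_le_le_0_compat; repeat apply Rmult_le_pos; lra.
Qed.

(** * The limit defining [zeta] *)

Lemma zeta_approx_sum s N :
  zeta_approx s (S N) = (zeta_approx s 0 + sum_n (zeta_term s) N)%C.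
Proof.
  assert (H : forall n,
             zeta_approx s (S n) = (zeta_approx s n + zeta_term s n)%C).
  { intros n; unfold zeta_approx, zeta_term; rewrite sum_Sn.
    change (plus ?a ?b) with (a + b)%C; rewrite !(S_INR (S n)).
    unfold Cdiv; ring. }
  induction N as [|N IH]; [rewrite sum_O; apply H |].
  rewrite H, IH, sum_Sn; change (plus ?a ?b) with (a + b)%C; ring.
Qed.

Lemma zeta_approx_0 s : zeta_approx s 0 = (1 - / (1 - s))%C.
Proof.
  unfold zeta_approx; rewrite sum_O; simpl INR; rewrite !Rcpow_base1.
  unfold Cdiv; ring.
Qed.

Lemma ex_zeta_series (s : C) :
  0 < Re s -> s <> 1%C -> ex_series (V := C_NormedModule) (zeta_term s).
Proof.
  intros Hs H1.
  apply (@ex_series_le C_AbsRing C_CompleteNormedModule) with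
    (b := fun n => 4 * (Cmod s * Rpower (INR (S n)) (- 1 - Re s))).
  - intros n; exact (zeta_term_le s n Hs H1).
  - apply (@ex_series_scal R_AbsRing R_NormedModule 4).
    apply (@ex_series_scal R_AbsRing R_NormedModule (Cmod s)).
    apply ex_series_Rpower, Hs.
Qed.

Lemma zeta_unfold (s l : C) :
  is_series (V := C_NormedModule) (zeta_term s) l ->
  filterlim (zeta_approx s) eventually (locally (zeta_approx s 0 + l)%C) /\
  zeta s = (zeta_approx s 0 + l)%C.
Proof.
  intros Hl.
  assert (H : filterlim (zeta_approx s) eventually
                (locally (zeta_approx s 0 + l)%C)).
  { intros P HP.
    assert (H' : filterlim (fun N => plus (zeta_approx s 0) (sum_n (zeta_term s) N))
                   eventually
                   (locally (plus (zeta_approx s 0 : C_NormedModule) l))).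
    { eapply filterlim_comp_2;
        [apply filterlim_const | exact Hl | apply (@filterlim_plus _ C_NormedModule)]. }
    destruct (H' P HP) as [N HN]; exists (S N); intros [|n] Hn; [lia |].
    rewrite zeta_approx_sum; apply HN; lia. }
  split; [exact H |].
  set (m := (zeta_approx s 0 + l)%C) in *.
  assert (A : is_lim_seq (fun N => Re (zeta_approx s N)) (Re m)).
  { eapply filterlim_comp; [exact H |].
    destruct m as [m1 m2]; apply (continuous_fst m1 m2). }
  assert (B : is_lim_seq (fun N => Im (zeta_approx s N)) (Im m)).
  { eapply filterlim_comp; [exact H |].
    destruct m as [m1 m2]; apply (continuous_snd m1 m2). }
  unfold zeta; rewrite (is_lim_seq_unique _ _ A), (is_lim_seq_unique _ _ B).
  now destruct m.
Qed.

Lemma zeta_approx_lim (s : C) :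
  0 < Re s -> s <> 1%C ->
  filterlim (zeta_approx s) eventually (locally (zeta s)).
Proof.
  intros Hs H1; destruct (ex_zeta_series s Hs H1) as [l Hl].
  destruct (zeta_unfold s l Hl) as [H ->]; exact H.
Qed.

(** * Agreement with the Dirichlet series, and holomorphy *)

Lemma zeta_dirichlet (s : C) :
  1 < Re s ->
  is_series (V := C_NormedModule) (fun n => Rcpow (INR (S n)) (- s)%C) (zeta s).
Proof.
  intros Hs.
  assert (H1 : s <> 1%C) by (intros ->; simpl in Hs; lra).
  assert (N1 := Cminus1_neq s H1).
  assert (H0 : filterlim
    (fun N => (Rcpow (INR (S N)) (1 - s) / (1 - s))%C : C_NormedModule)
    eventually (locally (zero : C_NormedModule))).
  { apply filterlim_norm_zero.
    assert (L : is_lim_seq (fun N =>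
      Rpower (INR (S N)) (- (Re s - 1)) * Cmod (/ (1 - s))) 0).
    { replace (Finite 0) with (Finite (0 * Cmod (/ (1 - s))))
        by (f_equal; ring).
      apply is_lim_seq_mult'; [| apply is_lim_seq_const].
      apply lim_Rpower_neg; lra. }
    eapply filterlim_ext; [| exact L].
    intros N; change (norm ?z) with (Cmod z); unfold Cdiv.
    rewrite Cmod_mult, Cmod_Rcpow; do 2 f_equal; simpl; unfold Re; ring. }
  assert (H : filterlim
    (fun N => plus (zeta_approx s N : C_NormedModule)
                (Rcpow (INR (S N)) (1 - s) / (1 - s))%C)
    eventually (locally (plus (zeta s : C_NormedModule) zero))).
  { eapply filterlim_comp_2;
      [| exact H0 | apply (@filterlim_plus _ C_NormedModule)].
    apply zeta_approx_lim; [lra | exact H1]. }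
  rewrite plus_zero_r in H.
  eapply filterlim_ext; [| exact H].
  intros N; change (plus ?a ?b) with (a + b)%C; unfold zeta_approx.
  assert (E : forall u v : C, (u - v + v)%C = u) by (intros; ring).
  apply E.
Qed.

Lemma Cmod_series_le (a : nat -> C) (b : nat -> R) (l : C) (m : R) :
  (forall n, Cmod (a n) <= b n) ->
  is_series (V := C_NormedModule) a l -> is_series b m -> Cmod l <= m.
Proof.
  intros Hab Ha Hb.
  assert (L : is_lim_seq (fun N => Cmod (sum_n a N)) (Cmod l)).
  { eapply filterlim_comp; [exact Ha |].
    apply (@filterlim_norm _ C_NormedModule). }
  refine (is_lim_seq_le _ (sum_n b) (Cmod l) m _ L Hb).
  intros N; eapply Rle_trans;
    [apply (@norm_sum_n_m _ C_NormedModule) | apply sum_n_m_le, Hab].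
Qed.

Lemma inv_quad (w h : C) :
  w <> 0%C -> Cmod h <= Cmod w / 2 ->
  Cmod (- / (w - h) + / w + h * (/ (w * w)))%C
  <= 2 / (Cmod w * Cmod w * Cmod w) * (Cmod h * Cmod h).
Proof.
  intros Hw Hh; assert (Hw0 := proj1 (Cmod_gt_0 w) Hw).
  assert (Hd : Cmod w / 2 <= Cmod (w - h)).
  { assert (T := Cmod_triangle (w - h) h).
    replace (w - h + h)%C with w in T by ring; lra. }
  assert (Hwh : (w - h)%C <> 0) by (apply Cmod_gt_0; lra).
  replace (- / (w - h) + / w + h * (/ (w * w)))%C
    with (- (h * h) * / (w * w) * / (w - h))%C by (field; split; assumption).
  rewrite !Cmod_mult, Cmod_opp, Cmod_mult, !Cmod_inv, Cmod_mult;
    try assumption; try (now apply Cmult_neq_0).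
  assert (/ Cmod (w - h) <= 2 / Cmod w).
  { replace (2 / Cmod w) with (/ (Cmod w / 2)) by (field; lra).
    apply Rinv_le_contravar; lra. }
  replace (2 / (Cmod w * Cmod w * Cmod w) * (Cmod h * Cmod h)) with
    (Cmod h * Cmod h * / (Cmod w * Cmod w) * (2 / Cmod w)) by (field; lra).
  apply Rmult_le_compat_l; [| assumption].
  apply Rmult_le_pos; [generalize (Cmod_ge_0 h); nra |].
  apply Rlt_le, Rinv_0_lt_compat; nra.
Qed.

Lemma is_derive_quad (f : C -> C) (s d : C) (r K : R) :
  0 < r ->
  (forall h, Cmod h <= r ->
     Cmod (f (s + h) - f s - h * d)%C <= K * (Cmod h * Cmod h)) ->
  is_derive (K := C_AbsRing) (V := C_NormedModule) f s d.
Proof.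
  intros Hr H; split; [apply is_linear_scal_l |].
  intros x Hx; apply (@is_filter_lim_locally_unique C_AbsRing (AbsRing_NormedModule C_AbsRing)) in Hx.
  subst x; intros eps.
  set (K' := Rmax K 1).
  assert (HK : 0 < K') by (generalize (Rmax_r K 1); unfold K'; lra).
  assert (He : 0 < Rmin r (eps / K')).
  { apply Rmin_glb_lt; [exact Hr | apply Rdiv_lt_0_compat; [apply eps | lra]]. }
  exists (mkposreal _ He); intros y Hy.
  change (Cmod (y - s) < Rmin r (eps / K')) in Hy.
  change (Cmod (f y - f s - (y - s) * d) <= eps * Cmod (y - s)).
  assert (Y1 := Rmin_l r (eps / K')); assert (Y2 := Rmin_r r (eps / K')).
  assert (Q := H (y - s)%C ltac:(lra)).
  assert (E : forall u v : C, (u + (v - u))%C = v) by (intros; ring).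
  rewrite E in Q.
  eapply Rle_trans; [exact Q |]; rewrite <- Rmult_assoc.
  apply Rmult_le_compat_r; [apply Cmod_ge_0 |].
  apply Rle_trans with (K' * (eps / K')); [| right; field; lra].
  apply Rle_trans with (K' * Cmod (y - s)).
  - apply Rmult_le_compat_r; [apply Cmod_ge_0 | apply Rmax_l].
  - apply Rmult_le_compat_l; lra.
Qed.

Lemma zeta_holomorphic (s : C) :
  0 < Re s -> s <> 1%C ->
  ex_derive (K := C_AbsRing) (V := C_NormedModule) zeta s.
Proof.
  intros Hs H1; assert (N1 := Cminus1_neq s H1).
  assert (Hw0 := proj1 (Cmod_gt_0 _) N1).
  set (r := Rmin (Re s / 4) (Cmod (1 - s) / 2)).
  assert (Hr : 0 < r) by (apply Rmin_glb_lt; lra).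
  assert (R1 := Rmin_l (Re s / 4) (Cmod (1 - s) / 2)); fold r in R1.
  assert (R2 := Rmin_r (Re s / 4) (Cmod (1 - s) / 2)); fold r in R2.
  assert (Hdom : forall h, Cmod h <= r -> 0 < Re (s + h) /\ (s + h)%C <> 1%C).
  { intros h Hh; split.
    - rewrite re_plus; generalize (re_le_Cmod h), (Rle_abs (- Re h)).
      rewrite Rabs_Ropp; lra.
    - intros E; assert (h = (1 - s)%C) by (rewrite <- E; ring); subst h; lra. }
  set (K := 256 * Cmod s / (Re s * Re s) + 16 / Re s).
  destruct (ex_series_Rpower (Re s / 2) ltac:(lra)) as [m Hm].
  assert (Hb : forall h, is_series (fun n =>
    4 * (K * (Cmod h * Cmod h) * Rpower (INR (S n)) (- 1 - Re s / 2)))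
    (4 * (K * (Cmod h * Cmod h) * m))).
  { intros h.
    apply (@is_series_scal R_AbsRing R_NormedModule 4).
    apply (@is_series_scal R_AbsRing R_NormedModule (K * (Cmod h * Cmod h))).
    exact Hm. }
  destruct (ex_zeta_series s Hs H1) as [l Hl].
  assert (Hlh : forall h, Cmod h <= r ->
    exists lh, is_series (V := C_NormedModule) (zeta_term (s + h)) lh).
  { intros h Hh; destruct (Hdom h Hh); now apply ex_zeta_series. }
  assert (Hq : forall h n, Cmod h <= r ->
    Cmod (zeta_term (s + h) n - zeta_term s n - h * zeta_dterm s n)
    <= 4 * (K * (Cmod h * Cmod h) * Rpower (INR (S n)) (- 1 - Re s / 2))).
  { intros h n Hh; destruct (Hdom h Hh).
    apply zeta_term_quad; [assumption.. | lra]. }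
  assert (Hd : exists d, is_series (V := C_NormedModule) (zeta_dterm s) d).
  { assert (Hr' : Cmod r <= r) by (rewrite Cmod_R, Rabs_right; lra).
    destruct (Hlh r Hr') as [lr Hlr].
    assert (Hx : ex_series (V := C_NormedModule) (fun n =>
      (zeta_term (s + r) n - zeta_term s n - r * zeta_dterm s n)%C)).
    { apply (@ex_series_le C_AbsRing C_CompleteNormedModule) with (1 := fun n =>
        Hq r n Hr'); eexists; apply Hb. }
    destruct Hx as [x Hx].
    eexists; eapply is_series_ext.
    2: exact (is_series_scal (V := C_NormedModule) (/ r)%C _ _
         (is_series_minus (V := C_NormedModule) _ _ _ _
            (is_series_minus (V := C_NormedModule) _ _ _ _ Hlr Hl) Hx)).
    intros n; simpl.
    change ((/ r * (zeta_term (s + r) n - zeta_term s n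
      - (zeta_term (s + r) n - zeta_term s n - r * zeta_dterm s n)))%C
      = zeta_dterm s n).
    field; intros E; apply RtoC_inj in E; lra. }
  destruct Hd as [d Hd].
  set (w := (1 - s)%C) in *.
  exists (- / (w * w) + d)%C.
  apply is_derive_quad with (r := r)
    (K := 2 / (Cmod w * Cmod w * Cmod w) + 4 * (K * m)); [exact Hr |].
  intros h Hh; destruct (Hlh h Hh) as [lh Hlh'].
  rewrite (proj2 (zeta_unfold _ _ Hlh')), (proj2 (zeta_unfold _ _ Hl)).
  rewrite !zeta_approx_0.
  replace (1 - (s + h))%C with (w - h)%C by (unfold w; ring); fold w.
  replace (1 - / (w - h) + lh - (1 - / w + l) - h * (- / (w * w) + d))%C
    with ((- / (w - h) + / w + h * (/ (w * w))) + (lh - l - h * d))%C by ring.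
  eapply Rle_trans; [apply Cmod_triangle |].
  rewrite Rmult_plus_distr_r; apply Rplus_le_compat.
  - apply inv_quad; [exact N1 | lra].
  - replace (4 * (K * m) * (Cmod h * Cmod h))
      with (4 * (K * (Cmod h * Cmod h) * m)) by ring.
    refine (Cmod_series_le _ _ _ _ (fun n => Hq h n Hh) _ (Hb h)).
    exact (is_series_minus (V := C_NormedModule) _ _ _ _
             (is_series_minus (V := C_NormedModule) _ _ _ _ Hlh' Hl)
             (is_series_scal (V := C_NormedModule) h _ _ Hd)).
Qed.

(* Main.v *)
(** Put [F s = zeta s * zeta ((1+b)/2 - b s) * zeta ((1+c)/2 - c s)], whose
    integral along [Re s = 1/2] is [I_(1,b,c)].  By Cauchy's theorem the line is
    moved to [Re s = 1/4 - 1 / ln T]; a van der Corput bound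
    [zeta (1/2 + iT) = O(T^(1/4))], and its analogues off the critical line, show
    that the horizontal side costs only [O(T^(3/4))].  On the new line the last two
    factors are absolutely convergent Dirichlet series, whose coefficient sums are
    [O(ln T)], and [O(1)] for the one with [b >= 3].  It remains to evaluate
    [J k = \int_1^T zeta (sg + it) k^(it) dt] for the integers [k = m^b n^c].
    Expanding [zeta] by Euler-Maclaurin and integrating in [t] before summing, the
    term [k] of the Dirichlet series gives the main term [T k^(-sg)], the other
    terms up to [T] contribute [sum n^(-sg) / |ln (k / n)| = O(T^(1-sg) ln T)], and
    for [n > T] the difference between sum and integral is controlled by the
    derivative in [n], again with an error [O(T^(1-sg) ln T)] uniform in [k].  So
    [J k = T k^(-sg) + O(T^(3/4) ln T)], and summing over [m, n] gives the theorem;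
    when [b = c = 2] the total [T^(3/4) (ln T)^3] is absorbed by [T^(3/4+eps)]. *)

Require Import Defs.
From Stdlib Require Import Reals Lra Lia.
From Coquelicot Require Import Coquelicot.
Open Scope R_scope.

(** * Finite sums and integrals of complex functions *)

(** The abscissa is dictated by [b = c = 2]: there the arguments of the last two factors have real
    part [1 + 2 / ln T], barely inside absolute convergence, and the displacement [1 / ln T] costs
    only a factor [e] in [T^(3/4)]. Those factors have their poles at the real points [1/2 - 1/(2b)]
    and [1/2 - 1/(2c)], which lie between the two lines. Hence the rectangle starts at height 1, and
    the segment from 0 to 1 stays on the critical line as a constant. Differentiating a vertical
    integral in its abscissa needs Taylor remainders that are uniform along the segment; this is the
    role of [Quad]. The obstacle in the first moment is uniformity in the twist [k = m^b n^c], which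
    runs far beyond [T]. Pointwise in [t] the Euler-Maclaurin remainder has size [|s| n^(-1-sg)],
    which is too large near [n = T]; after integration over [t] it involves [\int e^(ivt) dt] with
    [v = ln (k / u)], which decays like [1 / |v|]. Where [u] is close to [k] the trivial bound is
    used, which is affordable because [n] exceeds [T]. Constants are not optimized: real and
    imaginary parts are bounded separately, at the cost of a factor 2 each time. *)

Fixpoint Csum (f : nat -> C) (n : nat) : C :=
  match n with O => 0 | S k => (Csum f k + f k)%C end.

Fixpoint Rsum (f : nat -> R) (n : nat) : R :=
  match n with O => 0 | S k => Rsum f k + f k end.

Lemma Csum_sum_n (f : nat -> C) n :
  sum_n (G := C_AbelianMonoid) f n = Csum f (S n).
Proof.
  induction n as [|n IH].
  - rewrite sum_O; simpl; ring.
  - rewrite sum_Sn, IH; reflexivity.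
Qed.

Lemma Csum_ext f g n : (forall i, (i < n)%nat -> f i = g i) -> Csum f n = Csum g n.
Proof.
  induction n as [|n IH]; intros H; simpl; [easy |].
  rewrite IH, H; auto.
Qed.

Lemma Csum_scal z f n : Csum (fun i => z * f i)%C n = (z * Csum f n)%C.
Proof. induction n as [|n IH]; simpl; [ring | rewrite IH; ring]. Qed.

Lemma Csum_plus f g n : Csum (fun i => f i + g i)%C n = (Csum f n + Csum g n)%C.
Proof. induction n as [|n IH]; simpl; [ring | rewrite IH; ring]. Qed.

Lemma Csum_mult f g n m :
  (Csum f n * Csum g m)%C = Csum (fun i => Csum (fun j => f i * g j)%C m) n.
Proof.
  induction n as [|n IH]; simpl; [ring |].
  rewrite <- IH, Csum_scal; ring.
Qed.

Lemma Csum_add f p n : Csum f (p + n) = (Csum f p + Csum (fun i => f (p + i)%nat) n)%C.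
Proof.
  induction n as [|n IH]; [rewrite Nat.add_0_r; simpl; ring |].
  rewrite Nat.add_succ_r; simpl; rewrite IH; ring.
Qed.

Lemma Csum_Cconj f n : Csum (fun i => Cconj (f i)) n = Cconj (Csum f n).
Proof.
  induction n as [|n IH]; simpl.
  - unfold Cconj, RtoC; simpl; now rewrite Ropp_0.
  - rewrite IH; unfold Cconj, Cplus; simpl; f_equal; ring.
Qed.

Lemma Rsum_le f g n : (forall i, (i < n)%nat -> f i <= g i) -> Rsum f n <= Rsum g n.
Proof.
  induction n as [|n IH]; intros H; simpl; [lra |].
  apply Rplus_le_compat; auto.
Qed.

Lemma Rsum_ext f g n : (forall i, (i < n)%nat -> f i = g i) -> Rsum f n = Rsum g n.
Proof.
  induction n as [|n IH]; intros H; simpl; [easy |].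
  rewrite IH, H; auto.
Qed.

Lemma Rsum_scal z f n : Rsum (fun i => z * f i) n = z * Rsum f n.
Proof. induction n as [|n IH]; simpl; [ring | rewrite IH; ring]. Qed.

Lemma Rsum_plus f g n : Rsum (fun i => f i + g i) n = Rsum f n + Rsum g n.
Proof. induction n as [|n IH]; simpl; [ring | rewrite IH; ring]. Qed.

Lemma Rsum_add f p n : Rsum f (p + n) = Rsum f p + Rsum (fun i => f (p + i)%nat) n.
Proof.
  induction n as [|n IH]; [rewrite Nat.add_0_r; simpl; ring |].
  rewrite Nat.add_succ_r; simpl; rewrite IH; ring.
Qed.

Lemma Rsum_tele f n : Rsum (fun i => f i - f (S i)) n = f O - f n.
Proof. induction n as [|n IH]; simpl; [ring | rewrite IH; ring]. Qed.

Lemma Rsum_const z n : Rsum (fun _ => z) n = INR n * z.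
Proof. induction n as [|n IH]; [simpl; ring | rewrite S_INR; simpl; rewrite IH; ring]. Qed.

Lemma Rsum_nonneg f n : (forall i, (i < n)%nat -> 0 <= f i) -> 0 <= Rsum f n.
Proof.
  intros H; rewrite <- (Rmult_0_r (INR n)), <- (Rsum_const 0 n).
  now apply Rsum_le.
Qed.

Lemma Rsum_switch (f : nat -> nat -> R) n m :
  Rsum (fun i => Rsum (f i) m) n = Rsum (fun j => Rsum (fun i => f i j) n) m.
Proof.
  induction n as [|n IH]; simpl.
  - rewrite Rsum_const; ring.
  - rewrite IH, <- Rsum_plus; reflexivity.
Qed.

Lemma Rsum_ge_term f n k :
  (forall i, (i < n)%nat -> 0 <= f i) -> (k < n)%nat -> f k <= Rsum f n.
Proof.
  induction n as [|n IH]; intros H Hk; [lia | simpl].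
  destruct (Nat.eq_dec k n) as [-> | Hkn].
  - assert (0 <= Rsum f n) by (apply Rsum_nonneg; auto); lra.
  - assert (f k <= Rsum f n) by (apply IH; [auto | lia]).
    assert (0 <= f n) by auto; lra.
Qed.

Lemma Cmod_Csum_le f g n :
  (forall i, (i < n)%nat -> Cmod (f i) <= g i) -> Cmod (Csum f n) <= Rsum g n.
Proof.
  induction n as [|n IH]; intros H; simpl; [rewrite Cmod_0; lra |].
  eapply Rle_trans; [apply Cmod_triangle |].
  apply Rplus_le_compat; auto.
Qed.

Lemma Cmod_triangle_sub u v : Cmod (u - v) <= Cmod u + Cmod v.
Proof. unfold Cminus; rewrite <- (Cmod_opp v); apply Cmod_triangle. Qed.

Lemma abel_bound (a : nat -> R) (z : nat -> C) n B :
  (forall i, 0 <= a i) -> (forall i, a (S i) <= a i) ->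
  (forall m, (m <= n)%nat -> Cmod (Csum z m) <= B) ->
  Cmod (Csum (fun i => a i * z i)%C n) <= a O * B.
Proof.
  intros Ha Hd HB.
  assert (B0 : 0 <= B).
  { generalize (HB O ltac:(lia)); simpl; rewrite Cmod_0; lra. }
  (* The induction removes the boundary term [a m * Csum z m]; the remaining increments carry the
     weights [a m - a (S m)], which telescope to [a O - a m]. *)
  assert (H : forall m, (m <= n)%nat ->
    Cmod (Csum (fun i => a i * z i)%C m - a m * Csum z m) <= (a O - a m) * B).
  { induction m as [|m IH]; intros Hm; simpl Csum.
    - replace (0 - a O * 0)%C with (RtoC 0) by ring; rewrite Cmod_0; lra.
    - replace (Csum (fun i => a i * z i) m + a m * z m - a (S m) * (Csum z m + z m))%C
        with ((Csum (fun i => a i * z i) m - a m * Csum z m)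
              + (a m - a (S m))%R * (Csum z m + z m))%C
        by (rewrite RtoC_minus; ring).
      eapply Rle_trans; [apply Cmod_triangle |].
      rewrite Cmod_mult, Cmod_R, (Rabs_right (a m - a (S m)))
        by (generalize (Hd m); lra).
      generalize (IH ltac:(lia)) (HB (S m) Hm) (Hd m); simpl Csum; intros.
      nra. }
  replace (Csum (fun i => a i * z i) n)%C
    with ((Csum (fun i => a i * z i) n - a n * Csum z n) + a n * Csum z n)%C by ring.
  eapply Rle_trans; [apply Cmod_triangle |].
  rewrite Cmod_mult, Cmod_R, Rabs_right by (apply Rle_ge, Ha).
  generalize (H n (le_n n)) (HB n (le_n n)) (Ha n); nra.
Qed.

(** * Integrals of complex functions over a real interval *)

Definition CI (f : R -> C) (a b : R) : C :=
  (RInt (fun t => Re (f t)) a b, RInt (fun t => Im (f t)) a b).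

Definition ccont (f : R -> C) (t : R) : Prop :=
  continuous (fun u => Re (f u)) t /\ continuous (fun u => Im (f u)) t.

Lemma cder_ccont f t l : cder f t l -> ccont f t.
Proof. intros [h1 h2]; split; apply (@ex_derive_continuous R_AbsRing R_NormedModule); eexists; eassumption. Qed.

Lemma ccont_const z t : ccont (fun _ => z) t.
Proof. split; apply continuous_const. Qed.

Lemma ccont_plus f g t : ccont f t -> ccont g t -> ccont (fun u => f u + g u)%C t.
Proof.
  intros [a b] [c d]; split.
  - exact (continuous_plus _ _ _ a c).
  - exact (continuous_plus _ _ _ b d).
Qed.

Lemma ccont_opp f t : ccont f t -> ccont (fun u => - f u)%C t.
Proof.
  intros [a b]; split.
  - exact (continuous_opp _ _ a).
  - exact (continuous_opp _ _ b).
Qed.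

Lemma ccont_minus f g t : ccont f t -> ccont g t -> ccont (fun u => f u - g u)%C t.
Proof. intros a b; apply ccont_plus; [exact a | now apply ccont_opp]. Qed.

Lemma ccont_mult f g t : ccont f t -> ccont g t -> ccont (fun u => f u * g u)%C t.
Proof.
  intros [a b] [c d]; split.
  - exact (continuous_minus _ _ _ (continuous_mult (K := R_AbsRing) _ _ _ a c)
             (continuous_mult (K := R_AbsRing) _ _ _ b d)).
  - exact (continuous_plus _ _ _ (continuous_mult (K := R_AbsRing) _ _ _ a d)
             (continuous_mult (K := R_AbsRing) _ _ _ b c)).
Qed.

Lemma ccont_Csum (f : nat -> R -> C) n t :
  (forall i, (i < n)%nat -> ccont (f i) t) -> ccont (fun u => Csum (fun i => f i u) n) t.
Proof.
  induction n as [|n IH]; intros H; simpl; [apply ccont_const |].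
  apply ccont_plus; auto.
Qed.

Lemma ccont_int f a b :
  a <= b -> (forall t, a <= t <= b -> ccont f t) ->
  ex_RInt (fun t => Re (f t)) a b /\ ex_RInt (fun t => Im (f t)) a b.
Proof.
  intros Hab H; split; apply (@ex_RInt_continuous R_CompleteNormedModule);
    rewrite Rmin_left, Rmax_right by lra; intros; apply H; assumption.
Qed.

Lemma im_le_Cmod z : Rabs (Im z) <= Cmod z.
Proof. eapply Rle_trans; [| apply Rmax_Cmod]; apply Rmax_r. Qed.

(** A remainder with a fixed constant survives integration over a parameter, which a bare limit does
    not; hence this criterion for derivatives. *)
Lemma cder_quad (g : R -> C) u0 l r L :
  0 < r ->
  (forall h, Rabs h <= r -> Cmod (g (u0 + h)%R - g u0 - h * l) <= L * (h * h)) ->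
  cder g u0 l.
Proof.
  intros Hr H.
  assert (HL : 0 <= L).
  { generalize (H r) (Cmod_ge_0 (g (u0 + r)%R - g u0 - r * l)).
    rewrite Rabs_right by lra; intros H1 H2.
    apply (Rmult_le_reg_r (r * r)); [nra | rewrite Rmult_0_l].
    eapply Rle_trans; [exact H2 | apply H1; lra]. }
  assert (R : forall (g : R -> R) l,
    (forall h, Rabs h <= r -> Rabs (g (u0 + h) - g u0 - h * l) <= L * (h * h)) ->
    is_derive g u0 l).
  { clear g l H; intros g l Hg; apply is_derive_Reals; intros eps Heps.
    assert (Hd : 0 < Rmin r (eps / (L + 1))).
    { apply Rmin_glb_lt; [exact Hr | apply Rdiv_lt_0_compat; lra]. }
    exists (mkposreal _ Hd); intros h Hh0 Hh; simpl in Hh.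
    assert (H1 := Rmin_l r (eps / (L + 1))); assert (H2 := Rmin_r r (eps / (L + 1))).
    assert (P : 0 < Rabs h) by (apply Rabs_pos_lt, Hh0).
    replace ((g (u0 + h) - g u0) / h - l) with ((g (u0 + h) - g u0 - h * l) * / h)
      by (field; exact Hh0).
    rewrite Rabs_mult, Rabs_inv.
    apply (Rmult_lt_reg_r (Rabs h)); [exact P |].
    rewrite Rmult_assoc, Rinv_l, Rmult_1_r by lra.
    eapply Rle_lt_trans; [apply Hg; lra |].
    replace (h * h) with (Rabs h * Rabs h) by (rewrite <- Rabs_mult, Rabs_right; nra).
    rewrite <- Rmult_assoc; apply Rmult_lt_compat_r; [exact P |].
    apply Rle_lt_trans with (L * (eps / (L + 1))); [apply Rmult_le_compat_l; lra |].
    apply (Rmult_lt_reg_r (L + 1)); [lra |].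
    replace (L * (eps / (L + 1)) * (L + 1)) with (L * eps) by (field; lra); nra. }
  split; apply R; intros h Hh; (eapply Rle_trans; [| apply (H h Hh)]).
  - eapply Rle_trans; [| apply re_le_Cmod].
    right; f_equal; simpl; unfold Re; simpl; ring.
  - eapply Rle_trans; [| apply im_le_Cmod].
    right; f_equal; simpl; unfold Im; simpl; ring.
Qed.

Section ComplexIntegral.
Variables (a b : R).
Hypothesis Hab : a <= b.

Lemma CI_ext f g : (forall t, a <= t <= b -> f t = g t) -> CI f a b = CI g a b.
Proof.
  intros H; unfold CI; f_equal; apply RInt_ext;
    rewrite Rmin_left, Rmax_right by lra; intros; rewrite H; lra.
Qed.

Lemma CI_plus f g :
  (forall t, a <= t <= b -> ccont f t) -> (forall t, a <= t <= b -> ccont g t) ->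
  CI (fun t => f t + g t)%C a b = (CI f a b + CI g a b)%C.
Proof.
  intros Hf Hg; destruct (ccont_int f a b Hab Hf), (ccont_int g a b Hab Hg).
  unfold CI, Cplus; simpl fst; simpl snd; f_equal.
  - now apply (@RInt_plus R_CompleteNormedModule).
  - now apply (@RInt_plus R_CompleteNormedModule).
Qed.

Lemma CI_scal z f :
  (forall t, a <= t <= b -> ccont f t) -> CI (fun t => z * f t)%C a b = (z * CI f a b)%C.
Proof.
  intros Hf; destruct (ccont_int f a b Hab Hf) as [h1 h2].
  unfold CI, Cmult; simpl fst; simpl snd; f_equal.
  - rewrite (@RInt_minus R_CompleteNormedModule (fun t => scal (fst z) (fst (f t)))
               (fun t => scal (snd z) (snd (f t)))), !(@RInt_scal R_CompleteNormedModule);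
      try assumption; try reflexivity; now apply (@ex_RInt_scal R_NormedModule).
  - rewrite (@RInt_plus R_CompleteNormedModule (fun t => scal (fst z) (snd (f t)))
               (fun t => scal (snd z) (fst (f t)))), !(@RInt_scal R_CompleteNormedModule);
      try assumption; try reflexivity; now apply (@ex_RInt_scal R_NormedModule).
Qed.

Lemma CI_const z : CI (fun _ => z) a b = (z * (b - a)%R)%C.
Proof.
  unfold CI; rewrite !RInt_const; unfold Cmult, Re, Im; simpl.
  change scal with Rmult; f_equal; ring.
Qed.

Lemma CI_minus f g :
  (forall t, a <= t <= b -> ccont f t) -> (forall t, a <= t <= b -> ccont g t) ->
  CI (fun t => f t - g t)%C a b = (CI f a b - CI g a b)%C.
Proof.
  intros Hf Hg.
  rewrite <- (CI_ext (fun t => f t + (- (1)) * g t)%C) by (intros; ring).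
  rewrite CI_plus, CI_scal; [ring | assumption.. |].
  intros; apply ccont_mult; [apply ccont_const | auto].
Qed.

Lemma CI_Csum (f : nat -> R -> C) n :
  (forall i t, (i < n)%nat -> a <= t <= b -> ccont (f i) t) ->
  CI (fun t => Csum (fun i => f i t) n) a b = Csum (fun i => CI (f i) a b) n.
Proof.
  induction n as [|n IH]; intros H; simpl.
  - rewrite CI_const; ring.
  - rewrite CI_plus, IH; auto.
    intros; apply ccont_Csum; auto.
Qed.

(** The factor 2 comes from bounding the two components separately. *)
Lemma CI_bound f M :
  (forall t, a <= t <= b -> ccont f t) -> (forall t, a <= t <= b -> Cmod (f t) <= M) ->
  Cmod (CI f a b) <= 2 * M * (b - a).
Proof.
  intros Hf HM; destruct (ccont_int f a b Hab Hf) as [h1 h2].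
  eapply Rle_trans; [apply Cmod_le_sum |].
  assert (Rabs (Re (CI f a b)) <= (b - a) * M).
  { apply abs_RInt_le_const; [assumption.. |].
    intros t Ht; eapply Rle_trans; [apply re_le_Cmod | auto]. }
  assert (Rabs (Im (CI f a b)) <= (b - a) * M).
  { apply abs_RInt_le_const; [assumption.. |].
    intros t Ht; eapply Rle_trans; [apply im_le_Cmod | apply HM, Ht]. }
  lra.
Qed.

(** For majorants that are not constant, such as the [/ t] of the pole term: given an explicit
    primitive [G], the comparison ends in boundary values. *)
Lemma CI_bound_primitive f (G g : R -> R) :
  (forall t, a <= t <= b -> ccont f t) ->
  (forall t, a <= t <= b -> is_derive G t (g t)) ->
  (forall t, a <= t <= b -> continuous g t) ->
  (forall t, a <= t <= b -> Cmod (f t) <= g t) ->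
  Cmod (CI f a b) <= 2 * (G b - G a).
Proof.
  intros Hf HG Hg HM; destruct (ccont_int f a b Hab Hf) as [h1 h2].
  assert (I : is_RInt g a b (G b - G a)).
  { apply (@is_RInt_derive R_CompleteNormedModule G g);
      rewrite Rmin_left, Rmax_right by lra; auto. }
  assert (K : forall u : R -> R, ex_RInt u a b ->
             (forall t, a <= t <= b -> Rabs (u t) <= Cmod (f t)) ->
             Rabs (RInt u a b) <= G b - G a).
  { intros u Hu Hle; eapply Rle_trans; [apply abs_RInt_le; assumption |].
    rewrite <- (is_RInt_unique _ _ _ _ I).
    apply RInt_le; [assumption | | eexists; exact I |].
    - apply (ex_RInt_norm u), Hu.
    - intros t Ht; eapply Rle_trans; [apply Hle; lra | apply HM; lra]. }
  eapply Rle_trans; [apply Cmod_le_sum |].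
  assert (Rabs (Re (CI f a b)) <= G b - G a).
  { apply K; [assumption |]; intros; apply re_le_Cmod. }
  assert (Rabs (Im (CI f a b)) <= G b - G a).
  { apply K; [assumption |]; intros.
    apply im_le_Cmod. }
  lra.
Qed.

Lemma CI_FTC F f :
  (forall t, a <= t <= b -> cder F t (f t)) -> (forall t, a <= t <= b -> ccont f t) ->
  CI f a b = (F b - F a)%C.
Proof.
  intros HF Hf; unfold CI, Cminus, Cplus, Copp; simpl; f_equal; apply is_RInt_unique.
  - apply (@is_RInt_derive R_CompleteNormedModule (fun t => Re (F t)) (fun t => Re (f t)));
      rewrite Rmin_left, Rmax_right by lra; intros t Ht; [apply HF | apply Hf]; exact Ht.
  - apply (@is_RInt_derive R_CompleteNormedModule (fun t => Im (F t)) (fun t => Im (f t)));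
      rewrite Rmin_left, Rmax_right by lra; intros t Ht; [apply HF | apply Hf]; exact Ht.
Qed.

(* A quadratic Taylor bound uniform in [t] allows differentiation under the integral. *)
Lemma CI_param (f f' : R -> R -> C) u0 r K :
  0 < r ->
  (forall h t, Rabs h <= r -> a <= t <= b ->
     Cmod (f (u0 + h) t - f u0 t - h * f' u0 t) <= K * (h * h)) ->
  (forall h t, Rabs h <= r -> a <= t <= b -> ccont (f (u0 + h)) t) ->
  (forall t, a <= t <= b -> ccont (f' u0) t) ->
  cder (fun u => CI (f u) a b) u0 (CI (f' u0) a b).
Proof.
  intros Hr HK Hc Hc'.
  assert (Hc0 : forall t, a <= t <= b -> ccont (f u0) t).
  { intros t Ht; generalize (Hc 0 t); rewrite Rplus_0_r, Rabs_R0; intros H.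
    apply H; [lra | exact Ht]. }
  set (L := 2 * Rabs K * (b - a)).
  assert (HL : 0 <= L) by (unfold L; generalize (Rabs_pos K); nra).
  assert (H : forall h, Rabs h <= r ->
    Cmod (CI (f (u0 + h)%R) a b - CI (f u0) a b - h * CI (f' u0) a b) <= L * (h * h)).
  { intros h Hh.
    rewrite <- CI_scal, <- !CI_minus; auto.
    - replace (L * (h * h)) with (2 * (Rabs K * (h * h)) * (b - a)) by (unfold L; ring).
      apply CI_bound.
      + intros; apply ccont_minus; [apply ccont_minus; auto |].
        apply ccont_mult; [apply ccont_const | auto].
      + intros t Ht; eapply Rle_trans; [apply HK; auto |].
        generalize (Rle_abs K); nra.
    - intros; apply ccont_minus; auto.
    - intros; apply ccont_mult; [apply ccont_const | auto]. }
  apply (cder_quad _ _ _ r L Hr), H.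
Qed.

End ComplexIntegral.

Lemma CI_Chasles f a b c :
  a <= b <= c -> (forall t, a <= t <= c -> ccont f t) ->
  CI f a c = (CI f a b + CI f b c)%C.
Proof.
  intros H Hf.
  destruct (ccont_int f a b) as [h1 h2]; [lra | intros; apply Hf; lra |].
  destruct (ccont_int f b c) as [h3 h4]; [lra | intros; apply Hf; lra |].
  unfold CI, Cplus; simpl; f_equal; symmetry;
    now apply (@RInt_Chasles R_CompleteNormedModule).
Qed.

(** The bridge to the vector-valued integral of the statement; all other work is done with two real
    integrals. *)
Lemma CI_RInt f a b :
  a <= b -> (forall t, a <= t <= b -> ccont f t) ->
  RInt (V := C_R_CompleteNormedModule) f a b = CI f a b.
Proof.
  intros Hab Hf; destruct (ccont_int f a b Hab Hf) as [h1 h2].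
  apply is_RInt_unique.
  apply (@is_RInt_fct_extend_pair R_NormedModule R_NormedModule);
    now apply (@RInt_correct R_CompleteNormedModule).
Qed.

(** * Bounds and Taylor expansion of zeta *)

Lemma Rsum_Rpower_tail tau p n :
  0 < tau ->
  Rsum (fun i => Rpower (INR (S (S (p + i)))) (- 1 - tau)) n
  <= / tau * Rpower (INR (S p)) (- tau).
Proof.
  intros Ht.
  apply Rle_trans with (Rsum (fun i => / tau * (Rpower (INR (S (p + i))) (- tau)
                         - Rpower (INR (S (p + S i))) (- tau))) n).
  - apply Rsum_le; intros i _; rewrite Nat.add_succ_r; now apply Rpower_tele.
  - rewrite Rsum_scal, (Rsum_tele (fun i => Rpower (INR (S (p + i))) (- tau))), Nat.add_0_r.
    apply Rmult_le_compat_l; [apply Rlt_le, Rinv_0_lt_compat, Ht |].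
    generalize (exp_pos (- tau * ln (INR (S (p + n))))); unfold Rpower; lra.
Qed.

Lemma Rpower_base1 y : Rpower 1 y = 1.
Proof. unfold Rpower; rewrite ln_1, Rmult_0_r; apply exp_0. Qed.

Lemma INR_S_ge1 n : 1 <= INR (S n).
Proof. rewrite S_INR; generalize (pos_INR n); lra. Qed.

(** The telescoping comparison reaches back one step, so the first term is split off; it accounts
    for the [1] in [1 + / tau]. *)
Lemma Rsum_Rpower_le tau p n :
  0 < tau ->
  Rsum (fun i => Rpower (INR (S (p + i))) (- 1 - tau)) n
  <= (1 + / tau) * Rpower (INR (S p)) (- tau).
Proof.
  intros Ht; assert (Hi := Rinv_0_lt_compat _ Ht).
  assert (Hp : 0 < Rpower (INR (S p)) (- tau)) by apply exp_pos.
  destruct n as [|n]; [change (0 <= (1 + / tau) * Rpower (INR (S p)) (- tau)); apply Rmult_le_pos; lra |].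
  change (S n) with (1 + n)%nat; rewrite Rsum_add.
  rewrite (Rsum_ext _ (fun i => Rpower (INR (S (S (p + i)))) (- 1 - tau)) n)
    by (intros; do 2 f_equal; lia).
  generalize (Rsum_Rpower_tail tau p n Ht); intros H.
  cbn [Rsum]; rewrite Nat.add_0_r.
  assert (Rpower (INR (S p)) (- 1 - tau) <= Rpower (INR (S p)) (- tau)).
  { unfold Rpower; apply exp_le.
    assert (0 <= ln (INR (S p))) by (rewrite <- ln_1; apply ln_le; [lra | apply INR_S_ge1]).
    nra. }
  lra.
Qed.

Lemma Clim_le (u : nat -> C) (l z : C) B N :
  filterlim u eventually (locally l) ->
  (forall n, (N <= n)%nat -> Cmod (u n - z) <= B) -> Cmod (l - z) <= B.
Proof.
  intros Hu HB.
  assert (L : is_lim_seq (fun n => Cmod (u n - z)) (Cmod (l - z))).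
  { apply (filterlim_comp _ _ _ (fun n => plus (u n : C_NormedModule) (opp z)) (@norm _ C_NormedModule)
             _ (locally (plus (l : C_NormedModule) (opp z)))).
    - eapply filterlim_comp_2;
        [exact Hu | apply filterlim_const | apply (@filterlim_plus _ C_NormedModule)].
    - apply (@filterlim_norm _ C_NormedModule). }
  refine (is_lim_seq_le_loc _ (fun _ => B) (Cmod (l - z)) B _ L (is_lim_seq_const B)).
  exists N; exact HB.
Qed.

Lemma zeta_approx_add s N k :
  zeta_approx s (N + k) = (zeta_approx s N + Csum (fun i => zeta_term s (N + i)) k)%C.
Proof.
  assert (H : forall m, zeta_approx s m = (zeta_approx s 0 + Csum (zeta_term s) m)%C).
  { intros [|m]; [simpl Csum; ring |].
    rewrite zeta_approx_sum; f_equal; apply Csum_sum_n. }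
  rewrite H, (H N), Csum_add; ring.
Qed.

(** Sums the termwise bounds [zeta_term_le] beyond [N]. Because of the factor [Cmod s] it is small
    only when [N] exceeds a power of the height. *)
Lemma zeta_tail (s : C) N :
  0 < Re s -> s <> 1%C ->
  Cmod (zeta s - zeta_approx s N)
  <= 4 * Cmod s * (1 + / Re s) * Rpower (INR (S N)) (- Re s).
Proof.
  intros Hs H1.
  apply (Clim_le (zeta_approx s) _ _ _ N); [now apply zeta_approx_lim |].
  intros n Hn; replace n with (N + (n - N))%nat by lia.
  rewrite zeta_approx_add.
  assert (E : forall u v : C, (u + v - u)%C = v) by (intros; ring); rewrite E.
  eapply Rle_trans.
  { apply Cmod_Csum_le; intros i _; apply zeta_term_le; assumption. }
  rewrite (Rsum_ext _ (fun i => (4 * Cmod s) * Rpower (INR (S (N + i))) (- 1 - Re s)))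
    by (intros; ring).
  rewrite Rsum_scal, (Rmult_assoc (4 * Cmod s)).
  apply Rmult_le_compat_l; [generalize (Cmod_ge_0 s); lra |].
  now apply Rsum_Rpower_le.
Qed.

(** The truncation at [N = 0], where [zeta_approx] is [1 - / (1 - s)]. The growth is linear in the
    height, which suffices wherever only a finite bound matters. *)
Lemma zeta_crude (s : C) :
  0 < Re s -> s <> 1%C ->
  Cmod (zeta s) <= 1 + / Cmod (1 - s) + 4 * Cmod s * (1 + / Re s).
Proof.
  intros Hs H1; assert (H := zeta_tail s 0 Hs H1).
  rewrite Rpower_base1, Rmult_1_r, zeta_approx_0 in H.
  replace (zeta s) with ((zeta s - (1 - / (1 - s))) + (1 - / (1 - s)))%C by ring.
  eapply Rle_trans; [apply Cmod_triangle |].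
  assert (Cmod (1 - / (1 - s)) <= 1 + / Cmod (1 - s)).
  { eapply Rle_trans; [apply Cmod_triangle_sub |].
    rewrite Cmod_1, Cmod_inv by now apply Cminus1_neq.
    lra. }
  lra.
Qed.

(** Convergence of the differentiated series comes for free: at [h = r] each [d0 n] is [/ r] times a
    difference of two summable terms minus a remainder dominated by [b]. The termwise remainders are
    then summed. *)
Lemma zeta_term_series_taylor (s : C) (r K : R) (d0 : nat -> C) l (lh : C -> C) (b : nat -> R) m :
  0 < r ->
  is_series (V := C_NormedModule) (zeta_term s) l ->
  (forall h, Cmod h <= r -> is_series (V := C_NormedModule) (zeta_term (s + h)%C) (lh h)) ->
  (forall h n, Cmod h <= r ->
    Cmod (zeta_term (s + h) n - zeta_term s n - h * d0 n)%C <= (Cmod h * Cmod h) * b n) ->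
  is_series b m ->
  exists d, forall h, Cmod h <= r -> Cmod (lh h - l - h * d)%C <= (Cmod h * Cmod h) * m.
Proof.
  intros Hr Hl Hlh Hq Hm.
  assert (Hb : forall h, is_series (fun n => (Cmod h * Cmod h) * b n) ((Cmod h * Cmod h) * m)).
  { intros h; apply (@is_series_scal R_AbsRing R_NormedModule (Cmod h * Cmod h)), Hm. }
  assert (Hd : exists d, is_series (V := C_NormedModule) d0 d).
  { assert (Hr' : Cmod r <= r) by (rewrite Cmod_R, Rabs_right; lra).
    destruct (@ex_series_le C_AbsRing C_CompleteNormedModule _ _ (fun n => Hq r n Hr')
                (ex_intro _ _ (Hb r))) as [x Hx].
    eexists; eapply is_series_ext.
    2: exact (is_series_scal (V := C_NormedModule) (/ r)%C _ _
         (is_series_minus (V := C_NormedModule) _ _ _ _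
            (is_series_minus (V := C_NormedModule) _ _ _ _ (Hlh _ Hr') Hl) Hx)).
    intros n; simpl.
    change ((/ r * (zeta_term (s + r) n - zeta_term s n
      - (zeta_term (s + r) n - zeta_term s n - r * d0 n)))%C = d0 n).
    field; intros E; apply RtoC_inj in E; lra. }
  destruct Hd as [d Hd]; exists d; intros h Hh.
  refine (Cmod_series_le _ _ _ _ (fun n => Hq h n Hh) _ (Hb h)).
  exact (is_series_minus (V := C_NormedModule) _ _ _ _
           (is_series_minus (V := C_NormedModule) _ _ _ _ (Hlh h Hh) Hl)
           (is_series_scal (V := C_NormedModule) h _ _ Hd)).
Qed.

(** Holomorphy in quantitative form: one constant and one radius serve all of [P], and [s + h] may
    leave [P]. This uniformity allows differentiation under an integral and is stable under products
    and affine substitutions. *)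
Definition Quad (P : C -> Prop) (f f' : C -> C) : Prop :=
  exists K r, 0 < r /\ 0 <= K /\ forall s, P s ->
    Cmod (f s) <= K /\ Cmod (f' s) <= K /\
    forall h, Cmod h <= r -> Cmod (f (s + h)%C - f s - h * f' s) <= K * (Cmod h * Cmod h).

Lemma Quad_zeta rho B :
  0 < rho ->
  Quad (fun s => rho <= Re s /\ 1 / 2 <= Rabs (Im s) /\ Cmod s <= B) zeta (C_derive zeta).
Proof.
  intros Hrho.
  (* The radius keeps [s + h] in [Re >= rho / 2] and at distance at least [1/4] from the pole;
     [rho / 4] is also what [zeta_term_quad] asks for. *)
  set (r := Rmin (rho / 4) (1 / 4)).
  assert (R1 := Rmin_l (rho / 4) (1 / 4)); assert (R2 := Rmin_r (rho / 4) (1 / 4)); fold r in R1, R2.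
  assert (Hr : 0 < r) by (apply Rmin_glb_lt; lra).
  set (K0 := 256 * Rabs B / (rho * rho) + 16 / rho).
  destruct (ex_series_Rpower (rho / 2) ltac:(lra)) as [m Hm].
  set (Kz := 1 + 2 + 4 * Rabs B * (1 + / rho)).
  set (Kq := 16 + 4 * (K0 * m)).
  (* The three summands bound [zeta], its Taylor remainder and its derivative; the last is obtained
     by dividing the Taylor estimate at [h = r] by [r]. *)
  set (K := Rabs Kz + Rabs Kq + (2 * Rabs (1 + 4 + 4 * (Rabs B + r) * (1 + 2 / rho)) + Rabs Kq * (r * r)) / r).
  assert (Hirho := Rinv_0_lt_compat _ Hrho).
  assert (P1 := Rabs_pos Kz); assert (P2 := Rabs_pos Kq).
  assert (P3 := Rabs_pos (1 + 4 + 4 * (Rabs B + r) * (1 + 2 / rho))).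
  assert (P4 : 0 <= (2 * Rabs (1 + 4 + 4 * (Rabs B + r) * (1 + 2 / rho)) + Rabs Kq * (r * r)) / r).
  { apply Rmult_le_pos; [| apply Rlt_le, Rinv_0_lt_compat, Hr].
    apply Rplus_le_le_0_compat; [lra | apply Rmult_le_pos; [lra | nra]]. }
  exists K, r; split; [exact Hr |].
  split; [unfold K; lra |].
  intros s [Hs [Hi Hb]].
  assert (HB : Cmod s <= Rabs B) by (generalize (Rle_abs B); lra).
  assert (Hdom : forall h, Cmod h <= r ->
            rho / 2 <= Re (s + h) /\ 1 / 4 <= Cmod (1 - (s + h)) /\ (s + h)%C <> 1%C).
  { intros h Hh.
    assert (T1 : Rabs (Re h) <= Cmod h) by apply re_le_Cmod.
    assert (T2 := im_le_Cmod h).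
    assert (T3 := im_le_Cmod (1 - (s + h))).
    assert (T4 : Im (1 - (s + h)) = - (Im s + Im h)) by (simpl; unfold Im; simpl; ring).
    assert (T5 : 1 / 4 <= Cmod (1 - (s + h))).
    { rewrite T4, Rabs_Ropp in T3.
      generalize (Rabs_triang (Im s + Im h) (- Im h)).
      replace (Im s + Im h + - Im h) with (Im s) by ring; rewrite Rabs_Ropp; lra. }
    split; [| split; [exact T5 |]].
    - rewrite re_plus; generalize (Rle_abs (- Re h)); rewrite Rabs_Ropp; lra.
    - intros E; rewrite E in T5.
      replace (1 - 1)%C with (RtoC 0) in T5 by ring; rewrite Cmod_0 in T5; lra. }
  assert (H0 : s <> 1%C).
  { intros E; subst s; simpl in Hi; rewrite Rabs_R0 in Hi; lra. }
  assert (Hw2 : 1 / 2 <= Cmod (1 - s)).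
  { assert (T3 := im_le_Cmod (1 - s)).
    replace (Im (1 - s)) with (- Im s) in T3 by (simpl; unfold Im; simpl; ring).
    rewrite Rabs_Ropp in T3; lra. }
  assert (Hcr : forall u, rho / 2 <= Re u -> u <> 1%C -> 1 / 4 <= Cmod (1 - u) ->
                 Cmod u <= Rabs B + r ->
                 Cmod (zeta u) <= 1 + 4 + 4 * (Rabs B + r) * (1 + 2 / rho)).
  { intros u U1 U2 U3 U4.
    eapply Rle_trans; [apply zeta_crude; [lra | exact U2] |].
    assert (/ Cmod (1 - u) <= 4).
    { replace 4 with (/ (1 / 4)) by field; apply Rinv_le_contravar; lra. }
    assert (/ Re u <= 2 / rho).
    { replace (2 / rho) with (/ (rho / 2)) by (field; lra); apply Rinv_le_contravar; lra. }
    assert (0 < / Re u) by (apply Rinv_0_lt_compat; lra).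
    assert (4 * Cmod u * (1 + / Re u) <= 4 * (Rabs B + r) * (1 + 2 / rho)).
    { generalize (Cmod_ge_0 u); intros; apply Rmult_le_compat; lra. }
    lra. }
  destruct (ex_zeta_series s ltac:(lra) H0) as [l Hl].
  set (lh := fun h => (zeta (s + h) - zeta_approx (s + h)%C 0)%C).
  assert (Hlh : forall h, Cmod h <= r ->
            is_series (V := C_NormedModule) (zeta_term (s + h)%C) (lh h)).
  { intros h Hh; destruct (Hdom h Hh) as [D1 [D2 D3]].
    destruct (ex_zeta_series (s + h) ltac:(lra) D3) as [x Hx].
    unfold lh; rewrite (proj2 (zeta_unfold _ _ Hx)).
    assert (E : forall u v : C, (u + v - u)%C = v) by (intros; ring); rewrite E; exact Hx. }
  destruct (zeta_term_series_taylor s r 0 (zeta_dterm s) l lh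
     (fun n => (4 * K0) * Rpower (INR (S n)) (- 1 - rho / 2)) ((4 * K0) * m)) as [d Hd];
    [exact Hr | exact Hl | exact Hlh | |
     apply (@is_series_scal R_AbsRing R_NormedModule (4 * K0)), Hm |].
  { intros h n Hh; destruct (Hdom h Hh) as [D1 [D2 D3]].
    eapply Rle_trans; [apply zeta_term_quad; [lra | exact H0 | exact D3 | lra] |].
    assert (A1 : 256 * Cmod s / (Re s * Re s) + 16 / Re s <= K0).
    { unfold K0; apply Rplus_le_compat.
      - apply Rmult_le_compat.
        + generalize (Cmod_ge_0 s); lra.
        + apply Rlt_le, Rinv_0_lt_compat; nra.
        + lra.
        + apply Rinv_le_contravar; nra.
      - apply Rmult_le_compat_l; [lra |]; apply Rinv_le_contravar; lra. }
    assert (A2 : Rpower (INR (S n)) (- 1 - Re s / 2) <= Rpower (INR (S n)) (- 1 - rho / 2)).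
    { unfold Rpower; apply exp_le.
      assert (0 <= ln (INR (S n))) by (rewrite <- ln_1; apply ln_le; [lra | apply INR_S_ge1]).
      nra. }
    assert (A3 : 0 < Rpower (INR (S n)) (- 1 - Re s / 2)) by apply exp_pos.
    assert (A4 : 0 <= 256 * Cmod s / (Re s * Re s) + 16 / Re s).
    { apply Rplus_le_le_0_compat; apply Rmult_le_pos; try lra.
      - generalize (Cmod_ge_0 s); lra.
      - apply Rlt_le, Rinv_0_lt_compat; nra.
      - apply Rlt_le, Rinv_0_lt_compat; nra. }
    assert (A5 := Cmod_ge_0 h).
    set (c := 256 * Cmod s / _ + _) in *; set (p := Rpower _ (- 1 - Re s / 2)) in *.
    set (q := Rpower _ (- 1 - rho / 2)) in *.
    assert (A6 : c * p <= K0 * q) by (apply Rmult_le_compat; lra).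
    replace (4 * (c * (Cmod h * Cmod h) * p)) with (Cmod h * Cmod h * (4 * (c * p))) by ring.
    apply Rmult_le_compat_l; [nra | lra]. }
  set (w := (1 - s)%C) in *.
  assert (Hw0 : w <> 0%C) by now apply Cminus1_neq.
  (* The derivative is that of [zeta_approx s 0 = 1 - / (1 - s)] plus that of the series. *)
  assert (Hq : forall h, Cmod h <= r ->
    Cmod (zeta (s + h)%C - zeta s - h * (- / (w * w) + d)) <= Kq * (Cmod h * Cmod h)).
  { intros h Hh.
    replace (zeta (s + h) - zeta s - h * (- / (w * w) + d))%C
      with ((- / (w - h) + / w + h * (/ (w * w))) + (lh h - l - h * d))%C.
    2: { unfold lh; rewrite (proj2 (zeta_unfold _ _ Hl)), !zeta_approx_0.
         replace (1 - (s + h))%C with (w - h)%C by (unfold w; ring); fold w; ring. }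
    eapply Rle_trans; [apply Cmod_triangle |].
    unfold Kq; rewrite Rmult_plus_distr_r; apply Rplus_le_compat.
    - eapply Rle_trans; [apply inv_quad; [exact Hw0 | lra] |].
      apply Rmult_le_compat_r; [generalize (Cmod_ge_0 h); nra |].
      assert (Q : 1 / 8 <= Cmod w * Cmod w * Cmod w).
      { assert (1 / 4 <= Cmod w * Cmod w) by nra; nra. }
      replace 16 with (2 * / (1 / 8)) by field.
      apply Rmult_le_compat_l; [lra |]; apply Rinv_le_contravar; lra.
    - generalize (Hd h Hh); lra. }
  assert (Hder : C_derive zeta s = (- / (w * w) + d)%C).
  { apply is_C_derive_unique, (is_derive_quad _ _ _ r Kq Hr), Hq. }
  rewrite Hder; split; [| split].
  - eapply Rle_trans; [apply zeta_crude; [lra | exact H0] |].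
    fold w; apply Rle_trans with Kz; [unfold Kz | unfold K; generalize (Rle_abs Kz); lra].
    assert (/ Cmod w <= 2).
    { replace 2 with (/ (1 / 2)) by field; apply Rinv_le_contravar; lra. }
    assert (/ Re s <= / rho) by (apply Rinv_le_contravar; lra).
    assert (0 < / Re s) by (apply Rinv_0_lt_compat; lra).
    assert (4 * Cmod s * (1 + / Re s) <= 4 * Rabs B * (1 + / rho)).
    { generalize (Cmod_ge_0 s); intros; apply Rmult_le_compat; lra. }
    lra.
  - assert (Hr' : Cmod r <= r) by (rewrite Cmod_R, Rabs_right; lra).
    destruct (Hdom r Hr') as [D1 [D2 D3]].
    set (M := 1 + 4 + 4 * (Rabs B + r) * (1 + 2 / rho)) in *.
    assert (C1 : Cmod (zeta (s + r)) <= M).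
    { apply Hcr; try assumption.
      eapply Rle_trans; [apply Cmod_triangle | lra]. }
    assert (C2 : Cmod (zeta s) <= M) by (apply Hcr; [lra | exact H0 | unfold w in Hw2; lra | lra]).
    assert (C3 := Hq r Hr').
    assert (C4 : r * Cmod (- / (w * w) + d) <= 2 * Rabs M + Rabs Kq * (r * r)).
    { rewrite <- (Rabs_right r) at 1 by lra; rewrite <- Cmod_R, <- Cmod_mult.
      replace (r * (- / (w * w) + d))%C with (zeta (s + r) - zeta s
        - (zeta (s + r) - zeta s - r * (- / (w * w) + d)))%C by ring.
      eapply Rle_trans; [apply Cmod_triangle_sub |].
      assert (C5 := Cmod_triangle_sub (zeta (s + r)) (zeta s)).
      rewrite Cmod_R, Rabs_right in C3 by lra.
      generalize (Rle_abs M) (Rle_abs Kq); nra. }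
    apply Rle_trans with ((2 * Rabs M + Rabs Kq * (r * r)) / r).
    + apply (Rmult_le_reg_l r); [exact Hr |].
      eapply Rle_trans; [exact C4 | right; field; lra].
    + unfold K; lra.
  - intros h Hh; eapply Rle_trans; [apply Hq, Hh |].
    apply Rmult_le_compat_r; [generalize (Cmod_ge_0 h); nra |].
    unfold K; generalize (Rle_abs Kq); lra.
Qed.

(** * Shifting the line of integration *)

Lemma Quad_weaken (P Q : C -> Prop) f f' :
  (forall s, P s -> Q s) -> Quad Q f f' -> Quad P f f'.
Proof. intros H [K [r [Hr [HK HQ]]]]; exists K, r; auto. Qed.

Lemma Quad_step (f f' : C -> C) s h K r :
  0 <= K -> Cmod h <= r -> Cmod (f' s) <= K ->
  Cmod (f (s + h)%C - f s - h * f' s) <= K * (Cmod h * Cmod h) ->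
  Cmod (f (s + h)%C - f s) <= K * (1 + r) * Cmod h.
Proof.
  intros HK Hh H1 H2.
  replace (f (s + h)%C - f s)%C with ((f (s + h)%C - f s - h * f' s) + h * f' s)%C by ring.
  eapply Rle_trans; [apply Cmod_triangle |]; rewrite Cmod_mult.
  assert (H3 := Cmod_ge_0 h).
  assert (Cmod h * Cmod (f' s) <= Cmod h * K) by (apply Rmult_le_compat_l; lra).
  assert (K * (Cmod h * Cmod h) <= K * (r * Cmod h))
    by (apply Rmult_le_compat_l; [lra | apply Rmult_le_compat_r; lra]).
  lra.
Qed.

Lemma Quad_mult P f f' g g' :
  Quad P f f' -> Quad P g g' ->
  Quad P (fun s => f s * g s)%C (fun s => f' s * g s + f s * g' s)%C.
Proof.
  intros [K1 [r1 [Hr1 [HK1 H1]]]] [K2 [r2 [Hr2 [HK2 H2]]]].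
  set (r := Rmin r1 r2).
  assert (R1 := Rmin_l r1 r2); assert (R2 := Rmin_r r1 r2); fold r in R1, R2.
  assert (Hr : 0 < r) by (apply Rmin_glb_lt; lra).
  assert (HK : 0 <= K1 * K2) by nra.
  set (K := 2 * (K1 * K2) + K1 * (1 + r) * (K2 * (1 + r))).
  assert (HK3 : 0 <= K1 * (1 + r) * (K2 * (1 + r))) by (repeat apply Rmult_le_pos; lra).
  exists K, r; split; [exact Hr | split; [unfold K; lra |]].
  intros s Hs; destruct (H1 s Hs) as [A1 [A2 A3]]; destruct (H2 s Hs) as [B1 [B2 B3]].
  assert (C1 := Cmod_ge_0 (f s)); assert (C2 := Cmod_ge_0 (f' s)).
  assert (C3 := Cmod_ge_0 (g s)); assert (C4 := Cmod_ge_0 (g' s)).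
  split; [| split].
  - rewrite Cmod_mult.
    assert (Cmod (f s) * Cmod (g s) <= K1 * K2) by (apply Rmult_le_compat; lra).
    unfold K; lra.
  - eapply Rle_trans; [apply Cmod_triangle |]; rewrite !Cmod_mult.
    assert (Cmod (f' s) * Cmod (g s) <= K1 * K2) by (apply Rmult_le_compat; lra).
    assert (Cmod (f s) * Cmod (g' s) <= K1 * K2) by (apply Rmult_le_compat; lra).
    unfold K; lra.
  - intros h Hh; assert (Hh0 := Cmod_ge_0 h).
    assert (A4 := A3 h ltac:(lra)); assert (B4 := B3 h ltac:(lra)).
    assert (A5 := Quad_step _ _ _ _ _ _ HK1 Hh A2 A4).
    assert (B5 := Quad_step _ _ _ _ _ _ HK2 Hh B2 B4).
    (* Two Taylor remainders and a product of two increments; the latter is quadratic in [h] because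
       [Quad_step] makes each increment linear. *)
    replace (f (s + h)%C * g (s + h)%C - f s * g s - h * (f' s * g s + f s * g' s))%C
      with ((f (s + h)%C - f s - h * f' s) * g s + f s * (g (s + h)%C - g s - h * g' s)
            + (f (s + h)%C - f s) * (g (s + h)%C - g s))%C by ring.
    eapply Rle_trans; [apply Cmod_triangle |].
    eapply Rle_trans; [apply Rplus_le_compat_r, Cmod_triangle |].
    rewrite !Cmod_mult.
    assert (D1 := Rmult_le_compat _ _ _ _ (Cmod_ge_0 _) C3 A4 B1).
    assert (D2 := Rmult_le_compat _ _ _ _ C1 (Cmod_ge_0 _) A1 B4).
    assert (D3 := Rmult_le_compat _ _ _ _ (Cmod_ge_0 _) (Cmod_ge_0 _) A5 B5).
    unfold K; lra.
Qed.

Lemma Quad_affine (P Q : C -> Prop) f f' (z : C) (b : R) :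
  0 < b -> (forall s, P s -> Q (z - b * s)%C) -> Quad Q f f' ->
  Quad P (fun s => f (z - b * s)%C) (fun s => - b * f' (z - b * s))%C.
Proof.
  intros Hb HPQ [K [r [Hr [HK HQ]]]].
  assert (HKb : 0 <= K * b) by nra.
  assert (HKb2 : 0 <= K * (b * b)) by (apply Rmult_le_pos; nra).
  exists (K + K * b + K * (b * b)), (r / b).
  split; [apply Rdiv_lt_0_compat; lra | split; [lra |]].
  intros s Hs; destruct (HQ _ (HPQ s Hs)) as [A1 [A2 A3]].
  split; [lra | split].
  - rewrite Cmod_mult, Cmod_opp, Cmod_R, Rabs_right by lra.
    assert (b * Cmod (f' (z - b * s)%C) <= b * K) by (apply Rmult_le_compat_l; lra).
    lra.
  - intros h Hh.
    assert (E : Cmod (- b * h) = b * Cmod h)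
      by (rewrite Cmod_mult, Cmod_opp, Cmod_R, Rabs_right; lra).
    assert (Hh' : b * Cmod h <= r).
    { apply (Rmult_le_compat_l b) in Hh; [| lra].
      replace (b * (r / b)) with r in Hh by (field; lra); exact Hh. }
    rewrite <- E in Hh'; specialize (A3 _ Hh').
    replace (z - b * (s + h))%C with (z - b * s + - b * h)%C by ring.
    replace (h * (- b * f' (z - b * s)%C))%C with (- b * h * f' (z - b * s)%C)%C by ring.
    eapply Rle_trans; [exact A3 |]; rewrite E.
    assert (0 <= Cmod h * Cmod h) by (generalize (Cmod_ge_0 h); nra).
    nra.
Qed.

Lemma Quad_cder P f f' (s z : C) (t : R) :
  Quad P f f' -> P (s + z * t)%C ->
  cder (fun u => f (s + z * u)%C) t (z * f' (s + z * t))%C.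
Proof.
  intros [K [r [Hr [HK HQ]]]] Hs; destruct (HQ _ Hs) as [_ [_ A]].
  assert (Hz := Cmod_ge_0 z).
  apply (cder_quad _ _ _ (r / (1 + Cmod z)) (K * (Cmod z * Cmod z)));
    [apply Rdiv_lt_0_compat; lra |].
  intros h Hh.
  assert (E : Cmod (z * h) = Cmod z * Rabs h) by (rewrite Cmod_mult, Cmod_R; ring).
  assert (Hh' : Cmod z * Rabs h <= r).
  { apply (Rmult_le_compat_l (1 + Cmod z)) in Hh; [| lra].
    replace ((1 + Cmod z) * (r / (1 + Cmod z))) with r in Hh by (field; lra).
    generalize (Rabs_pos h); nra. }
  rewrite <- E in Hh'; specialize (A _ Hh').
  rewrite RtoC_plus.
  replace (s + z * (t + h))%C with (s + z * t + z * h)%C by ring.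
  replace (h * (z * f' (s + z * t)%C))%C with (z * h * f' (s + z * t)%C)%C by ring.
  eapply Rle_trans; [exact A |]; rewrite E.
  right; replace (h * h) with (Rabs h * Rabs h); [ring |].
  rewrite <- Rabs_mult, Rabs_right; nra.
Qed.

Lemma ccont_Lip (g : R -> C) t r L :
  0 < r -> (forall h, Rabs h <= r -> Cmod (g (t + h)%R - g t) <= L * Rabs h) -> ccont g t.
Proof.
  intros Hr H.
  assert (HL : 0 <= L).
  { generalize (H r) (Cmod_ge_0 (g (t + r)%R - g t)).
    rewrite Rabs_right by lra; intros H1 H2; specialize (H1 ltac:(lra)); nra. }
  assert (R : forall g : R -> R,
    (forall h, Rabs h <= r -> Rabs (g (t + h) - g t) <= L * Rabs h) -> continuous g t).
  { clear g H; intros g Hg; apply continuity_pt_filterlim.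
    intros eps Heps; exists (Rmin r (eps / (L + 1))).
    split; [apply Rmin_glb_lt; [exact Hr | apply Rdiv_lt_0_compat; lra] |].
    intros x [_ Hx]; simpl in *; unfold R_dist in *.
    assert (H1 := Rmin_l r (eps / (L + 1))); assert (H2 := Rmin_r r (eps / (L + 1))).
    replace x with (t + (x - t)) by ring.
    eapply Rle_lt_trans; [apply Hg; lra |].
    apply Rle_lt_trans with (L * (eps / (L + 1))); [apply Rmult_le_compat_l; lra |].
    apply (Rmult_lt_reg_r (L + 1)); [lra |].
    replace (L * (eps / (L + 1)) * (L + 1)) with (L * eps) by (field; lra); nra. }
  split; apply R; intros h Hh; (eapply Rle_trans; [| apply (H h Hh)]).
  - eapply Rle_trans; [| apply re_le_Cmod]; right; reflexivity.
  - eapply Rle_trans; [| apply im_le_Cmod]; right; reflexivity.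
Qed.

(** Adding the Taylor bounds taken at [u] and at [u + k] cancels [f] and leaves
    [k * (f' (u + k) - f' u)], of size at most [2 K |k|^2]. So [f'] is Lipschitz, without any second
    derivative. *)
Lemma Quad_ccont P f f' (s z : C) (t rho : R) :
  Quad P f f' -> 0 < rho -> (forall h, Rabs h <= rho -> P (s + z * (t + h)%R)%C) ->
  ccont (fun u => f' (s + z * u)%C) t.
Proof.
  intros [K [r [Hr [HK HQ]]]] Hrho HP.
  assert (Hz := Cmod_ge_0 z).
  assert (Hd : 0 < r / (1 + Cmod z)) by (apply Rdiv_lt_0_compat; lra).
  apply (ccont_Lip _ _ (Rmin rho (r / (1 + Cmod z))) (2 * K * Cmod z));
    [now apply Rmin_glb_lt |].
  intros h Hh.
  assert (H1 := Rmin_l rho (r / (1 + Cmod z))); assert (H2 := Rmin_r rho (r / (1 + Cmod z))).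
  assert (E : Cmod (z * h) = Cmod z * Rabs h) by (rewrite Cmod_mult, Cmod_R; ring).
  assert (Hh' : Cmod (z * h) <= r).
  { rewrite E; apply Rle_trans with ((1 + Cmod z) * (r / (1 + Cmod z)));
      [| right; field; lra].
    generalize (Rabs_pos h); nra. }
  assert (P0 : P (s + z * t)%C).
  { generalize (HP 0); rewrite Rplus_0_r, Rabs_R0; intros Q; apply Q; lra. }
  assert (P1 := HP h ltac:(lra)).
  destruct (HQ _ P0) as [_ [_ A0]]; destruct (HQ _ P1) as [_ [_ A1]].
  specialize (A0 _ Hh'); rewrite <- Cmod_opp in Hh'; specialize (A1 _ Hh').
  rewrite RtoC_plus in A1 |- *.
  replace (s + z * (t + h))%C with (s + z * t + z * h)%C in A1 |- * by ring.
  set (u := (s + z * t)%C) in *; set (k := (z * h)%C) in *.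
  replace (u + k + - k)%C with u in A1 by ring.
  rewrite Cmod_opp in A1.
  assert (H : Cmod (k * (f' (u + k)%C - f' u)) <= 2 * K * (Cmod k * Cmod k)).
  { replace (k * (f' (u + k)%C - f' u))%C with
      ((f (u + k)%C - f u - k * f' u) + (f u - f (u + k)%C - - k * f' (u + k)%C))%C by ring.
    eapply Rle_trans; [apply Cmod_triangle | lra]. }
  rewrite Cmod_mult in H.
  destruct (Req_dec (Cmod k) 0) as [K0 | K0].
  - apply Cmod_eq_0 in K0; rewrite K0, Cplus_0_r.
    replace (f' u - f' u)%C with (RtoC 0) by ring.
    rewrite Cmod_0; generalize (Rabs_pos h); intros; repeat apply Rmult_le_pos; lra.
  - assert (0 < Cmod k) by (generalize (Cmod_ge_0 k); lra).
    rewrite Rmult_assoc, <- E.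
    apply (Rmult_le_reg_l (Cmod k)); [assumption | lra].
Qed.

Lemma pair_re (x t h : R) : ((x + h)%R, t) = ((x, t) + h)%C.
Proof. unfold Cplus, RtoC; simpl; f_equal; ring. Qed.

Lemma pair_im (x t : R) : (x, t) = (x + Ci * t)%C.
Proof. unfold Cplus, Cmult, Ci, RtoC; simpl; f_equal; ring. Qed.

Lemma Quad_line P f f' x t : Quad P f f' -> P (x, t) ->
  cder (fun u => f (x, u)) t (Ci * f' (x, t))%C.
Proof.
  intros HQ HP; rewrite pair_im in HP |- *.
  assert (H := Quad_cder P f f' x Ci t HQ HP).
  destruct H as [h1 h2]; split.
  - eapply is_derive_ext; [| exact h1]; intros u; simpl; now rewrite <- pair_im.
  - eapply is_derive_ext; [| exact h2]; intros u; simpl; now rewrite <- pair_im.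
Qed.

(* Cauchy's theorem on a rectangle, in integrated form: [d/dx] of the vertical
   integral at abscissa [x] is the difference of the values at its two ends. *)
Lemma contour_shift P f f' (x0 x1 rho T M : R) :
  Quad P f f' -> 1 <= T -> x0 <= x1 -> 0 < rho -> 
  (forall x t, x0 - rho <= x <= x1 + rho -> 1 / 2 <= t <= T + 1 / 2 -> P (x, t)) ->
  (forall x, x0 <= x <= x1 -> Cmod (f (x, T)) <= M) ->
  (forall x, x0 <= x <= x1 -> Cmod (f (x, 1)) <= M) ->
  Cmod (CI (fun t => f (x1, t)) 1 T - CI (fun t => f (x0, t)) 1 T) <= 4 * M * (x1 - x0).
Proof.
  intros HQ HT Hx Hrho HP M1 M2.
  assert (Hc : forall x t, x0 - rho <= x <= x1 + rho -> 1 <= t <= T -> ccont (fun u => f (x, u)) t).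
  { intros x t H1 H2; eapply cder_ccont, (Quad_line P); [exact HQ |]; apply HP; lra. }
  assert (Hc' : forall x t, x0 <= x <= x1 -> 1 <= t <= T -> ccont (fun u => f' (x, u)) t).
  { intros x t H1 H2.
    assert (H := Quad_ccont P f f' x Ci t (1 / 2) HQ ltac:(lra)).
    destruct H as [h1 h2].
    - intros h Hh; rewrite <- pair_im; apply HP; [lra |].
      apply Rabs_le_between in Hh; lra.
    - split.
      + eapply continuous_ext; [| exact h1]; intros u; simpl; now rewrite <- pair_im.
      + eapply continuous_ext; [| exact h2]; intros u; simpl; now rewrite <- pair_im. }
  (* One factor 2 counts the two ends of the vertical segment, the other is that of [Cmvt_le]. *)
  replace (4 * M) with (2 * (2 * M)) by ring.
  apply (Cmvt_le (fun x => CI (fun t => f (x, t)) 1 T) (fun x => CI (fun t => f' (x, t)) 1 T));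
    [exact Hx | |].
  - intros x Hx'.
    destruct HQ as [K [r [Hr [HK HQ]]]].
    apply (CI_param 1 T HT (fun x t => f (x, t)) (fun x t => f' (x, t)) x (Rmin r rho) K).
    + now apply Rmin_glb_lt.
    + intros h t Hh Ht; assert (H1 := Rmin_l r rho).
      destruct (HQ (x, t)) as [_ [_ A]]; [apply HP; lra |].
      rewrite pair_re.
      eapply Rle_trans; [apply A; rewrite Cmod_R; lra |].
      rewrite Cmod_R, <- Rabs_mult, Rabs_right; [lra | nra].
    + intros h t Hh Ht; apply Hc; [| exact Ht].
      assert (H1 := Rmin_r r rho); assert (Rabs h <= rho) as H2 by lra.
      apply Rabs_le_between in H2; lra.
    + intros; apply Hc'; assumption.
  - intros x Hx'.
    (* The Cauchy-Riemann equations enter here: the derivative of [f (x, t)] in [t] is [Ci * f'], so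
       [- Ci * f] is a primitive of [f']. *)
    rewrite (CI_FTC 1 T HT (fun t => - Ci * f (x, t))%C).
    + replace (- Ci * f (x, T) - - Ci * f (x, 1))%C with (- Ci * (f (x, T) - f (x, 1)))%C by ring.
      rewrite Cmod_mult, Cmod_opp, Cmod_Ci, Rmult_1_l.
      eapply Rle_trans; [apply Cmod_triangle_sub |].
      generalize (M1 x Hx') (M2 x Hx'); lra.
    + intros t Ht; eapply cder_eq; [| apply cder_scal, (Quad_line P f f'); [exact HQ | apply HP; lra]].
      rewrite Cmult_assoc; replace (- Ci * Ci)%C with (RtoC 1); [ring |].
      unfold Ci, Cmult, Copp, RtoC; simpl; f_equal; ring.
    + intros; apply Hc'; assumption.
Qed.

(** * The van der Corput second derivative test *)

Definition unit_cis (x : R) : C := (cos x, sin x).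

Lemma unit_cis_plus x y : unit_cis (x + y) = (unit_cis x * unit_cis y)%C.
Proof.
  unfold unit_cis, Cmult; simpl; rewrite cos_plus, sin_plus; f_equal; ring.
Qed.

Lemma Cmod_unit_cis x : Cmod (unit_cis x) = 1.
Proof.
  unfold Cmod, unit_cis; simpl fst; simpl snd.
  generalize (sin2_cos2 x); unfold Rsqr; intros H.
  replace (_ + _) with 1 by nra; apply sqrt_1.
Qed.

Lemma cder_unit_cis x : cder unit_cis x (Ci * unit_cis x)%C.
Proof.
  split.
  - refine (Rder_eq _ _ _ _ _ (is_derive_cos x)); simpl; unfold Re; simpl; ring.
  - refine (Rder_eq _ _ _ _ _ (is_derive_sin x)); simpl; unfold Im; simpl; ring.
Qed.

Lemma unit_cis_Lip x y : Cmod (unit_cis x - unit_cis y) <= 2 * Rabs (x - y).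
Proof.
  assert (H : forall a b, a <= b -> Cmod (unit_cis b - unit_cis a) <= 2 * 1 * (b - a)).
  { intros a b Hab.
    apply (Cmvt_le unit_cis (fun t => Ci * unit_cis t)%C); [exact Hab | |].
    - intros; apply cder_unit_cis.
    - intros; rewrite Cmod_mult, Cmod_Ci, Cmod_unit_cis; lra. }
  destruct (Rle_dec x y) as [h | h].
  - rewrite Rabs_left1 by lra.
    replace (unit_cis x - unit_cis y)%C with (- (unit_cis y - unit_cis x))%C by ring.
    rewrite Cmod_opp; generalize (H x y h); lra.
  - rewrite Rabs_right by lra; generalize (H y x); lra.
Qed.

(** Since [x <= 2], the minorant [x - x^3 / 6] already has slope at least [1/3]. *)
Lemma sin_ge_quarter x : 0 <= x <= PI / 2 -> x / 4 <= sin x.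
Proof.
  intros Hx; assert (P := PI_4).
  destruct (sin_bound x 0) as [H _]; [lra.. |].
  eapply Rle_trans; [| exact H].
  unfold sin_approx, sin_term; simpl.
  assert (x * x <= 4) by nra.
  field_simplify; nra.
Qed.

Lemma one_minus_cos_ge y : Rabs y <= PI -> y * y / 16 <= 2 - 2 * cos y.
Proof.
  intros Hy.
  replace (2 - 2 * cos y) with (4 * (sin (y / 2) * sin (y / 2))).
  2: { replace (cos y) with (cos (2 * (y / 2))) by (f_equal; field).
       rewrite cos_2a_sin; ring. }
  assert (H : forall z, 0 <= z <= PI / 2 -> z * z <= 16 * (sin z * sin z)).
  { intros z Hz; assert (H := sin_ge_quarter z Hz); nra. }
  destruct (Rle_dec 0 y) as [h | h].
  - rewrite Rabs_right in Hy by lra; generalize (H (y / 2)); lra.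
  - rewrite Rabs_left in Hy by lra; generalize (H (- (y / 2))).
    rewrite sin_neg; lra.
Qed.

(** The multiple of [2 pi] nearest to [g] is found by a floor. That [k] ranges below a [K] depending
    only on [G] lets the sum over [k] be exchanged with the sum over the phases. *)
Lemma one_minus_cos_near_period (G g : R) (K : nat) :
  0 <= g <= G -> G + 1 <= INR K ->
  exists k, (k < K)%nat /\
    (g - 2 * INR k * PI) * (g - 2 * INR k * PI) / 16 <= 2 - 2 * cos g.
Proof.
  intros Hg HK; assert (P := PI2_3_2).
  assert (P2 : 0 < 2 * PI) by lra.
  destruct (nfloor_ex ((g + PI) / (2 * PI))) as [k [k1 k2]].
  { apply Rdiv_le_0_compat; lra. }
  assert (E : (g + PI) / (2 * PI) * (2 * PI) = g + PI) by (field; lra).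
  assert (k3 : INR k * (2 * PI) <= g + PI) by (rewrite <- E; apply Rmult_le_compat_r; lra).
  assert (k4 : g + PI <= (INR k + 1) * (2 * PI)) by (rewrite <- E; apply Rmult_le_compat_r; lra).
  exists k; split.
  - apply INR_lt; assert (0 <= INR k) by apply pos_INR; nra.
  - replace (cos g) with (cos (g - 2 * INR k * PI)).
    + apply one_minus_cos_ge, Rabs_le; lra.
    + rewrite <- (cos_period _ k); f_equal; ring.
Qed.

(** A point [c] within 16 of [x] satisfies [c^2 <= 2 x^2 + 512], hence [1 + c^2 <= 513 (1 + x^2)];
    the mean value theorem does the rest. *)
Lemma atan_step (x s : R) :
  0 <= s <= 16 -> s / (1 + x * x) <= 513 * (atan x - atan (x - s)).
Proof.
  intros Hs.
  destruct (MVT_gen atan (x - s) x (fun y => / (1 + y ^ 2))) as [c [Hc H]].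
  - intros y _; apply is_derive_Reals, derivable_pt_lim_atan.
  - intros y _; exact (derivable_continuous_pt _ _ (derivable_pt_atan y)).
  - rewrite Rmin_left, Rmax_right in Hc by lra.
    rewrite H; cbv beta; replace (c ^ 2) with (c * c) by ring.
    replace (513 * (/ (1 + c * c) * (x - (x - s)))) with (s * (513 * / (1 + c * c))) by ring.
    apply Rmult_le_compat_l; [lra |].
    assert (H1 : 0 < 1 + x * x) by nra; assert (H2 : 0 < 1 + c * c) by nra.
    replace (513 * / (1 + c * c)) with (/ ((1 + c * c) / 513)) by (field; lra).
    apply Rinv_le_contravar; [lra |].
    assert ((c - x) * (c - x) <= 256) by nra.
    assert (c * c <= 2 * (x * x) + 2 * ((c - x) * (c - x))).
    { generalize (Rle_0_sqr (c - 2 * x)); unfold Rsqr; lra. }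
    nra.
Qed.

Lemma spaced_sum (g : nat -> R) (a lam : R) m :
  0 < lam <= 1 ->
  (forall i, (i < m)%nat -> lam <= g i - g (S i) <= 16 * lam) ->
  Rsum (fun i => lam / (lam + (g i - a) * (g i - a))) m <= 513 * PI / sqrt lam.
Proof.
  intros Hl Hg.
  set (r := sqrt lam).
  assert (Hr : 0 < r) by (apply sqrt_lt_R0; lra).
  assert (Hrr : r * r = lam) by (apply sqrt_sqrt; lra).
  assert (Hr1 : r <= 1) by nra.
  set (A := fun i => (g i - a) / r).
  apply Rle_trans with (Rsum (fun i => 513 / r * (atan (A i) - atan (A (S i)))) m).
  - apply Rsum_le; intros i Hi; specialize (Hg i Hi).
    set (s := (g i - g (S i)) / r).
    assert (Hs : r <= s <= 16).
    { unfold s; split; apply (Rmult_le_reg_r r); try lra.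
      - replace ((g i - g (S i)) / r * r) with (g i - g (S i)) by (field; lra); lra.
      - replace ((g i - g (S i)) / r * r) with (g i - g (S i)) by (field; lra); nra. }
    assert (H := atan_step (A i) s ltac:(lra)).
    replace (A i - s) with (A (S i)) in H by (unfold A, s; field; lra).
    replace (lam / (lam + (g i - a) * (g i - a))) with (/ r * (r / (1 + A i * A i))).
    2: { unfold A; rewrite <- Hrr; field.
         generalize (Rle_0_sqr (g i - a)); unfold Rsqr; split; [lra | nra]. }
    replace (513 / r * (atan (A i) - atan (A (S i)))) with
      (/ r * (513 * (atan (A i) - atan (A (S i))))) by (field; lra).
    apply Rmult_le_compat_l; [apply Rlt_le, Rinv_0_lt_compat, Hr |].
    eapply Rle_trans; [| exact H].
    apply Rmult_le_compat_r; [| lra].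
    apply Rlt_le, Rinv_0_lt_compat; generalize (Rle_0_sqr (A i)); unfold Rsqr; lra.
  - rewrite Rsum_scal, (Rsum_tele (fun i => atan (A i))).
    replace (513 * PI / r) with (513 / r * PI) by (field; lra).
    apply Rmult_le_compat_l; [apply Rlt_le, Rdiv_lt_0_compat; lra |].
    generalize (atan_bound (A O)) (atan_bound (A m)); lra.
Qed.

(** Over the common denominator the numerator is [lam * Cconj (u - v) - Cconj u * Cconj v * (u -
    v)], so [u - v] factors out and [lam + |u| |v|] is at most the sum of the two denominators. *)
Lemma regularized_inverse_diff (u v : C) lam :
  0 < lam ->
  Cmod (Cconj u * / (Cmod u * Cmod u + lam)%R - Cconj v * / (Cmod v * Cmod v + lam)%R)
  <= Cmod (u - v) * (/ (Cmod u * Cmod u + lam) + / (Cmod v * Cmod v + lam)).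
Proof.
  intros Hl.
  assert (A := Cmod_ge_0 u); assert (B := Cmod_ge_0 v).
  set (du := Cmod u * Cmod u + lam); set (dv := Cmod v * Cmod v + lam).
  assert (Hu : 0 < du) by (unfold du; nra); assert (Hv : 0 < dv) by (unfold dv; nra).
  assert (Nu : RtoC du <> 0) by (intros E; apply RtoC_inj in E; lra).
  assert (Nv : RtoC dv <> 0) by (intros E; apply RtoC_inj in E; lra).
  assert (Eu : RtoC du = (u * Cconj u + lam)%C).
  { unfold du; rewrite RtoC_plus, RtoC_mult.
    rewrite <- Cmod2_conj; simpl; rewrite RtoC_mult, RtoC_mult; ring. }
  assert (Ev : RtoC dv = (v * Cconj v + lam)%C).
  { unfold dv; rewrite RtoC_plus, RtoC_mult.
    rewrite <- Cmod2_conj; simpl; rewrite RtoC_mult, RtoC_mult; ring. }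
  replace (Cconj u * / du - Cconj v * / dv)%C
    with ((lam * Cconj (u - v) - Cconj u * Cconj v * (u - v)) * (/ du * / dv))%C.
  2: { replace (Cconj (u - v)) with (Cconj u - Cconj v)%C
         by (rewrite Cminus_conj; reflexivity).
       transitivity ((Cconj u * (v * Cconj v + lam) - Cconj v * (u * Cconj u + lam))
                     * (/ du * / dv))%C; [ring |].
       rewrite <- Eu, <- Ev; field; split; assumption. }
  rewrite !Cmod_mult, !Cmod_inv, !Cmod_R, !(Rabs_right du), !(Rabs_right dv) by (assumption || lra).
  assert (H : Cmod (lam * Cconj (u - v) - Cconj u * Cconj v * (u - v))
              <= Cmod (u - v) * (dv + du)).
  { eapply Rle_trans; [apply Cmod_triangle_sub |].
    rewrite !Cmod_mult, !Cmod_conj, Cmod_R, Rabs_right by lra.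
    assert (C0 := Cmod_ge_0 (u - v)).
    replace (lam * Cmod (u - v) + Cmod u * Cmod v * Cmod (u - v))
      with (Cmod (u - v) * (lam + Cmod u * Cmod v)) by ring.
    apply Rmult_le_compat_l; [exact C0 |]; unfold du, dv.
    generalize (Rle_0_sqr (Cmod u - Cmod v)) (Rle_0_sqr (Cmod u + Cmod v)); unfold Rsqr; lra. }
  assert (P : 0 < / du * / dv) by (apply Rmult_lt_0_compat; now apply Rinv_0_lt_compat).
  apply (Rmult_le_compat_r (/ du * / dv)) in H; [| lra].
  eapply Rle_trans; [exact H | right; field; lra].
Qed.

Lemma Csum_by_parts (z f : nat -> C) n :
  Csum (fun i => (z i - z (S i)) * f i)%C n
  = (z O * f O - z n * f n + Csum (fun i => z (S i) * (f (S i) - f i)) n)%C.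
Proof. induction n as [|n IH]; simpl; [ring | rewrite IH; ring]. Qed.

Lemma Cmod2_one_minus_cis g : Cmod (1 - unit_cis g) * Cmod (1 - unit_cis g) = 2 - 2 * cos g.
Proof.
  unfold Cmod; rewrite sqrt_sqrt by nra; simpl.
  generalize (sin2_cos2 g); unfold Rsqr; intros H; nra.
Qed.

(* Instead of cutting the range where
   the phase increment [g] is near [2 k pi], the factor [1 / (1 - w)] of the
   Kusmin-Landau telescoping is replaced by [conj (1 - w) / (|1 - w|^2 + lam)]. *)
Lemma van_der_corput (th : nat -> R) (lam G : R) (n K : nat) :
  0 < lam <= 1 ->
  let g i := th (S i) - th i in
  (forall i, (i <= n)%nat -> lam <= g i - g (S i) <= 16 * lam) ->
  (forall i, (i <= n)%nat -> 0 <= g i <= G) ->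
  G + 1 <= INR K ->
  Cmod (Csum (fun i => unit_cis (th i)) n) <= 3000000 * INR K / sqrt lam.
Proof.
  intros Hl g Hd Hg HK.
  set (r := sqrt lam).
  assert (Hr : 0 < r) by (apply sqrt_lt_R0; lra).
  assert (Hrr : r * r = lam) by (apply sqrt_sqrt; lra).
  set (z := fun i => unit_cis (th i)).
  set (u := fun i => (1 - unit_cis (g i))%C).
  set (D := fun i => Cmod (u i) * Cmod (u i) + lam).
  set (f := fun i => (Cconj (u i) * / RtoC (D i))%C).
  assert (HD : forall i, lam <= D i) by (intros i; unfold D; generalize (Cmod_ge_0 (u i)); nra).
  assert (ND : forall i, RtoC (D i) <> 0).
  { intros i E; apply RtoC_inj in E; generalize (HD i); lra. }
  (* With [z (S i) = z i * unit_cis (g i)], the telescoping part equals [z i * |u i|^2 / D i]; what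
     is missing from [z i] is the regularization error [lam / D i]. *)
  assert (Hz : forall i, z i = ((z i - z (S i)) * f i + (lam / D i)%R * z i)%C).
  { intros i; unfold f.
    replace (z (S i)) with (z i * unit_cis (g i))%C.
    2: { unfold z; rewrite <- unit_cis_plus; f_equal; unfold g; ring. }
    replace (z i - z i * unit_cis (g i))%C with (z i * u i)%C by (unfold u; ring).
    rewrite RtoC_div by (generalize (HD i); lra).
    assert (E : (u i * Cconj (u i) + lam)%C = D i).
    { unfold D; rewrite RtoC_plus, RtoC_mult, <- Cmod2_conj; simpl.
      rewrite !RtoC_mult; ring. }
    transitivity (z i * (u i * Cconj (u i) + lam) * / D i)%C; [| field; apply ND].
    rewrite E; field; apply ND. }
  (* The inequality [r |u| <= |u|^2 + r^2]. *)
  assert (Hf : forall i, Cmod (f i) <= / r).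
  { intros i; unfold f; rewrite Cmod_mult, Cmod_conj, Cmod_inv by apply ND.
    assert (A := HD i); rewrite Cmod_R, Rabs_right by lra.
    apply (Rmult_le_reg_r (D i * r)); [apply Rmult_lt_0_compat; lra |].
    replace (Cmod (u i) * / D i * (D i * r)) with (Cmod (u i) * r) by (field; lra).
    replace (/ r * (D i * r)) with (D i) by (field; lra).
    unfold D; generalize (Rle_0_sqr (Cmod (u i) - r)) (Rle_0_sqr (Cmod (u i) + r)); unfold Rsqr; lra. }
  (* The 32 is the Lipschitz constant 2 of [unit_cis] times the largest step [16 * lam] of [g]. *)
  assert (Hdf : forall i, (i < n)%nat ->
            Cmod (z (S i) * (f (S i) - f i)) <= 32 * (lam / D i) + 32 * (lam / D (S i))).
  { intros i Hi; unfold z; rewrite Cmod_mult, Cmod_unit_cis, Rmult_1_l.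
    eapply Rle_trans; [apply regularized_inverse_diff; lra |].
    replace (u (S i) - u i)%C with (unit_cis (g i) - unit_cis (g (S i)))%C by (unfold u; ring).
    assert (A := unit_cis_Lip (g i) (g (S i))).
    assert (B := Hd i ltac:(lia)); rewrite Rabs_right in A by lra.
    fold (D i) (D (S i)).
    assert (P1 := Rinv_0_lt_compat (D i) ltac:(generalize (HD i); lra)).
    assert (P2 := Rinv_0_lt_compat (D (S i)) ltac:(generalize (HD (S i)); lra)).
    unfold Rdiv; nra. }
  (* For the nearest multiple of [2 pi], at signed distance [y], [D i >= (lam + y^2) / 16]. Adding
     the terms of all other [k < K] only increases the majorant, and after exchanging sums each [k]
     falls under [spaced_sum]. *)
  assert (Hsum : Rsum (fun i => lam / D i) (S n) <= 16 * (INR K * (513 * PI / r))).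
  { apply Rle_trans with (Rsum (fun i => 16 * Rsum (fun k =>
      lam / (lam + (g i - 2 * INR k * PI) * (g i - 2 * INR k * PI))) K) (S n)).
    - apply Rsum_le; intros i Hi.
      destruct (one_minus_cos_near_period G (g i) K (Hg i ltac:(lia)) HK) as [k [k1 k2]].
      set (y := g i - 2 * INR k * PI) in *.
      apply Rle_trans with (16 * (lam / (lam + y * y))).
      + replace (16 * (lam / (lam + y * y))) with (lam * / ((lam + y * y) / 16)) by (field; nra).
        apply Rmult_le_compat_l; [lra |]; apply Rinv_le_contravar; [nra |].
        unfold D, u; rewrite Cmod2_one_minus_cis; lra.
      + apply Rmult_le_compat_l; [lra |].
        apply (Rsum_ge_term (fun k =>
          lam / (lam + (g i - 2 * INR k * PI) * (g i - 2 * INR k * PI))) K k); [| exact k1].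
        intros j _; apply Rlt_le, Rdiv_lt_0_compat; [lra |].
        generalize (Rle_0_sqr (g i - 2 * INR j * PI)); unfold Rsqr; lra.
    - rewrite Rsum_scal, Rsum_switch; apply Rmult_le_compat_l; [lra |].
      rewrite <- (Rsum_const (513 * PI / r) K).
      apply Rsum_le; intros k _.
      apply (spaced_sum g (2 * INR k * PI)); [exact Hl |].
      intros i Hi; apply Hd; lia. }
  assert (Hnn : forall i, 0 <= lam / D i).
  { intros i; generalize (HD i); intros; apply Rlt_le, Rdiv_lt_0_compat; lra. }
  change (Csum (fun i => unit_cis (th i)) n) with (Csum z n).
  rewrite (Csum_ext _ _ n (fun i _ => Hz i)), Csum_plus, Csum_by_parts.
  set (A := Csum _ n); set (B := Csum _ n).
  assert (HA : Cmod A <= 32 * Rsum (fun i => lam / D i) n + 32 * Rsum (fun i => lam / D (S i)) n).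
  { eapply Rle_trans; [apply Cmod_Csum_le, Hdf |].
    rewrite Rsum_plus, !Rsum_scal; lra. }
  assert (HB : Cmod B <= Rsum (fun i => lam / D i) n).
  { apply Cmod_Csum_le; intros i _; unfold z.
    rewrite Cmod_mult, Cmod_unit_cis, Cmod_R, Rabs_right; [lra | apply Rle_ge, Hnn]. }
  assert (H1 : Rsum (fun i => lam / D i) n <= Rsum (fun i => lam / D i) (S n)).
  { simpl; generalize (Hnn n); lra. }
  assert (H2 : Rsum (fun i => lam / D (S i)) n <= Rsum (fun i => lam / D i) (S n)).
  { change (S n) with (1 + n)%nat; rewrite (Rsum_add _ 1).
    generalize (Hnn O); cbn [Rsum]; change (fun i => lam / D (1 + i)%nat) with (fun i => lam / D (S i)).
    lra. }
  assert (HC : Cmod (z O * f O - z n * f n) <= 2 * / r).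
  { eapply Rle_trans; [apply Cmod_triangle_sub |].
    unfold z; rewrite !Cmod_mult, !Cmod_unit_cis.
    generalize (Hf O) (Hf n); lra. }
  assert (HK1 : 1 <= INR K) by (generalize (Hg O ltac:(lia)); lra).
  assert (T1 := Cmod_triangle (z O * f O - z n * f n + A) B).
  assert (T2 := Cmod_triangle (z O * f O - z n * f n) A).
  assert (Hri : 0 < / r) by now apply Rinv_0_lt_compat.
  assert (P := PI_4).
  (* The sum is used [32 + 32 + 1] times: [65 * 16 * 513 * 4], plus 2 for the boundary terms, stays
     below 3000000. *)
  assert (Q : 16 * (INR K * (513 * PI / r)) <= 16 * 513 * 4 * INR K * / r).
  { unfold Rdiv; assert (0 < INR K * / r) by nra; nra. }
  assert (Q2 : / r <= INR K * / r) by nra.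
  unfold Rdiv; lra.
Qed.

(** * Growth of zeta on vertical lines *)

Lemma ln_le_sub1 x : 0 < x -> ln x <= x - 1.
Proof.
  intros Hx; rewrite <- (ln_exp (x - 1)); apply ln_le; [exact Hx |].
  generalize (exp_ineq1_le (x - 1)); lra.
Qed.

Lemma ln_ge_sub1 x : 0 < x -> 1 - / x <= ln x.
Proof.
  intros Hx; assert (H := ln_le_sub1 (/ x) (Rinv_0_lt_compat _ Hx)).
  rewrite ln_Rinv in H by exact Hx; lra.
Qed.

Lemma Rcpow_polar x s :
  Rcpow x (- s) = (RtoC (Rpower x (- Re s)) * unit_cis (- Im s * ln x))%C.
Proof.
  unfold Rcpow, Cexp, unit_cis, Rpower, Cmult, RtoC; simpl.
  f_equal; unfold Re, Im; rewrite !Rmult_0_r, ?Rminus_0_r, ?Rplus_0_r, ?Rplus_0_l; ring_simplify.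
  all: rewrite ?Rmult_0_l, ?Rminus_0_r, ?Rplus_0_r; try reflexivity.
Qed.

Lemma Rpower_mono_base x y z : 0 < x <= y -> 0 <= z -> Rpower x z <= Rpower y z.
Proof.
  intros Hx Hz; unfold Rpower; apply exp_le.
  assert (ln x <= ln y) by (apply ln_le; lra); nra.
Qed.

Lemma Rpower_mono_exp x y z : 1 <= x -> y <= z -> Rpower x y <= Rpower x z.
Proof.
  intros Hx Hz; unfold Rpower; apply exp_le.
  assert (0 <= ln x) by (rewrite <- ln_1; apply ln_le; lra); nra.
Qed.

Lemma Rpower_pos x y : 0 < Rpower x y.
Proof. apply exp_pos. Qed.

Lemma sqrt_Rpower t : 0 < t -> sqrt t = Rpower t (1 / 2).
Proof. intros Ht; rewrite <- Rpower_sqrt by exact Ht; f_equal; field. Qed.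

(** The constant 3000000 of [van_der_corput] times 4 from [sqrt lam = sqrt t / (4 N)], times 2 from
    the count [K <= t / N + 2] of multiples of [2 pi]. *)
Definition vdc_const : R := 24000000.

(** On a block from [N] to [2 N] the phase [t ln x] has second differences between [t / (16 N^2)]
    and [t / N^2]. With [lam = t / (16 N^2)] they fit [van_der_corput], and [t <= 16 N^2] says
    [lam <= 1]. *)
Lemma unit_cis_log_block (t : R) (N n : nat) :
  0 < t -> (1 <= N)%nat -> t <= 16 * (INR N * INR N) -> (n <= N)%nat ->
  Cmod (Csum (fun i => unit_cis (t * ln (INR (N + i)))) n)
  <= vdc_const * (sqrt t + INR N / sqrt t).
Proof.
  intros Ht HN HtN Hn.
  assert (HN1 : 1 <= INR N) by (apply (le_INR 1), HN).
  assert (Hr : 0 < sqrt t) by now apply sqrt_lt_R0.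
  assert (Hrr : sqrt t * sqrt t = t) by (apply sqrt_sqrt; lra).
  destruct (nfloor_ex (t / INR N)) as [k [k1 k2]]; [apply Rdiv_le_0_compat; lra |].
  set (lam := t / (16 * (INR N * INR N))).
  assert (Hl : 0 < lam <= 1).
  { split; [apply Rdiv_lt_0_compat; nra |].
    apply (Rmult_le_reg_r (16 * (INR N * INR N))); [nra |].
    unfold lam; replace (t / _ * _) with t by (field; lra); lra. }
  assert (Hs : sqrt lam = sqrt t / (4 * INR N)).
  { unfold lam; rewrite sqrt_div_alt by nra; f_equal.
    replace (16 * (INR N * INR N)) with ((4 * INR N) * (4 * INR N)) by ring.
    apply sqrt_square; lra. }
  assert (Hln : forall x, 0 < x -> ln (x + 1) - ln x = ln (1 + / x)).
  { intros x Hx; rewrite <- ln_div by lra; f_equal; field; lra. }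
  assert (Hinc : forall i, (i <= n)%nat ->
    0 <= t * ln (INR (N + S i)) - t * ln (INR (N + i)) <= t / INR N).
  { intros i Hi; rewrite Nat.add_succ_r, S_INR.
    assert (Hx : INR N <= INR (N + i)) by (apply le_INR; lia).
    set (x := INR (N + i)) in *.
    rewrite <- Rmult_minus_distr_l, Hln by lra.
    assert (Hi0 : 0 < / x) by (apply Rinv_0_lt_compat; lra).
    split.
    - apply Rmult_le_pos; [lra |]; rewrite <- ln_1; apply ln_le; lra.
    - apply Rmult_le_compat_l; [lra |].
      eapply Rle_trans; [apply ln_le_sub1; lra |].
      assert (/ x <= / INR N) by (apply Rinv_le_contravar; lra); lra. }
  assert (Hdiff : forall i, (i <= n)%nat ->
    lam <= (t * ln (INR (N + S i)) - t * ln (INR (N + i)))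
           - (t * ln (INR (N + S (S i))) - t * ln (INR (N + S i))) <= 16 * lam).
  { intros i Hi; rewrite !Nat.add_succ_r, !S_INR.
    assert (Hx : INR N <= INR (N + i)) by (apply le_INR; lia).
    assert (Hx2 : INR (N + i) <= 2 * INR N).
    { rewrite plus_INR; assert (INR i <= INR N) by (apply le_INR; lia); lra. }
    set (x := INR (N + i)) in *.
    (* The second difference is [t ln y], squeezed by [1 - / y <= ln y <= y - 1], where both outer
       terms are explicit reciprocals. *)
    replace (t * ln (x + 1) - t * ln x - (t * ln (x + 1 + 1) - t * ln (x + 1)))
      with (t * ln ((x + 1) * (x + 1) / (x * (x + 2)))).
    2: { rewrite ln_div, !ln_mult by nra.
         replace (x + 1 + 1) with (x + 2) by ring; ring. }
    set (y := (x + 1) * (x + 1) / (x * (x + 2))).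
    assert (Hy : 0 < y) by (apply Rdiv_lt_0_compat; nra).
    assert (Y1 : y - 1 = / (x * (x + 2))) by (unfold y; field; lra).
    assert (Y2 : 1 - / y = / ((x + 1) * (x + 1))) by (unfold y; field; lra).
    generalize (ln_le_sub1 y Hy) (ln_ge_sub1 y Hy); rewrite Y1, Y2; intros L1 L2.
    assert (I1 : / (16 * (INR N * INR N)) <= / ((x + 1) * (x + 1))).
    { apply Rinv_le_contravar; nra. }
    assert (I2 : / (x * (x + 2)) <= / (INR N * INR N)).
    { apply Rinv_le_contravar; nra. }
    unfold lam; split.
    - apply Rmult_le_compat_l; lra.
    - replace (16 * (t / (16 * (INR N * INR N)))) with (t * / (INR N * INR N)) by (field; lra).
      apply Rmult_le_compat_l; lra. }
  eapply Rle_trans.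
  { apply (van_der_corput (fun i => t * ln (INR (N + i))) lam (t / INR N) n (S (S k)) Hl).
    - exact Hdiff.
    - exact Hinc.
    - rewrite !S_INR; lra. }
  rewrite Hs, !S_INR.
  replace (3000000 * (INR k + 1 + 1) / (sqrt t / (4 * INR N)))
    with (12000000 * ((INR k + 1 + 1) * (INR N / sqrt t))) by (field; lra).
  assert (Hq : 0 < INR N / sqrt t) by (apply Rdiv_lt_0_compat; lra).
  assert (H : (INR k + 1 + 1) * (INR N / sqrt t) <= (t / INR N + 2) * (INR N / sqrt t)).
  { apply Rmult_le_compat_r; lra. }
  replace ((t / INR N + 2) * (INR N / sqrt t)) with (sqrt t + 2 * (INR N / sqrt t)) in H.
  2: { transitivity (t / sqrt t + 2 * (INR N / sqrt t)); [| field; lra].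
       f_equal; replace (t / sqrt t) with (sqrt t * sqrt t / sqrt t) by (now rewrite Hrr).
       field; lra. }
  unfold vdc_const; lra.
Qed.

(** Abel summation removes the decreasing weight. The exponential sum test asks for an increasing
    phase, so for [Im s > 0] the sum is conjugated first. *)
Lemma Dirichlet_block (s : C) (t tau : R) (N n : nat) :
  t = Rabs (Im s) -> 0 < t -> 0 <= tau <= Re s ->
  (1 <= N)%nat -> t <= 16 * (INR N * INR N) -> (n <= N)%nat ->
  Cmod (Csum (fun i => Rcpow (INR (N + i)) (- s)) n)
  <= Rpower (INR N) (- tau) * (vdc_const * (sqrt t + INR N / sqrt t)).
Proof.
  intros Et Ht Htau HN HtN Hn.
  assert (HN1 : 1 <= INR N) by (apply (le_INR 1), HN).
  set (V := vdc_const * (sqrt t + INR N / sqrt t)).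
  assert (HV : forall m, (m <= n)%nat ->
    Cmod (Csum (fun i => unit_cis (- Im s * ln (INR (N + i)))) m) <= V).
  { intros m Hm; destruct (Rle_dec (Im s) 0) as [h | h].
    - rewrite Rabs_left1 in Et by lra; rewrite <- Et.
      apply unit_cis_log_block; auto; lia.
    - rewrite Rabs_right in Et by lra; rewrite <- Et, <- Cmod_conj, <- Csum_Cconj.
      rewrite (Csum_ext _ (fun i => unit_cis (t * ln (INR (N + i))))).
      + apply unit_cis_log_block; auto; lia.
      + intros i _; unfold unit_cis, Cconj; simpl.
        rewrite Ropp_mult_distr_l_reverse, cos_neg, sin_neg, Ropp_involutive; reflexivity. }
  rewrite (Csum_ext _ (fun i => RtoC (Rpower (INR (N + i)) (- Re s))
                     * unit_cis (- Im s * ln (INR (N + i))))%C) by (intros; apply Rcpow_polar).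
  eapply Rle_trans.
  { apply (abel_bound (fun i => Rpower (INR (N + i)) (- Re s)) _ n V); [| | exact HV].
    - intros i; apply Rlt_le, Rpower_pos.
    - intros i; apply Rpower_neg_le; [| lra].
      split; [apply lt_0_INR; lia | apply le_INR; lia]. }
  rewrite Nat.add_0_r; apply Rmult_le_compat_r.
  - generalize (HV O ltac:(lia)); simpl; rewrite Cmod_0; trivial.
  - apply Rpower_mono_exp; lra.
Qed.

Lemma pow2_between (y : R) : 1 <= y -> exists J, y <= 2 ^ J <= 2 * y.
Proof.
  intros Hy.
  assert (H : forall n, y <= 2 ^ n -> exists J, y <= 2 ^ J <= 2 * y).
  { induction n as [|n IH]; simpl; intros Hn; [exists O; simpl; lra |].
    destruct (Rle_dec y (2 ^ n)) as [h | h]; [now apply IH | exists (S n); simpl; lra]. }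
  destruct (Pow_x_infinity 2 ltac:(rewrite Rabs_right; lra) y) as [n Hn].
  apply (H n); specialize (Hn n (le_n n)).
  rewrite Rabs_right in Hn by (apply Rle_ge, pow_le; lra); lra.
Qed.

Lemma Rsum_geom q n : q <> 1 -> Rsum (fun j => q ^ j) n = (1 - q ^ n) / (1 - q).
Proof.
  intros Hq; induction n as [|n IH]; simpl; [field; lra | rewrite IH; field; lra].
Qed.

Lemma Rsum_Rpower_head tau n :
  0 <= tau < 1 ->
  Rsum (fun i => Rpower (INR (S i)) (- tau)) (S n) <= / (1 - tau) * Rpower (INR (S n)) (1 - tau).
Proof.
  intros Ht; induction n as [|n IH].
  - cbn [Rsum]; rewrite !Rpower_base1.
    assert (1 <= / (1 - tau)) by (rewrite <- Rinv_1 at 1; apply Rinv_le_contravar; lra); lra.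
  - cbn [Rsum] in IH |- *.
    assert (Hx := INR_S_pos n); rewrite (S_INR (S n)); set (x := INR (S n)) in *.
    destruct (MVT_gen (fun t => Rpower t (1 - tau)) x (x + 1)
              (fun t => (1 - tau) * Rpower t (1 - tau - 1))) as [c [Hc H]].
    + rewrite Rmin_left, Rmax_right by lra; intros y Hy.
      apply is_derive_Reals, derivable_pt_lim_power; lra.
    + rewrite Rmin_left, Rmax_right by lra; intros y Hy.
      apply derivable_continuous_pt; eexists; apply derivable_pt_lim_power; lra.
    + rewrite Rmin_left, Rmax_right in Hc by lra.
      replace (1 - tau - 1) with (- tau) in H by ring.
      assert (Hp : Rpower (x + 1) (- tau) <= Rpower c (- tau)) by (apply Rpower_neg_le; lra).
      cbv beta in H.
      assert (E : / (1 - tau) * Rpower (x + 1) (1 - tau)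
                  = / (1 - tau) * Rpower x (1 - tau) + Rpower c (- tau)).
      { replace (Rpower (x + 1) (1 - tau)) with
          (Rpower x (1 - tau) + (1 - tau) * Rpower c (- tau)) by lra.
        field; lra. }
      lra.
Qed.

(** The range [N <= n < 2^J N] is cut into the blocks from [2^j N] to [2^(j+1) N]; as their starting
    points increase, the condition on [t] persists. *)
Lemma Dirichlet_dyadic (s : C) (t tau : R) (N J : nat) :
  t = Rabs (Im s) -> 0 < t -> 0 <= tau <= Re s ->
  (1 <= N)%nat -> t <= 16 * (INR N * INR N) ->
  Cmod (Csum (fun i => Rcpow (INR (N + i)) (- s)) ((2 ^ J - 1) * N))
  <= Rsum (fun j => Rpower (2 ^ j * INR N) (- tau)
                    * (vdc_const * (sqrt t + 2 ^ j * INR N / sqrt t))) J.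
Proof.
  intros Et Ht Htau HN HtN; induction J as [|J IH].
  - simpl; rewrite Cmod_0; lra.
  - assert (P : (1 <= 2 ^ J)%nat) by (clear; induction J; simpl; lia).
    replace ((2 ^ S J - 1) * N)%nat with ((2 ^ J - 1) * N + 2 ^ J * N)%nat.
    2: { simpl; rewrite Nat.add_0_r, !Nat.mul_sub_distr_r, Nat.mul_add_distr_r.
         assert (1 * N <= 2 ^ J * N)%nat by (apply Nat.mul_le_mono_r, P); lia. }
    rewrite Csum_add; cbn [Rsum].
    eapply Rle_trans; [apply Cmod_triangle | apply Rplus_le_compat; [exact IH |]].
    assert (E : INR (2 ^ J * N) = 2 ^ J * INR N) by (rewrite mult_INR, pow_INR; reflexivity).
    rewrite <- E.
    rewrite (Csum_ext _ (fun i => Rcpow (INR (2 ^ J * N + i)) (- s))).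
    2: { intros i _; do 2 f_equal; rewrite Nat.mul_sub_distr_r.
         assert (1 * N <= 2 ^ J * N)%nat by (apply Nat.mul_le_mono_r, P); lia. }
    assert (Q : (N <= 2 ^ J * N)%nat).
    { rewrite <- (Nat.mul_1_l N) at 1; apply Nat.mul_le_mono_r, P. }
    apply Dirichlet_block; auto; [lia |].
    assert (INR N <= INR (2 ^ J * N)) by (apply le_INR, Q).
    assert (0 <= INR N) by apply pos_INR; nra.
Qed.

(** Keeping [tau] away from 0 and 1 keeps the two geometric ratios away from 1; the bounds [10/11]
    and [21/20] become the factors 11 and 20 of [dyadic_sum_bound]. *)
Lemma Rpower_2_bounds tau : 1 / 5 <= tau <= 9 / 10 ->
  0 < Rpower 2 (- tau) <= 10 / 11 /\ 21 / 20 <= Rpower 2 (1 - tau).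
Proof.
  intros H; assert (L := ln_lt_2); split; [split; [apply Rpower_pos |] |].
  - unfold Rpower; rewrite Ropp_mult_distr_l_reverse, exp_Ropp.
    replace (10 / 11) with (/ (11 / 10)) by field.
    apply Rinv_le_contravar; [lra |].
    eapply Rle_trans; [| apply exp_ineq1_le]; nra.
  - unfold Rpower; eapply Rle_trans; [| apply exp_ineq1_le]; nra.
Qed.

Lemma Rpower_pow2 j y : Rpower (2 ^ j) y = Rpower 2 y ^ j.
Proof.
  unfold Rpower; rewrite ln_pow by lra.
  induction j as [|j IH]; [simpl; rewrite Rmult_0_l, Rmult_0_r; apply exp_0 |].
  rewrite S_INR; simpl; rewrite <- IH, <- exp_plus; f_equal; ring.
Qed.

(** The part with [sqrt t] decreases geometrically and is governed by the first block; the part with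
    [/ sqrt t] grows and is governed by the end [2^J x]. *)
Lemma dyadic_sum_bound (t tau x : R) (J : nat) :
  1 / 5 <= tau <= 9 / 10 -> 0 < t -> 0 < x ->
  Rsum (fun j => Rpower (2 ^ j * x) (- tau)
                    * (vdc_const * (sqrt t + 2 ^ j * x / sqrt t))) J
  <= vdc_const * (11 * (sqrt t * Rpower x (- tau))
                  + 20 * (Rpower (2 ^ J * x) (1 - tau) / sqrt t)).
Proof.
  intros Ht Ht0 Hx; destruct (Rpower_2_bounds tau Ht) as [[q0 q1] p1].
  assert (Hr : 0 < sqrt t) by now apply sqrt_lt_R0.
  set (q := Rpower 2 (- tau)) in *; set (p := Rpower 2 (1 - tau)) in *.
  assert (E : forall j, Rpower (2 ^ j * x) (- tau)
                    * (vdc_const * (sqrt t + 2 ^ j * x / sqrt t))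
     = vdc_const * (sqrt t * Rpower x (- tau)) * q ^ j
       + vdc_const * (Rpower x (1 - tau) / sqrt t) * p ^ j).
  { intros j; assert (P : 0 < 2 ^ j) by (apply pow_lt; lra).
    rewrite <- Rpower_mult_distr, Rpower_pow2 by assumption; fold q.
    unfold p; rewrite <- Rpower_pow2.
    assert (D : forall y, 0 < y -> Rpower y (1 - tau) = y * Rpower y (- tau)).
    { intros y Hy; unfold Rminus; rewrite Rpower_plus, Rpower_1 by exact Hy; reflexivity. }
    rewrite !D, Rpower_pow2 by assumption; fold q; field; lra. }
  rewrite (Rsum_ext _ _ J (fun j _ => E j)), Rsum_plus, !Rsum_scal, !Rsum_geom by lra.
  assert (Q : (1 - q ^ J) / (1 - q) <= 11).
  { assert (0 <= q ^ J) by (apply pow_le; lra).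
    apply (Rmult_le_reg_r (1 - q)); [lra |].
    replace ((1 - q ^ J) / (1 - q) * (1 - q)) with (1 - q ^ J) by (field; lra); lra. }
  assert (P : (1 - p ^ J) / (1 - p) <= 20 * p ^ J).
  { assert (0 < p ^ J) by (apply pow_lt; lra).
    replace ((1 - p ^ J) / (1 - p)) with ((p ^ J - 1) / (p - 1)) by (field; lra).
    apply (Rmult_le_reg_r (p - 1)); [lra |].
    replace ((p ^ J - 1) / (p - 1) * (p - 1)) with (p ^ J - 1) by (field; lra); nra. }
  rewrite <- Rpower_mult_distr, Rpower_pow2 by (try apply pow_lt; lra); fold p.
  assert (A : 0 < vdc_const * (sqrt t * Rpower x (- tau))).
  { unfold vdc_const; generalize (Rpower_pos x (- tau)); intros.
    repeat apply Rmult_lt_0_compat; lra. }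
  assert (B : 0 < vdc_const * (Rpower x (1 - tau) / sqrt t)).
  { unfold vdc_const, Rdiv; generalize (Rpower_pos x (1 - tau)) (Rinv_0_lt_compat _ Hr); intros.
    repeat apply Rmult_lt_0_compat; lra. }
  apply (Rmult_le_compat_l _ _ _ (Rlt_le _ _ A)) in Q.
  apply (Rmult_le_compat_l _ _ _ (Rlt_le _ _ B)) in P.
  eapply Rle_trans; [apply Rplus_le_compat; [exact Q | exact P] |].
  right; field; lra.
Qed.

(* Convexity bound at [sigma = 1/2], obtained from blocks [sqrt t <= n <= t^(3/2)];
   beyond [t^(3/2)] the trivial Euler-Maclaurin remainder is already small enough. *)
Lemma zeta_vertical_bound (B : R) :
  exists K, 0 < K /\ forall (s : C) (tau t : R),
    t = Rabs (Im s) -> 2 <= t -> 1 / 5 <= tau <= 9 / 10 -> tau <= Re s <= B ->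
    Cmod (zeta s) <= K * (Rpower t ((1 - tau) / 2) + Rpower t (1 - 3 * tau / 2)).
Proof.
  (* 20 covers the terms below [sqrt t], the multiples of [vdc_const] the dyadic blocks, 4 the last
     term and the pole term, and [24 * (Rabs B + 1)] the truncation error. *)
  exists (20 + 11 * vdc_const + 80 * vdc_const + 4 + 24 * (Rabs B + 1)).
  split; [unfold vdc_const; generalize (Rabs_pos B); lra |].
  intros s tau t Et Ht Htau Hs.
  assert (H1 : s <> 1%C).
  { intros E; subst s; simpl in Et; rewrite Rabs_R0 in Et; lra. }
  set (r := sqrt t).
  assert (Hr : 0 < r) by (apply sqrt_lt_R0; lra).
  assert (Hrr : r * r = t) by (apply sqrt_sqrt; lra).
  assert (Hr1 : 1 <= r) by nra.
  assert (Er : r = Rpower t (1 / 2)) by (apply sqrt_Rpower; lra).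
  destruct (nfloor_ex r) as [k [k1 k2]]; [lra |].
  set (N := S k).
  assert (HN : r <= INR N <= 2 * r) by (unfold N; rewrite S_INR; lra).
  assert (HtN : t <= 16 * (INR N * INR N)) by nra.
  (* Thus [X = 2^J N] lies between [t^(3/2)] and its double, where [|s| X^(-tau)] has the size
     [t^(1 - 3 tau / 2)] of the second term of the bound. *)
  destruct (pow2_between (t * r / INR N)) as [J HJ].
  { apply (Rmult_le_reg_r (INR N)); [lra |].
    replace (t * r / INR N * INR N) with (t * r) by (field; lra); nra. }
  set (X := 2 ^ J * INR N).
  assert (HX : t * r <= X <= 2 * (t * r)).
  { unfold X; destruct HJ as [j1 j2].
    apply (Rmult_le_compat_r (INR N)) in j1; [| lra].
    apply (Rmult_le_compat_r (INR N)) in j2; [| lra].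
    replace (2 * (t * r / INR N) * INR N) with (2 * (t * r)) in j2 by (field; lra).
    replace (t * r / INR N * INR N) with (t * r) in j1 by (field; lra); lra. }
  assert (Etr : t * r = Rpower t (3 / 2)).
  { rewrite Er; rewrite <- (Rpower_1 t) at 1 by lra.
    rewrite <- Rpower_plus; f_equal; lra. }
  assert (P2 : (1 <= 2 ^ J)%nat) by (clear; induction J; simpl; lia).
  (* [zeta_approx] at [M] has [S M = 2^J N] terms: [k = N - 1] before the blocks, the blocks, and
     the single term [n = 2^J N]. *)
  set (M := (k + (2 ^ J - 1) * N)%nat).
  assert (EM : S M = (2 ^ J * N)%nat).
  { unfold M; rewrite Nat.mul_sub_distr_r.
    assert (1 * N <= 2 ^ J * N)%nat by (apply Nat.mul_le_mono_r, P2); unfold N in *; lia. }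
  assert (EX : INR (S M) = X) by (rewrite EM, mult_INR, pow_INR; reflexivity).
  assert (X1 : 1 <= X) by nra.
  set (u := Rpower t ((1 - tau) / 2)); set (v := Rpower t (1 - 3 * tau / 2)).
  assert (Xv : Rpower X (1 - tau) / r <= 2 * v).
  { apply Rle_trans with (2 * Rpower (t * r) (1 - tau) / r).
    - apply Rmult_le_compat_r; [apply Rlt_le, Rinv_0_lt_compat, Hr |].
      eapply Rle_trans; [apply (Rpower_mono_base X (2 * (t * r))); lra |].
      rewrite <- Rpower_mult_distr by nra.
      apply Rmult_le_compat_r; [apply Rlt_le, Rpower_pos |].
      rewrite <- (Rpower_1 2) at 2 by lra; apply Rpower_mono_exp; lra.
    - rewrite Etr, Er, Rpower_mult; unfold Rdiv; rewrite <- Rpower_Ropp.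
      rewrite Rmult_assoc, <- Rpower_plus; unfold v; right; do 2 f_equal; lra. }
  assert (Hu : 0 < u) by apply Rpower_pos; assert (Hv : 0 < v) by apply Rpower_pos.
  assert (Z := zeta_tail s M ltac:(lra) H1); rewrite EX in Z.
  assert (HB : Cmod s <= (Rabs B + 1) * t).
  { eapply Rle_trans; [apply Cmod_le_sum |]; rewrite <- Et, Rabs_right by lra.
    generalize (Rle_abs B) (Rabs_pos B); nra. }
  assert (Hsig : / Re s <= 5).
  { replace 5 with (/ (1 / 5)) by field; apply Rinv_le_contravar; lra. }
  assert (Hsig0 : 0 < / Re s) by (apply Rinv_0_lt_compat; lra).
  assert (T1 : 4 * Cmod s * (1 + / Re s) * Rpower X (- Re s) <= 24 * (Rabs B + 1) * v).
  { assert (Xt : Rpower X (- Re s) <= Rpower t (- (3 * tau / 2))).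
    { eapply Rle_trans; [apply (Rpower_mono_exp X (- Re s) (- tau)); lra |].
      eapply Rle_trans; [apply (Rpower_neg_le (t * r) X (- tau)); nra |].
      rewrite Etr, Rpower_mult; apply Req_le; f_equal; lra. }
    assert (Ev : v = t * Rpower t (- (3 * tau / 2))).
    { unfold v; rewrite <- (Rpower_1 t) at 2 by lra; rewrite <- Rpower_plus; f_equal. }
    rewrite Ev.
    replace (24 * (Rabs B + 1) * (t * Rpower t (- (3 * tau / 2)))) with
      (4 * ((Rabs B + 1) * t) * (1 + 5) * Rpower t (- (3 * tau / 2))) by ring.
    generalize (Cmod_ge_0 s) (Rpower_pos X (- Re s)); intros.
    apply Rmult_le_compat; [| lra | | exact Xt].
    - apply Rmult_le_pos; lra.
    - apply Rmult_le_compat; lra. }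
  unfold zeta_approx in Z; rewrite EX in Z.
  set (L := ((2 ^ J - 1) * N)%nat).
  rewrite Csum_sum_n in Z; replace (S M) with (k + S L)%nat in Z by (unfold M, L; lia).
  rewrite Csum_add in Z; cbn [Csum] in Z.
  set (A := Csum (fun n => Rcpow (INR (S n)) (- s)) k) in Z.
  rewrite (Csum_ext (fun i => Rcpow (INR (S (k + i))) (- s))
             (fun i => Rcpow (INR (N + i)) (- s)) L) in Z by reflexivity.
  set (D := Csum _ L) in Z.
  assert (HA : Cmod A <= 20 * u).
  { destruct k as [|k']; [simpl in k2; lra |].
    apply Rle_trans with (Rsum (fun i => Rpower (INR (S i)) (- tau)) (S k')).
    - apply Cmod_Csum_le; intros i _; rewrite Cmod_Rcpow, re_opp.
      apply Rpower_mono_exp; [apply INR_S_ge1 | lra].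
    - eapply Rle_trans; [apply Rsum_Rpower_head; lra |].
      assert (I : / (1 - tau) <= 10).
      { replace 10 with (/ (1 / 10)) by field; apply Rinv_le_contravar; lra. }
      assert (I0 : 0 < / (1 - tau)) by (apply Rinv_0_lt_compat; lra).
      assert (U : Rpower (INR (S k')) (1 - tau) <= u).
      { eapply Rle_trans; [apply (Rpower_mono_base _ r); [| lra] |].
        - split; [apply INR_S_pos | lra].
        - rewrite Er, Rpower_mult; apply Req_le; unfold u; f_equal; lra. }
      generalize (Rpower_pos (INR (S k')) (1 - tau)); nra. }
  assert (HD : Cmod D <= vdc_const * (11 * u + 20 * (2 * v))).
  { eapply Rle_trans; [apply (Dirichlet_dyadic s t tau N J); try assumption; unfold N; lra || lia |].
    eapply Rle_trans; [apply dyadic_sum_bound; lra |].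
    fold X r.
    assert (U : r * Rpower (INR N) (- tau) <= u).
    { apply Rle_trans with (r * Rpower r (- tau)).
      - apply Rmult_le_compat_l; [lra | apply Rpower_neg_le; lra].
      - rewrite <- (Rpower_1 r) at 1 by lra; rewrite <- Rpower_plus, Er, Rpower_mult.
        apply Req_le; unfold u; f_equal; lra. }
    apply Rmult_le_compat_l; [unfold vdc_const; lra | lra]. }
  set (F := Rcpow (INR (S (k + L))) (- s)) in Z.
  assert (HF : Cmod F <= v).
  { unfold F; rewrite Cmod_Rcpow, re_opp.
    replace (S (k + L)) with (S M) by (unfold M, L; lia); rewrite EX.
    eapply Rle_trans; [apply (Rpower_mono_exp X (- Re s) (- tau)); lra |].
    eapply Rle_trans; [apply (Rpower_neg_le (t * r) X (- tau)); nra |].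
    rewrite Etr, Rpower_mult; unfold v; apply Rpower_mono_exp; lra. }
  set (Q := (Rcpow X (1 - s) / (1 - s))%C) in Z.
  assert (HQ : Cmod Q <= 2 * v).
  { unfold Q, Cdiv; rewrite Cmod_mult, Cmod_Rcpow, Cmod_inv by now apply Cminus1_neq.
    eapply Rle_trans; [| exact Xv].
    assert (r <= Cmod (1 - s)).
    { apply Rle_trans with t; [nra |].
      eapply Rle_trans; [| apply im_le_Cmod].
      replace (Im (1 - s)) with (- Im s) by (simpl; unfold Im; simpl; ring).
      rewrite Rabs_Ropp; lra. }
    apply Rmult_le_compat; [apply Rlt_le, Rpower_pos | | | apply Rinv_le_contravar; lra].
    - apply Rlt_le, Rinv_0_lt_compat; lra.
    - apply Rpower_mono_exp; [exact X1 |]; simpl; unfold Re in *; simpl; lra. }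
  replace (zeta s) with ((zeta s - (A + (D + F) - Q)) + A + D + F - Q)%C by ring.
  assert (W1 := Cmod_triangle_sub ((zeta s - (A + (D + F) - Q)) + A + D + F) Q).
  assert (W2 := Cmod_triangle ((zeta s - (A + (D + F) - Q)) + A + D) F).
  assert (W3 := Cmod_triangle ((zeta s - (A + (D + F) - Q)) + A) D).
  assert (W4 := Cmod_triangle (zeta s - (A + (D + F) - Q)) A).
  assert (HB0 := Rabs_pos B).
  unfold vdc_const in *; nra.
Qed.

(** * Twisted integrals of the Euler-Maclaurin terms *)

(** The 4 is the factor 2 of [Cmvt_le] applied twice. The endpoints may come in either order, since
    the increments used later have either sign. *)
Lemma Ctaylor2 (f f1 f2 : R -> C) a b M :
  (forall x, Rmin a b <= x <= Rmax a b -> cder f x (f1 x)) ->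
  (forall x, Rmin a b <= x <= Rmax a b -> cder f1 x (f2 x)) ->
  (forall x, Rmin a b <= x <= Rmax a b -> Cmod (f2 x) <= M) ->
  Cmod (f b - f a - (b - a)%R * f1 a) <= 4 * M * ((b - a) * (b - a)).
Proof.
  intros H1 H2 HM.
  assert (HM0 : 0 <= M).
  { eapply Rle_trans; [apply Cmod_ge_0 | apply (HM a)].
    split; [apply Rmin_l | apply Rmax_l]. }
  assert (HL : forall x, Rmin a b <= x <= Rmax a b ->
            Cmod (f1 x - f1 a) <= 2 * M * Rabs (b - a)).
  { intros x Hx; destruct (Rle_dec a b) as [h | h].
    - rewrite Rmin_left, Rmax_right in Hx, H2, HM by lra.
      eapply Rle_trans; [apply (Cmvt_le f1 f2 a x M); [lra | |] |].
      + intros; apply H2; lra.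
      + intros; apply HM; lra.
      + rewrite Rabs_right by lra; apply Rmult_le_compat_l; lra.
    - rewrite Rmin_right, Rmax_left in Hx, H2, HM by lra.
      replace (f1 x - f1 a)%C with (- (f1 a - f1 x))%C by ring; rewrite Cmod_opp.
      eapply Rle_trans; [apply (Cmvt_le f1 f2 x a M); [lra | |] |].
      + intros; apply H2; lra.
      + intros; apply HM; lra.
      + rewrite Rabs_left by lra; apply Rmult_le_compat_l; lra. }
  assert (Hc : forall x, Rmin a b <= x <= Rmax a b ->
            cder (fun x => f x - f1 a * RtoC x)%C x (f1 x - f1 a)%C).
  { intros x Hx; apply cder_minus; [apply H1, Hx | apply cder_line]. }
  set (phi := fun x => (f x - f1 a * RtoC x)%C).
  replace (f b - f a - (b - a)%R * f1 a)%C with (phi b - phi a)%C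
    by (unfold phi; rewrite RtoC_minus; ring).
  destruct (Rle_dec a b) as [h | h].
  - rewrite Rmin_left, Rmax_right in HL, Hc by lra.
    eapply Rle_trans; [apply (Cmvt_le phi _ a b _ h Hc HL) |].
    rewrite Rabs_right by lra; right; ring.
  - rewrite Rmin_right, Rmax_left in HL, Hc by lra.
    replace (phi b - phi a)%C with (- (phi a - phi b))%C by ring; rewrite Cmod_opp.
    eapply Rle_trans; [apply (Cmvt_le phi _ b a _ ltac:(lra) Hc HL) |].
    rewrite Rabs_left by lra; right; ring.
Qed.

Lemma cder_Rcpow_exponent (u : R) (z : R -> C) t z' :
  cder z t z' -> cder (fun t => Rcpow u (z t)) t (z' * RtoC (ln u) * Rcpow u (z t))%C.
Proof.
  intros H; apply (cder_Cexp (fun t => z t * RtoC (ln u))%C).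
  eapply cder_eq; [| apply cder_mult; [exact H | apply cder_const]]; simpl; ring.
Qed.

(** Differentiation in the base [u], needed because the Euler-Maclaurin step is taken on integrals
    over [t]. For [|h| <= 1/2] the base stays in [[1/2, u0 + 1/2]], where its logarithm, and so the
    second derivative, is bounded. *)
Lemma cder_CI_Rcpow (c z : R -> C) (a b Mc Mz u0 : R) :
  a <= b -> 1 <= u0 ->
  (forall t, a <= t <= b -> ccont c t) ->
  (forall t, a <= t <= b -> exists l, cder z t l) ->
  (forall t, a <= t <= b -> Cmod (c t) <= Mc) ->
  (forall t, a <= t <= b -> Cmod (z t) <= Mz) ->
  cder (fun u => CI (fun t => c t * Rcpow u (z t))%C a b) u0
    (CI (fun t => c t * (z t * Rcpow u0 (z t - 1)))%C a b).
Proof.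
  intros Hab Hu Hc Hz HMc HMz.
  assert (M1 : 0 <= Mc) by (eapply Rle_trans; [apply Cmod_ge_0 | apply (HMc a); lra]).
  assert (M2 : 0 <= Mz) by (eapply Rle_trans; [apply Cmod_ge_0 | apply (HMz a); lra]).
  set (L := Rabs (ln (1 / 2)) + Rabs (ln (u0 + 1 / 2))).
  assert (HL : forall u, 1 / 2 <= u <= u0 + 1 / 2 -> Rabs (ln u) <= L).
  { intros u Hu'; assert (ln (1 / 2) <= ln u) by (apply ln_le; lra).
    assert (ln u <= ln (u0 + 1 / 2)) by (apply ln_le; lra).
    unfold L; generalize (Rle_abs (ln (u0 + 1 / 2))) (Rle_abs (- ln (1 / 2)))
      (Rabs_pos (ln (1 / 2))) (Rabs_pos (ln (u0 + 1 / 2))); rewrite Rabs_Ropp; intros.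
    apply Rabs_le; lra. }
  assert (Hcz : forall t, a <= t <= b -> ccont z t).
  { intros t Ht; destruct (Hz t Ht); eapply cder_ccont; eassumption. }
  assert (Hcr : forall u k t, a <= t <= b -> ccont (fun t => Rcpow u (z t - k)) t).
  { intros u k t Ht; destruct (Hz t Ht) as [l Hl].
    eapply cder_ccont, (cder_Rcpow_exponent u (fun t => z t - k)%C).
    apply cder_minus; [exact Hl | apply cder_const]. }
  assert (Hcr0 : forall u t, a <= t <= b -> ccont (fun t => Rcpow u (z t)) t).
  { intros u t Ht; destruct (Hz t Ht) as [l Hl].
    eapply cder_ccont, cder_Rcpow_exponent; exact Hl. }
  set (E := exp ((Mz + 2) * L)).
  apply (CI_param a b Hab (fun u t => c t * Rcpow u (z t))%C
    (fun u t => c t * (z t * Rcpow u (z t - 1)))%C u0 (1 / 2)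
    (4 * (Mc * (Mz * ((Mz + 1) * E))))).
  - lra.
  - intros h t Hh Ht; apply Rabs_le_between in Hh.
    assert (T := Ctaylor2 (fun u => c t * Rcpow u (z t))%C
      (fun u => c t * (z t * Rcpow u (z t - 1)))%C
      (fun u => c t * (z t * ((z t - 1) * Rcpow u (z t - 1 - 1))))%C
      u0 (u0 + h) (Mc * (Mz * ((Mz + 1) * E)))).
    cbv beta in T; replace (u0 + h - u0) with h in T by ring.
    apply T; intros u Hu'.
    + apply cder_scal, cder_Rcpow.
      assert (u0 - 1 / 2 <= Rmin u0 (u0 + h)) by (apply Rmin_glb; lra); lra.
    + apply cder_scal, cder_scal, cder_Rcpow.
      assert (u0 - 1 / 2 <= Rmin u0 (u0 + h)) by (apply Rmin_glb; lra); lra.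
    + assert (u0 - 1 / 2 <= Rmin u0 (u0 + h)) by (apply Rmin_glb; lra).
      assert (Rmax u0 (u0 + h) <= u0 + 1 / 2) by (apply Rmax_lub; lra).
      assert (HLu := HL u ltac:(lra)).
      rewrite !Cmod_mult.
      assert (Q : Cmod (Rcpow u (z t - 1 - 1)) <= E).
      { rewrite Cmod_Rcpow; unfold Rpower, E; apply exp_le.
        eapply Rle_trans; [apply Rle_abs |]; rewrite Rabs_mult.
        apply Rmult_le_compat; try apply Rabs_pos; [| exact HLu].
        eapply Rle_trans; [apply re_le_Cmod |].
        replace (z t - 1 - 1)%C with (z t - RtoC 2)%C by (replace (RtoC 2) with (1 + 1)%C by (rewrite <- RtoC_plus; f_equal; ring); ring).
        eapply Rle_trans; [apply Cmod_triangle_sub |].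
        rewrite Cmod_R, Rabs_right by lra; generalize (HMz t Ht); lra. }
      assert (Q1 : Cmod (z t - 1) <= Mz + 1).
      { eapply Rle_trans; [apply Cmod_triangle_sub |]; rewrite Cmod_1.
        generalize (HMz t Ht); lra. }
      generalize (HMz t Ht) (HMc t Ht) (Cmod_ge_0 (z t)) (Cmod_ge_0 (c t))
        (Cmod_ge_0 (z t - 1)) (Cmod_ge_0 (Rcpow u (z t - 1 - 1))); intros.
      repeat (apply Rmult_le_compat; [assumption || (repeat apply Rmult_le_pos; assumption) .. | |]);
        try assumption; repeat apply Rmult_le_pos; assumption.
  - intros h t _ Ht; apply ccont_mult; auto.
  - intros t Ht; apply ccont_mult; auto; apply ccont_mult; auto.
Qed.

(** * Oscillatory kernels and twisted power integrals *)

Definition osc (v t : R) : C := Cexp (Ci * v * t).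

Lemma Cmod_osc v t : Cmod (osc v t) = 1.
Proof.
  unfold osc; rewrite Cmod_Cexp; rewrite <- exp_0; f_equal; simpl; unfold Re; simpl; ring.
Qed.

Lemma cder_osc v t : cder (osc v) t (Ci * v * osc v t)%C.
Proof. apply (cder_Cexp (fun t => Ci * v * RtoC t)%C), cder_line. Qed.

Lemma ccont_osc v t : ccont (osc v) t.
Proof. eapply cder_ccont, cder_osc. Qed.

Definition kern (T v : R) : C := CI (osc v) 1 T.
(** The integrand is the derivative of [osc v t] in [v]; this kernel appears when
    [kern T (w - ln u)] is differentiated in [u]. *)
Definition kern1 (T v : R) : C := CI (fun t => Ci * t * osc v t)%C 1 T.

Section Kernel.
Variables (T v : R).
Hypothesis HT : 1 <= T.

Lemma kern_0 : kern T 0 = RtoC (T - 1).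
Proof.
  unfold kern; rewrite (CI_ext 1 T HT _ (fun _ => 1%C)).
  - rewrite CI_const; ring.
  - intros t _; unfold osc; rewrite <- Cexp_0; f_equal; ring.
Qed.

Lemma kern_le : Cmod (kern T v) <= 2 * T.
Proof.
  eapply Rle_trans; [apply (CI_bound 1 T HT (osc v) 1) |]; [| | lra].
  - intros; apply ccont_osc.
  - intros; rewrite Cmod_osc; lra.
Qed.

Lemma ccont_line t : ccont (fun t => Ci * t)%C t.
Proof. eapply cder_ccont, cder_line. Qed.

Lemma kern1_le : Cmod (kern1 T v) <= 2 * (T * T).
Proof.
  eapply Rle_trans; [apply (CI_bound 1 T HT _ T) |]; [| | nra].
  - intros; apply ccont_mult; [apply ccont_line | apply ccont_osc].
  - intros t Ht; rewrite !Cmod_mult, Cmod_Ci, Cmod_osc, Cmod_R, Rabs_right; lra.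
Qed.

Hypothesis Hv : v <> 0.

Lemma kern_eq : (Ci * v * kern T v)%C = (osc v T - osc v 1)%C.
Proof.
  unfold kern; rewrite <- CI_scal by (auto; intros; apply ccont_osc).
  apply (CI_FTC 1 T HT (osc v)); intros t _; [apply cder_osc |].
  apply ccont_mult; [apply ccont_const | apply ccont_osc].
Qed.

(** Integration by parts, with [t * osc v t] as the primitive. *)
Lemma kern1_eq : (v * kern1 T v)%C = (T * osc v T - osc v 1 - kern T v)%C.
Proof.
  assert (H : CI (fun t => v * (Ci * t * osc v t) + osc v t)%C 1 T = (T * osc v T - 1 * osc v 1)%C).
  { apply (CI_FTC 1 T HT (fun t => t * osc v t)%C); intros t _.
    - eapply cder_eq; [| apply cder_mult; [apply (cder_RtoC (fun t => t)), is_derive_id | apply cder_osc]].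
      change (@one R_AbsRing) with 1; ring.
    - apply ccont_plus; [| apply ccont_osc].
      apply ccont_mult; [apply ccont_const |].
      apply ccont_mult; [apply ccont_line | apply ccont_osc]. }
  rewrite CI_plus, CI_scal in H; try assumption.
  - fold (kern1 T v) (kern T v) in H.
    replace (v * kern1 T v)%C with (v * kern1 T v + kern T v - kern T v)%C by ring.
    rewrite H; ring.
  - intros; apply ccont_mult; [apply ccont_line | apply ccont_osc].
  - intros; apply ccont_mult; [apply ccont_const |].
    apply ccont_mult; [apply ccont_line | apply ccont_osc].
  - intros; apply ccont_osc.
Qed.

Lemma kern_decay : Cmod (kern T v) <= 2 / Rabs v.
Proof.
  assert (P := Rabs_pos_lt v Hv).
  assert (H := f_equal Cmod kern_eq).
  rewrite !Cmod_mult, Cmod_Ci, Cmod_R, Rmult_1_l in H.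
  assert (H2 := Cmod_triangle_sub (osc v T) (osc v 1)).
  rewrite !Cmod_osc in H2.
  apply (Rmult_le_reg_l (Rabs v)); [exact P |].
  replace (Rabs v * (2 / Rabs v)) with 2 by (field; lra); lra.
Qed.

Lemma kern1_decay : Cmod (kern1 T v) <= 4 * T / Rabs v.
Proof.
  assert (P := Rabs_pos_lt v Hv).
  assert (H := f_equal Cmod kern1_eq).
  rewrite Cmod_mult, Cmod_R in H.
  assert (H2 := Cmod_triangle_sub (T * osc v T - osc v 1) (kern T v)).
  assert (H3 := Cmod_triangle_sub (T * osc v T) (osc v 1)).
  rewrite Cmod_mult, !Cmod_osc, Cmod_R, Rabs_right in H3 by lra.
  generalize kern_le; intros.
  apply (Rmult_le_reg_l (Rabs v)); [exact P |].
  replace (Rabs v * (4 * T / Rabs v)) with (4 * T) by (field; lra); lra.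
Qed.

End Kernel.

Lemma osc_plus v w t : osc (v + w) t = (osc v t * osc w t)%C.
Proof. unfold osc; rewrite <- Cexp_plus; f_equal; rewrite RtoC_plus; ring. Qed.

Lemma Cexp_RtoC y : Cexp (RtoC y) = RtoC (exp y).
Proof. unfold Cexp, RtoC; simpl; rewrite cos_0, sin_0; f_equal; ring. Qed.

Lemma Rcpow_line u x t : Rcpow u (- (x, t)) = (RtoC (Rpower u (- x)) * osc (- ln u) t)%C.
Proof.
  unfold Rcpow, osc, Rpower; rewrite <- Cexp_RtoC, <- Cexp_plus; f_equal.
  rewrite RtoC_opp, RtoC_mult, RtoC_opp, pair_im; ring.
Qed.

Lemma osc_Rcpow_line u x w t :
  (osc w t * Rcpow u (- (x, t)))%C = (RtoC (Rpower u (- x)) * osc (w - ln u) t)%C.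
Proof. rewrite Rcpow_line; unfold Rminus; rewrite osc_plus; ring. Qed.

Lemma Rcpow_sub1 u z : 0 < u -> Rcpow u (z - 1) = (/ u * Rcpow u z)%C.
Proof.
  intros Hu; unfold Cminus; rewrite Rcpow_plus.
  assert (H : (Rcpow u (- (1)) * u = 1)%C).
  { rewrite <- (Rcpow_1 u Hu) at 1; rewrite <- Rcpow_plus.
    replace (- (1) + 1)%C with (RtoC 0) by ring.
    unfold Rcpow; rewrite Cmult_0_l; apply Cexp_0. }
  assert (Hu0 : RtoC u <> 0) by (intros E; apply RtoC_inj in E; lra).
  replace (Rcpow u (- (1))) with (Rcpow u (- (1)) * u * / u)%C by (field; exact Hu0).
  rewrite H; ring.
Qed.

Lemma twisted_power T u x w :
  1 <= T ->
  CI (fun t => osc w t * Rcpow u (- (x, t)))%C 1 T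
  = (RtoC (Rpower u (- x)) * kern T (w - ln u))%C.
Proof.
  intros HT; unfold kern; rewrite <- CI_scal by (auto; intros; apply ccont_osc).
  apply CI_ext; [exact HT |]; intros; apply osc_Rcpow_line.
Qed.

Lemma cder_vertical x t : cder (fun t => (x, t)) t Ci.
Proof. split; simpl; unfold Re, Im; simpl; auto_derive; trivial; ring. Qed.

Lemma ccont_Rcpow_line u x t : ccont (fun t => Rcpow u (- (x, t))) t.
Proof.
  eapply cder_ccont, (cder_Rcpow_exponent u (fun t => - (x, t))%C), cder_opp, cder_vertical.
Qed.

Lemma one_minus_line_neq (x t : R) : x <> 1 -> (1 - (x, t))%C <> 0.
Proof. intros Hx E; apply (f_equal Re) in E; unfold Re in E; simpl in E; lra. Qed.

Lemma ccont_inv_line (x t : R) : x <> 1 -> ccont (fun t => / (1 - (x, t)))%C t.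
Proof.
  intros Hx; unfold Cinv; simpl.
  assert (N : forall t, (1 + - x) * ((1 + - x) * 1) + (0 + - t) * ((0 + - t) * 1) <> 0).
  { intros u; assert (0 < (1 - x) * (1 - x)) by (apply Rsqr_pos_lt; lra); nra. }
  split; apply (@ex_derive_continuous R_AbsRing R_NormedModule); unfold Re, Im; simpl;
    auto_derive; apply N.
Qed.

Lemma ccont_Rcpow_one_minus_line u x t : ccont (fun t => Rcpow u (1 - (x, t))) t.
Proof.
  eapply cder_ccont, (cder_Rcpow_exponent u (fun t => 1 - (x, t))%C), cder_minus;
    [apply cder_const | apply cder_vertical].
Qed.

Lemma ccont_zeta_term x n t : x <> 1 -> ccont (fun t => zeta_term (x, t) n) t.
Proof.
  intros Hx; assert (H := ccont_inv_line x t Hx).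
  unfold zeta_term, Cdiv; apply ccont_minus; [apply ccont_Rcpow_line | apply ccont_minus];
    apply ccont_mult; auto; apply ccont_Rcpow_one_minus_line.
Qed.

(** The derivative in [u] of [\int osc w t * u^(-(x + it)) dt], the general term of the twisted
    integral seen as a function of a real variable. *)
Definition twisted_derivative T x w u : C :=
  CI (fun t => osc w t * (- (x, t) * Rcpow u (- (x, t) - 1)))%C 1 T.

Lemma twisted_derivative_eq T x w u :
  1 <= T -> 0 < u ->
  twisted_derivative T x w u
  = (RtoC (Rpower u (- x) / u) * (- x * kern T (w - ln u) - kern1 T (w - ln u)))%C.
Proof.
  intros HT Hu; unfold twisted_derivative, kern, kern1.
  assert (H0 : forall t, ccont (osc (w - ln u)) t) by (intros; apply ccont_osc).
  rewrite <- CI_scal, <- CI_minus, <- CI_scal; auto.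
  - apply CI_ext; [exact HT |]; intros t _.
    rewrite Rcpow_sub1 by exact Hu.
    replace (osc w t * (- (x, t) * (/ u * Rcpow u (- (x, t)))))%C
      with (- (x, t) * / u * (osc w t * Rcpow u (- (x, t))))%C by ring.
    rewrite osc_Rcpow_line.
    rewrite RtoC_div by lra; rewrite pair_im; unfold Cdiv; ring.
  - intros; apply ccont_minus.
    + apply ccont_mult; [apply ccont_const | auto].
    + apply ccont_mult; [apply ccont_line | auto].
  - intros; apply ccont_mult; [apply ccont_const | auto].
  - intros; apply ccont_mult; [apply ccont_line | auto].
Qed.

Lemma twisted_derivative_le T x w u :
  1 <= T -> 0 <= x <= 1 -> 0 < u ->
  Cmod (twisted_derivative T x w u) <= Rpower u (- x) / u * (4 * (T * T)).
Proof.
  intros HT Hx Hu; rewrite twisted_derivative_eq, Cmod_mult, Cmod_R by assumption.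
  assert (P : 0 < Rpower u (- x) / u) by (apply Rdiv_lt_0_compat; [apply Rpower_pos | exact Hu]).
  rewrite Rabs_right by lra; apply Rmult_le_compat_l; [lra |].
  eapply Rle_trans; [apply Cmod_triangle_sub |].
  rewrite Cmod_mult, Cmod_opp, Cmod_R, Rabs_right by lra.
  generalize (kern_le T (w - ln u) HT) (kern1_le T (w - ln u) HT) (Cmod_ge_0 (kern T (w - ln u))).
  nra.
Qed.

Lemma twisted_derivative_decay T x w u :
  1 <= T -> 0 <= x <= 1 -> 0 < u -> w - ln u <> 0 ->
  Cmod (twisted_derivative T x w u) <= Rpower u (- x) / u * (6 * T / Rabs (w - ln u)).
Proof.
  intros HT Hx Hu Hv; rewrite twisted_derivative_eq, Cmod_mult, Cmod_R by assumption.
  assert (P : 0 < Rpower u (- x) / u) by (apply Rdiv_lt_0_compat; [apply Rpower_pos | exact Hu]).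
  rewrite Rabs_right by lra; apply Rmult_le_compat_l; [lra |].
  eapply Rle_trans; [apply Cmod_triangle_sub |].
  rewrite Cmod_mult, Cmod_opp, Cmod_R, Rabs_right by lra.
  generalize (kern_decay T (w - ln u) HT Hv) (kern1_decay T (w - ln u) HT Hv)
    (Cmod_ge_0 (kern T (w - ln u))) (Rinv_0_lt_compat _ (Rabs_pos_lt _ Hv)).
  unfold Rdiv; intros; nra.
Qed.

(** [step_bound] is applied to the integrals [q] and [p] as functions of the base, so the
    cancellation in [t] is kept and enters through [twisted_derivative]. Integrating [zeta_term_le]
    would lose it. *)
Lemma twisted_zeta_term_le T x w n M :
  1 <= T -> 0 < x < 1 ->
  (forall u, INR (S n) <= u <= INR (S n) + 1 -> Cmod (twisted_derivative T x w u) <= M) ->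
  Cmod (CI (fun t => osc w t * zeta_term (x, t) n)%C 1 T) <= 4 * M.
Proof.
  intros HT Hx HM; assert (Hn := INR_S_ge1 n).
  set (d := fun t => (/ (1 - (x, t)))%C).
  assert (Nd : forall t, (1 - (x, t))%C <> 0) by (intros; apply one_minus_line_neq; lra).
  assert (Cd : forall t, ccont d t) by (intros; apply ccont_inv_line; lra).
  assert (Md : forall t, Cmod (d t) <= / (1 - x)).
  { intros t; unfold d; rewrite Cmod_inv by apply Nd.
    apply Rinv_le_contravar; [lra |].
    eapply Rle_trans; [| apply Re_le_Cmod]; right; unfold Re; simpl; ring. }
  assert (Mz : forall t, 1 <= t <= T -> Cmod (x, t) <= 1 + T).
  { intros t Ht; eapply Rle_trans; [apply Cmod_le_sum |]; unfold Re, Im; simpl.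
    rewrite !Rabs_right; lra. }
  set (q := fun u => CI (fun t => osc w t * d t * Rcpow u (1 - (x, t)))%C 1 T).
  set (p := fun u => CI (fun t => osc w t * Rcpow u (- (x, t)))%C 1 T).
  assert (Cr := fun u t => ccont_Rcpow_one_minus_line u x t).
  assert (Cq : forall u t, ccont (fun t => osc w t * d t * Rcpow u (1 - (x, t)))%C t).
  { intros; apply ccont_mult; [apply ccont_mult; [apply ccont_osc | apply Cd] | apply Cr]. }
  assert (Cp : forall u t, ccont (fun t => osc w t * Rcpow u (- (x, t)))%C t).
  { intros; apply ccont_mult; [apply ccont_osc | apply ccont_Rcpow_line]. }
  replace (CI (fun t => osc w t * zeta_term (x, t) n)%C 1 T)
    with (p (INR (S n) + 1)%R - (q (INR (S n) + 1)%R - q (INR (S n))))%C.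
  2: { unfold p, q; rewrite <- CI_minus by auto.
       rewrite <- CI_minus; [| exact HT | auto | intros; apply ccont_minus; apply Cq].
       apply CI_ext; [exact HT |]; intros t _; unfold zeta_term, d, Cdiv; ring. }
  apply (step_bound q p (twisted_derivative T x w)); [| | exact HM].
  - intros u Hu; unfold q.
    eapply cder_eq; [| apply (cder_CI_Rcpow (fun t => osc w t * d t)%C (fun t => 1 - (x, t))%C
      1 T (/ (1 - x)) (2 + T)); [exact HT | lra | | | |]].
    + unfold p; apply CI_ext; [exact HT |]; intros t _; unfold d.
      replace (1 - (x, t) - 1)%C with (- (x, t))%C by ring; field; apply Nd.
    + intros; apply ccont_mult; [apply ccont_osc | apply Cd].
    + intros; eexists; apply cder_minus; [apply cder_const | apply cder_vertical].
    + intros; rewrite Cmod_mult, Cmod_osc, Rmult_1_l; apply Md.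
    + intros t Ht; eapply Rle_trans; [apply Cmod_triangle_sub |]; rewrite Cmod_1.
      generalize (Mz t Ht); lra.
  - intros u Hu; unfold p, twisted_derivative.
    apply (cder_CI_Rcpow (osc w) (fun t => - (x, t))%C 1 T 1 (1 + T)); [exact HT | lra | | | |].
    + intros; apply ccont_osc.
    + intros; eexists; apply cder_opp, cder_vertical.
    + intros; rewrite Cmod_osc; lra.
    + intros t Ht; rewrite Cmod_opp; apply Mz, Ht.
Qed.

(** * The first moment of zeta twisted by an integer *)

Lemma ccont_zeta_line (x t : R) : 0 < x -> (x, t) <> RtoC 1 -> ccont (fun u => zeta (x, u)) t.
Proof.
  intros Hx H1.
  assert (H := ex_derive_continuous _ _ (zeta_holomorphic (x, t) Hx H1)).
  assert (L : filterlim (fun u : R => (x, u)) (locally t)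
                (@locally (AbsRing_UniformSpace C_AbsRing) (x, t))).
  { intros P [eps HP]; exists eps; intros y Hy; apply HP.
    change (Cmod ((x, y) - (x, t)) < eps).
    replace ((x, y) - (x, t))%C with (Ci * (y - t)%R)%C
      by (unfold Cminus, Cplus, Copp, Cmult, Ci, RtoC; simpl; f_equal; ring).
    rewrite Cmod_mult, Cmod_Ci, Cmod_R, Rmult_1_l; exact Hy. }
  assert (H2 := filterlim_comp _ _ _ _ _ _ _ _ L H).
  split.
  - eapply filterlim_comp; [exact H2 |].
    destruct (zeta (x, t)) as [m1 m2]; apply (continuous_fst m1 m2).
  - eapply filterlim_comp; [exact H2 |].
    destruct (zeta (x, t)) as [m1 m2]; apply (continuous_snd m1 m2).
Qed.

(** * Sums over the distance to the twist *)

Lemma inv_log_diff a b : 0 < a < b -> / Rabs (ln a - ln b) <= b / (b - a).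
Proof.
  intros H.
  assert (L := ln_ge_sub1 (b / a) ltac:(apply Rdiv_lt_0_compat; lra)).
  rewrite ln_div in L by lra.
  replace (1 - / (b / a)) with ((b - a) / b) in L by (field; lra).
  assert (P : 0 < (b - a) / b) by (apply Rdiv_lt_0_compat; lra).
  rewrite Rabs_left by lra.
  replace (b / (b - a)) with (/ ((b - a) / b)) by (field; lra).
  apply Rinv_le_contravar; lra.
Qed.

Lemma ln_neq a b : 0 < a < b -> ln a - ln b <> 0.
Proof. intros H; assert (ln a < ln b) by (apply ln_increasing; lra); lra. Qed.

(** A sum of a function of the distance to [k], over a window of indices, becomes a difference of
    initial sums. Truncated subtraction makes the identity hold also when the window lies partly or
    wholly beyond [k]. *)
Lemma Rsum_below (f : nat -> R) k p m :
  Rsum (fun i => if (p + i <? k)%nat then f (k - 1 - (p + i))%nat else 0) m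
  = Rsum f (k - p) - Rsum f (k - p - m).
Proof.
  induction m as [|m IH]; [rewrite Nat.sub_0_r; simpl; ring |].
  cbn [Rsum]; rewrite IH.
  destruct (Nat.ltb_spec (p + m) k) as [h | h].
  - replace (k - p - m)%nat with (S (k - p - S m)) by lia; cbn [Rsum].
    replace (k - 1 - (p + m))%nat with (k - p - S m)%nat by lia; ring.
  - replace (k - p - S m)%nat with (k - p - m)%nat by lia; ring.
Qed.

Lemma Rsum_above (f : nat -> R) k p m :
  Rsum (fun i => if (k <=? p + i)%nat then f (p + i - k)%nat else 0) m
  = Rsum f (p + m - k) - Rsum f (p - k).
Proof.
  induction m as [|m IH]; [rewrite Nat.add_0_r; simpl; ring |].
  cbn [Rsum]; rewrite IH.
  destruct (Nat.leb_spec k (p + m)) as [h | h].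
  - replace (p + S m - k)%nat with (S (p + m - k)) by lia; cbn [Rsum]; ring.
  - replace (p + S m - k)%nat with O by lia; replace (p + m - k)%nat with O by lia.
    replace (p - k)%nat with O by lia; ring.
Qed.

Lemma Rsum_mono_n f n m : (forall i, 0 <= f i) -> (n <= m)%nat -> Rsum f n <= Rsum f m.
Proof.
  intros Hf Hnm; replace m with (n + (m - n))%nat by lia; rewrite Rsum_add.
  assert (0 <= Rsum (fun i => f (n + i)%nat) (m - n)) by (apply Rsum_nonneg; auto); lra.
Qed.

Lemma Rsum_harmonic n : Rsum (fun i => / INR (S i)) (S n) <= 1 + ln (INR (S n)).
Proof.
  induction n as [|n IH].
  - simpl; rewrite ln_1; lra.
  - cbn [Rsum] in IH |- *.
    assert (Hx := INR_S_pos n).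
    assert (L := ln_ge_sub1 (INR (S (S n)) / INR (S n))
                   ltac:(apply Rdiv_lt_0_compat; apply INR_S_pos)).
    rewrite ln_div in L by apply INR_S_pos.
    rewrite (S_INR (S n)) in *.
    replace (1 - / ((INR (S n) + 1) / INR (S n))) with (/ (INR (S n) + 1)) in L by (field; lra).
    lra.
Qed.

(* Dominates [n ^ (- sg) / |n - k|], summed over [n > y], as a function of the
   distance [d = |n - k|] alone. *)
Definition gap_weight (y : nat) (sg : R) (d : nat) : R :=
  Rpower (INR (max (S y) d)) (- sg) / INR (max d 1).

Lemma gap_weight_pos y sg d : 0 < gap_weight y sg d.
Proof. apply Rdiv_lt_0_compat; [apply Rpower_pos | apply lt_0_INR; lia]. Qed.

Lemma gap_weight_ge y sg d N :
  0 <= sg -> (S y <= N)%nat -> (d <= N)%nat -> (1 <= d)%nat ->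
  Rpower (INR N) (- sg) / INR d <= gap_weight y sg d.
Proof.
  intros Hs H1 H2 H3; unfold gap_weight; replace (max d 1) with d by lia.
  apply Rmult_le_compat_r; [apply Rlt_le, Rinv_0_lt_compat, lt_0_INR; lia |].
  apply Rpower_neg_le; [| lra].
  split; [apply lt_0_INR; lia | apply le_INR; lia].
Qed.

(** Up to distance [S y] the power is constant and a harmonic sum remains; beyond it the series
    converges. The bound is independent of [D], which makes the error uniform in the twist. *)
Lemma Rsum_gap_weight y sg D :
  0 < sg ->
  Rsum (gap_weight y sg) D
  <= Rpower (INR (S y)) (- sg) * (2 + ln (INR (S y)) + / sg).
Proof.
  intros Hs.
  eapply Rle_trans.
  { apply (Rsum_mono_n _ D (1 + (S y + D))); [intros; apply Rlt_le, gap_weight_pos | lia]. }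
  rewrite (Rsum_add _ 1), (Rsum_add _ (S y)).
  assert (H0 : gap_weight y sg 0 = Rpower (INR (S y)) (- sg)).
  { unfold gap_weight; replace (max (S y) 0) with (S y) by lia; simpl (INR (max 0 1)); field. }
  assert (H1 : Rsum (fun i => gap_weight y sg (1 + i)) (S y)
               <= Rpower (INR (S y)) (- sg) * (1 + ln (INR (S y)))).
  { apply Rle_trans with (Rsum (fun i => Rpower (INR (S y)) (- sg) * / INR (S i)) (S y)).
    - apply Rsum_le; intros i Hi; unfold gap_weight.
      replace (max (S y) (1 + i)) with (S y) by lia.
      replace (max (1 + i) 1) with (S i) by lia; apply Rle_refl.
    - rewrite Rsum_scal; apply Rmult_le_compat_l; [apply Rlt_le, Rpower_pos |].
      apply Rsum_harmonic. }
  assert (H2 : Rsum (fun i => gap_weight y sg (1 + (S y + i))) D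
               <= / sg * Rpower (INR (S y)) (- sg)).
  { eapply Rle_trans; [| apply (Rsum_Rpower_tail sg y D Hs)].
    apply Rsum_le; intros i Hi; unfold gap_weight.
    replace (max (S y) (1 + (S y + i))) with (S (S (y + i))) by lia.
    replace (max (1 + (S y + i)) 1) with (S (S (y + i))) by lia.
    right; unfold Rdiv; rewrite <- (Rpower_1 (INR (S (S (y + i))))) at 2 by apply INR_S_pos.
    rewrite <- Rpower_Ropp, <- Rpower_plus; f_equal; ring. }
  replace (Rsum (gap_weight y sg) 1) with (gap_weight y sg 0) by (unfold Rsum; ring).
  rewrite H0; lra.
Qed.

Lemma Rpower_div_self x y : 0 < x -> Rpower x (- y) / x = Rpower x (- 1 - y).
Proof.
  intros Hx; unfold Rdiv; rewrite <- (Rpower_1 x) at 2 by exact Hx.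
  rewrite <- Rpower_Ropp, <- Rpower_plus; f_equal; ring.
Qed.

(** If [k] is [S n] or [S (S n)], then [u] may meet [k]: the trivial bound applies, and one factor
    [T] of [T^2] is paid by [T <= INR (S n)]. Otherwise the kernel decays, with distance [S n - k]
    on the left and [k - 1 - S n] on the right, because [u] reaches [S n + 1]. *)
Lemma twisted_derivative_sum_bound (T sg : R) (y n k : nat) (u : R) :
  1 <= T -> 0 < sg < 1 -> T <= INR (S y) -> (y <= n)%nat -> (1 <= k)%nat ->
  INR (S n) <= u <= INR (S n) + 1 ->
  Cmod (twisted_derivative T sg (ln (INR k)) u)
  <= 6 * T * (3 * Rpower (INR (S n)) (- 1 - sg)
      + 2 * ((if (k <=? S n)%nat then gap_weight y sg (S n - k) else 0)
             + (if (S n <? k)%nat then gap_weight y sg (k - 1 - S n) else 0))).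
Proof.
  intros HT Hs HTy Hyn Hk Hu.
  assert (Hn := INR_S_ge1 n).
  assert (HYn : INR (S y) <= INR (S n)) by (apply le_INR; lia).
  assert (Hk0 : 1 <= INR k) by (apply (le_INR 1), Hk).
  set (N := INR (S n)) in *.
  assert (Hpw : Rpower u (- sg) / u <= Rpower N (- 1 - sg)).
  { rewrite <- Rpower_div_self by lra.
    apply Rmult_le_compat; [apply Rlt_le, Rpower_pos | apply Rlt_le, Rinv_0_lt_compat; lra | |].
    - apply Rpower_neg_le; lra.
    - apply Rinv_le_contravar; lra. }
  assert (Hpw0 : 0 < Rpower u (- sg) / u).
  { apply Rdiv_lt_0_compat; [apply Rpower_pos | lra]. }
  set (P := Rpower N (- 1 - sg)) in *.
  assert (HP : 0 < P) by apply Rpower_pos.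
  assert (EP : P = Rpower N (- sg) / N) by (symmetry; apply Rpower_div_self; lra).
  set (Q := Rpower N (- sg)) in *.
  assert (HQ : 0 < Q) by apply Rpower_pos.
  assert (H0 : Q <= gap_weight y sg 0).
  { unfold gap_weight; replace (max (S y) 0) with (S y) by lia; simpl (INR (max 0 1)).
    unfold Rdiv; rewrite Rinv_1, Rmult_1_r; apply Rpower_neg_le; [| lra].
    split; [apply INR_S_pos | exact HYn]. }
  assert (Hnear : Cmod (twisted_derivative T sg (ln (INR k)) u) <= 4 * T * gap_weight y sg 0).
  { eapply Rle_trans; [apply twisted_derivative_le; lra |].
    apply Rle_trans with (P * (4 * (T * T))); [apply Rmult_le_compat_r; nra |].
    rewrite EP; apply Rle_trans with (Q * (4 * T)).
    - replace (Q / N * (4 * (T * T))) with (Q * (4 * T) * (T / N)) by (field; lra).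
      assert (T / N <= 1).
      { apply (Rmult_le_reg_r N); [lra |]; unfold Rdiv; rewrite Rmult_assoc, Rinv_l; lra. }
      assert (0 < Q * (4 * T)) by (apply Rmult_lt_0_compat; lra); nra.
    - nra. }
  assert (Hfar : ln (INR k) - ln u <> 0 -> forall W, / Rabs (ln (INR k) - ln u) <= W ->
            Cmod (twisted_derivative T sg (ln (INR k)) u) <= 6 * T * (P * W)).
  { intros Hv W HW.
    eapply Rle_trans; [apply twisted_derivative_decay; lra |].
    assert (0 < / Rabs (ln (INR k) - ln u)) by (apply Rinv_0_lt_compat, Rabs_pos_lt, Hv).
    replace (6 * T * (P * W)) with (P * (6 * T * W)) by ring.
    apply Rmult_le_compat; [lra | | exact Hpw |].
    - unfold Rdiv; repeat apply Rmult_le_pos; lra.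
    - unfold Rdiv; apply Rmult_le_compat_l; lra. }
  assert (G0 := gap_weight_pos y sg 0).
  destruct (Nat.leb_spec k (S n)) as [h | h]; destruct (Nat.ltb_spec (S n) k) as [h' | h']; try lia.
  - destruct (Nat.eq_dec k (S n)) as [e | e].
    + replace (S n - k)%nat with O by lia; nra.
    + assert (Hd : INR (S n - k) = N - INR k) by (rewrite minus_INR by lia; reflexivity).
      assert (Hd0 : 1 <= INR (S n - k)) by (apply (le_INR 1); lia).
      assert (G := gap_weight_ge y sg (S n - k) (S n) ltac:(lra) ltac:(lia) ltac:(lia) ltac:(lia)).
      fold N Q in G; rewrite Hd in *.
      assert (V : ln (INR k) - ln u <> 0) by (apply ln_neq; lra).
      assert (W : / Rabs (ln (INR k) - ln u) <= 1 + N / (N - INR k)).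
      { eapply Rle_trans; [apply inv_log_diff; lra |].
        replace (u / (u - INR k)) with (1 + INR k * / (u - INR k)) by (field; lra).
        apply Rplus_le_compat_l, Rmult_le_compat; [lra | | lra |].
        - apply Rlt_le, Rinv_0_lt_compat; lra.
        - apply Rinv_le_contravar; lra. }
      eapply Rle_trans; [apply (Hfar V _ W) |].
      replace (P * (1 + N / (N - INR k))) with (P + Q / (N - INR k)) by (rewrite EP; field; lra).
      apply Rmult_le_compat_l; [lra |].
      generalize (gap_weight_pos y sg (S n - k)); lra.
  - destruct (Nat.eq_dec k (S (S n))) as [e | e].
    + replace (k - 1 - S n)%nat with O by lia; nra.
    + assert (Hd : INR (k - 1 - S n) = INR k - 1 - N).
      { rewrite !minus_INR by lia; reflexivity. }
      assert (Hd0 : 1 <= INR (k - 1 - S n)) by (apply (le_INR 1); lia).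
      set (d := (k - 1 - S n)%nat) in *.
      assert (V : ln (INR k) - ln u <> 0).
      { assert (ln u - ln (INR k) <> 0) by (apply ln_neq; lra); lra. }
      assert (W : / Rabs (ln (INR k) - ln u) <= 1 + 2 * N / INR d).
      { rewrite Rabs_minus_sym; eapply Rle_trans; [apply inv_log_diff; lra |].
        replace (INR k / (INR k - u)) with (1 + u * / (INR k - u)) by (field; lra).
        apply Rplus_le_compat_l, Rmult_le_compat; [lra | | lra |].
        - apply Rlt_le, Rinv_0_lt_compat; lra.
        - apply Rinv_le_contravar; lra. }
      eapply Rle_trans; [apply (Hfar V _ W) |].
      replace (P * (1 + 2 * N / INR d)) with (P + 2 * (Q / INR d)) by (rewrite EP; field; lra).
      apply Rmult_le_compat_l; [lra |].
      destruct (Nat.le_gt_cases d (S n)) as [g | g].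
      * assert (G := gap_weight_ge y sg d (S n) ltac:(lra) ltac:(lia) g ltac:(unfold d; lia)).
        fold N Q in G; lra.
      (* At distances beyond [S n] the term is absorbed by the first summand; this is why that
         summand carries a 3. *)
      * assert (Q / INR d <= P).
        { rewrite EP; apply Rmult_le_compat_l; [lra |].
          apply Rinv_le_contravar; [lra |]; apply le_INR; lia. }
        generalize (gap_weight_pos y sg d); lra.
Qed.

(** Each side of [k] contributes at most [W * (7 + ln Y)], whatever [k] and [m] are. With
    [/ sg <= 5] this gives [3 * 6 + 2 * 2 * (7 + ln Y) = 46 + 4 ln Y], and the factor 24 is
    [4 * 6]. *)
Lemma twisted_tail_sum (T sg : R) (y k m : nat) :
  1 <= T -> 1 / 5 <= sg <= 1 / 2 -> T <= INR (S y) -> (1 <= k)%nat ->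
  Rsum (fun i => Cmod (CI (fun t => osc (ln (INR k)) t * zeta_term (sg, t) (y + i))%C 1 T)) m
  <= Rpower (INR (S y)) (1 - sg) * (1104 + 96 * ln (INR (S y))).
Proof.
  intros HT Hs HTy Hk.
  set (a := fun i => if (k <=? S y + i)%nat then gap_weight y sg (S y + i - k) else 0).
  set (b := fun i => if (S y + i <? k)%nat then gap_weight y sg (k - 1 - (S y + i)) else 0).
  set (Y := INR (S y)) in *.
  assert (HY : 1 <= Y) by apply INR_S_ge1.
  assert (HL : 0 <= ln Y) by (rewrite <- ln_1; apply ln_le; lra).
  set (W := Rpower Y (- sg)).
  assert (HW : 0 < W) by apply Rpower_pos.
  assert (Hi : 0 < / sg <= 5).
  { split; [apply Rinv_0_lt_compat; lra |].
    replace 5 with (/ (1 / 5)) by field; apply Rinv_le_contravar; lra. }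
  apply Rle_trans with (Rsum (fun i => 24 * T *
    (3 * Rpower (INR (S (y + i))) (- 1 - sg) + 2 * (a i + b i))) m).
  { apply Rsum_le; intros i _.
    replace (24 * T * _) with (4 * (6 * T * (3 * Rpower (INR (S (y + i))) (- 1 - sg)
      + 2 * (a i + b i)))) by ring.
    apply twisted_zeta_term_le; [exact HT | lra |].
    intros u Hu; apply (twisted_derivative_sum_bound T sg y (y + i) k u); lra || lia || assumption. }
  rewrite Rsum_scal, Rsum_plus, !Rsum_scal, Rsum_plus.
  assert (HA : forall D, Rsum (gap_weight y sg) D <= W * (7 + ln Y)).
  { intros D; eapply Rle_trans; [apply Rsum_gap_weight; lra |]; fold Y W.
    apply Rmult_le_compat_l; lra. }
  assert (H0 : forall D, 0 <= Rsum (gap_weight y sg) D).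
  { intros D; apply Rsum_nonneg; intros; apply Rlt_le, gap_weight_pos. }
  assert (Ha : Rsum a m <= W * (7 + ln Y)).
  { unfold a; rewrite Rsum_above.
    generalize (HA (S y + m - k)%nat) (H0 (S y - k)%nat); lra. }
  assert (Hb : Rsum b m <= W * (7 + ln Y)).
  { unfold b; rewrite Rsum_below.
    generalize (HA (k - S y)%nat) (H0 (k - S y - m)%nat); lra. }
  assert (Hp := Rsum_Rpower_le sg y m ltac:(lra)); fold Y W in Hp.
  assert (Hp' : (1 + / sg) * W <= 6 * W) by (apply Rmult_le_compat_r; lra).
  assert (EW : Rpower Y (1 - sg) = Y * W).
  { unfold W, Rminus; rewrite Rpower_plus, Rpower_1 by lra; reflexivity. }
  rewrite EW.
  apply Rle_trans with (24 * T * (W * (46 + 4 * ln Y))).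
  - apply Rmult_le_compat_l; lra.
  - replace (Y * W * (1104 + 96 * ln Y)) with (24 * Y * (W * (46 + 4 * ln Y))) by ring.
    apply Rmult_le_compat_r; [apply Rmult_le_pos; lra | lra].
Qed.

Lemma Csum_single (z : C) k n :
  Csum (fun i => if (S i =? k)%nat then z else 0) n
  = if ((1 <=? k) && (k <=? n))%nat%bool then z else 0%C.
Proof.
  induction n as [|n IH]; cbn [Csum].
  - destruct k; reflexivity.
  - rewrite IH; destruct (Nat.eqb_spec (S n) k), (Nat.leb_spec 1 k), (Nat.leb_spec k n),
      (Nat.leb_spec k (S n)); simpl; try lia; ring.
Qed.

(** Only [n = k] does not oscillate; it gives the main term, with [T - 1] in place of [T]. For the
    others the decay of the kernel yields [2 n^(-sg)] plus [2 n^(1-sg)] over a distance to [k], and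
    [n^(1-sg) <= V] leaves harmonic sums. *)
Lemma twisted_head_sum (T sg : R) (y k : nat) :
  1 <= T -> 1 / 5 <= sg <= 1 / 2 -> T <= INR (S y) -> (1 <= k)%nat ->
  Cmod (CI (fun t => osc (ln (INR k)) t * Csum (fun n => Rcpow (INR (S n)) (- (sg, t))) (S y))%C 1 T
        - RtoC (T * Rpower (INR k) (- sg)))
  <= Rpower (INR (S y)) (1 - sg) * (9 + 4 * ln (INR (S y))).
Proof.
  intros HT Hs HTy Hk.
  set (w := ln (INR k)); set (Y := INR (S y)) in *.
  assert (HY : 1 <= Y) by apply INR_S_ge1.
  assert (Hk0 : 1 <= INR k) by (apply (le_INR 1), Hk).
  assert (HL : 0 <= ln Y) by (rewrite <- ln_1; apply ln_le; lra).
  set (V := Rpower Y (1 - sg)).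
  assert (HV : 1 <= V).
  { unfold V; apply Rle_trans with (Rpower Y 0); [rewrite Rpower_O; lra | apply Rpower_mono_exp; lra]. }
  assert (E : CI (fun t => osc w t * Csum (fun n => Rcpow (INR (S n)) (- (sg, t))) (S y))%C 1 T
    = Csum (fun n => (RtoC (Rpower (INR (S n)) (- sg)) * kern T (w - ln (INR (S n))))%C) (S y)).
  { rewrite (CI_ext 1 T HT _ (fun t => Csum (fun n => osc w t * Rcpow (INR (S n)) (- (sg, t)))%C (S y))).
    - rewrite CI_Csum.
      + apply Csum_ext; intros n _; apply twisted_power, HT.
      + exact HT.
      + intros; apply ccont_mult; [apply ccont_osc | apply ccont_Rcpow_line].
    - intros t _; now rewrite Csum_scal. }
  rewrite E.
  set (z := RtoC (Rpower (INR k) (- sg) * (T - 1))).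
  set (c := fun n => (RtoC (Rpower (INR (S n)) (- sg)) * kern T (w - ln (INR (S n))))%C).
  set (dl := fun n => if (S n =? k)%nat then z else RtoC 0).
  (* Capping [k] just beyond the last [n] only shortens distances, and keeps the harmonic sum of
     length at most [S y], so that no [ln k] appears. *)
  set (k' := min k (S (S y))).
  set (f := fun d => / INR (S d)).
  assert (Hf : forall d, 0 <= f d) by (intros; apply Rlt_le, Rinv_0_lt_compat, INR_S_pos).
  set (a := fun n => if (1 + n <? k')%nat then f (k' - 1 - (1 + n))%nat else 0).
  set (b := fun n => if (S k <=? 1 + n)%nat then f (1 + n - S k)%nat else 0).
  assert (Hab : forall n, 0 <= a n /\ 0 <= b n).
  { intros n; unfold a, b; destruct (_ <? _)%nat, (_ <=? _)%nat; split; auto; lra. }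
  assert (Hc : forall n, (n < S y)%nat -> Cmod (c n - dl n)
            <= 2 * Rpower (INR (S n)) (- sg) + 2 * V * (a n + b n)).
  { intros n Hn; unfold c, dl; destruct (Nat.eqb_spec (S n) k) as [e | e].
    - rewrite e; unfold w, z; rewrite Rminus_diag, kern_0, RtoC_mult by exact HT.
      replace (_ - _)%C with (RtoC 0) by ring; rewrite Cmod_0.
      generalize (Hab n) (Rpower_pos (INR k) (- sg)); nra.
    - replace (RtoC (Rpower (INR (S n)) (- sg)) * kern T (w - ln (INR (S n))) - 0)%C
        with (RtoC (Rpower (INR (S n)) (- sg)) * kern T (w - ln (INR (S n))))%C by ring.
      assert (Hn1 := INR_S_ge1 n).
      assert (HnY : INR (S n) <= Y) by (apply le_INR; lia).
      set (N := INR (S n)) in *; set (Q := Rpower N (- sg)).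
      assert (HQ : 0 < Q) by apply Rpower_pos.
      assert (HQV : Q * N <= V).
      { replace (Q * N) with (Rpower N (1 - sg)).
        - apply Rpower_mono_base; lra.
        - unfold Rminus; rewrite Rpower_plus, Rpower_1 by lra; unfold Q; ring. }
      rewrite Cmod_mult, Cmod_R, Rabs_right by lra.
      assert (Hfar : w - ln N <> 0 -> forall d, / Rabs (w - ln N) <= 1 + N * d -> 0 <= d ->
                Q * Cmod (kern T (w - ln N)) <= 2 * Q + 2 * V * d).
      { intros Hv d Hd Hd0.
        assert (K := kern_decay T (w - ln N) HT Hv); unfold Rdiv in K.
        apply Rle_trans with (Q * (2 * (1 + N * d))).
        - apply Rmult_le_compat_l; lra.
        - nra. }
      destruct (Nat.lt_total (S n) k) as [h | [h | h]]; [| lia |].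
      + apply Rle_trans with (2 * Q + 2 * V * a n); [| generalize (Hab n); nra].
        assert (hN : N + 1 <= INR k) by (unfold N; rewrite <- S_INR; apply le_INR; lia).
        apply Hfar; [| | apply Hab].
        * unfold w; assert (ln N - ln (INR k) <> 0) by (apply ln_neq; lra); lra.
        * unfold w; rewrite Rabs_minus_sym; eapply Rle_trans; [apply inv_log_diff; lra |].
          replace (INR k / (INR k - N)) with (1 + N * / (INR k - N)) by (field; lra).
          apply Rplus_le_compat_l, Rmult_le_compat_l; [lra |].
          unfold a; destruct (Nat.ltb_spec (1 + n) k') as [g | g]; [| unfold k' in g; lia].
          unfold f; apply Rinv_le_contravar; [apply INR_S_pos |].
          replace (S (k' - 1 - (1 + n))) with (k' - S n)%nat by lia.
          unfold N; rewrite minus_INR by lia.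
          assert (INR k' <= INR k) by (apply le_INR; unfold k'; lia); lra.
      + apply Rle_trans with (2 * Q + 2 * V * b n); [| generalize (Hab n); nra].
        assert (hN : INR k + 1 <= N) by (unfold N; rewrite <- S_INR; apply le_INR; lia).
        apply Hfar; [| | apply Hab].
        * unfold w; apply ln_neq; lra.
        * unfold w; eapply Rle_trans; [apply inv_log_diff; lra |].
          replace (N / (N - INR k)) with (1 + INR k * / (N - INR k)) by (field; lra).
          assert (HI : 0 < / (N - INR k)) by (apply Rinv_0_lt_compat; lra).
          apply Rplus_le_compat_l, Rmult_le_compat; [lra | lra | lra |].
          unfold b; destruct (Nat.leb_spec (S k) (1 + n)) as [g | g]; [| lia].
          unfold f; replace (S (1 + n - S k)) with (S n - k)%nat by lia.
          rewrite minus_INR by lia; apply Rle_refl. }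
  assert (Hsum : Cmod (Csum c (S y) - Csum dl (S y)) <= V * (8 + 4 * ln Y)).
  { replace (Csum c (S y) - Csum dl (S y))%C with (Csum (fun n => c n - dl n)%C (S y)).
    2: { unfold Cminus; rewrite Csum_plus; f_equal.
         rewrite (Csum_ext _ (fun i => - (1) * dl i)%C) by (intros; ring).
         rewrite Csum_scal; ring. }
    eapply Rle_trans; [apply Cmod_Csum_le, Hc |].
    rewrite Rsum_plus, !Rsum_scal, Rsum_plus.
    assert (A1 := Rsum_Rpower_head sg y ltac:(lra)); fold Y V in A1.
    assert (A2 : / (1 - sg) * V <= 2 * V).
    { apply Rmult_le_compat_r; [lra |].
      replace 2 with (/ (1 / 2)) by field; apply Rinv_le_contravar; lra. }
    assert (A3 := Rsum_harmonic y); fold Y in A3.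
    assert (F0 : forall D, 0 <= Rsum f D) by (intros; apply Rsum_nonneg; auto).
    assert (Ha : Rsum a (S y) <= 1 + ln Y).
    { unfold a; rewrite Rsum_below.
      generalize (Rsum_mono_n f (k' - 1) (S y) Hf ltac:(unfold k'; lia)) (F0 (k' - 1 - S y)%nat).
      unfold f in *; lra. }
    assert (Hb : Rsum b (S y) <= 1 + ln Y).
    { unfold b; rewrite Rsum_above.
      generalize (Rsum_mono_n f (1 + S y - S k) (S y) Hf ltac:(lia)) (F0 (1 - S k)%nat).
      unfold f in *; lra. }
    nra. }
  assert (Hmain : Cmod (Csum dl (S y) - RtoC (T * Rpower (INR k) (- sg))) <= V).
  { unfold dl; rewrite Csum_single.
    replace (1 <=? k)%nat with true by (symmetry; now apply Nat.leb_le); simpl andb.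
    assert (PQ := Rpower_pos (INR k) (- sg)).
    destruct (Nat.leb_spec k (S y)) as [h | h].
    - unfold z; rewrite <- RtoC_minus.
      rewrite Cmod_R.
      replace (Rpower (INR k) (- sg) * (T - 1) - T * Rpower (INR k) (- sg))
        with (- Rpower (INR k) (- sg)) by ring.
      rewrite Rabs_Ropp, Rabs_right by lra.
      apply Rle_trans with 1; [| exact HV].
      apply Rle_trans with (Rpower (INR k) 0); [apply Rpower_mono_exp; lra | rewrite Rpower_O; lra].
    (* Here [k] lies beyond the head and no term produces the main term, but then [T k^(-sg)] is
       itself at most [Y^(1-sg)]. *)
    - replace (0 - RtoC (T * Rpower (INR k) (- sg)))%C with (RtoC (- (T * Rpower (INR k) (- sg))))
        by (rewrite RtoC_opp; ring).
      rewrite Cmod_R, Rabs_Ropp, Rabs_right by nra.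
      replace V with (Y * Rpower Y (- sg)).
      2: { unfold V, Rminus; rewrite Rpower_plus, Rpower_1 by lra; reflexivity. }
      apply Rmult_le_compat; [lra | lra | exact HTy |].
      apply Rpower_neg_le; [| lra]; split; [lra | apply le_INR; lia]. }
  replace (Csum c (S y) - RtoC (T * Rpower (INR k) (- sg)))%C with
    ((Csum c (S y) - Csum dl (S y)) + (Csum dl (S y) - RtoC (T * Rpower (INR k) (- sg))))%C by ring.
  eapply Rle_trans; [apply Cmod_triangle | lra].
Qed.

(** Since [|1 - s| >= t], integrating [/ t] gives the logarithm; no oscillation is used. *)
Lemma twisted_pole_le (T sg Y w : R) :
  1 <= T -> 0 < sg < 1 -> 0 < Y ->
  Cmod (CI (fun t => osc w t * (Rcpow Y (1 - (sg, t)) / (1 - (sg, t))))%C 1 T)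
  <= 2 * (Rpower Y (1 - sg) * ln T).
Proof.
  intros HT Hs HY.
  replace (2 * (Rpower Y (1 - sg) * ln T))
    with (2 * (Rpower Y (1 - sg) * ln T - Rpower Y (1 - sg) * ln 1)) by (rewrite ln_1; ring).
  assert (HV := Rpower_pos Y (1 - sg)).
  apply (CI_bound_primitive 1 T HT _ (fun t => Rpower Y (1 - sg) * ln t)
           (fun t => Rpower Y (1 - sg) * / t)).
  - intros t _; apply ccont_mult; [apply ccont_osc |].
    apply ccont_mult; [apply ccont_Rcpow_one_minus_line | apply ccont_inv_line; lra].
  - intros t Ht; auto_derive; [lra | ring].
  - intros t Ht; apply (@ex_derive_continuous R_AbsRing R_NormedModule); auto_derive; lra.
  - intros t Ht; unfold Cdiv.
    rewrite !Cmod_mult, Cmod_osc, Rmult_1_l, Cmod_Rcpow, Cmod_inv by (apply one_minus_line_neq; lra).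
    replace (Re (1 - (sg, t))) with (1 - sg) by (unfold Re; simpl; ring).
    apply Rmult_le_compat_l; [lra |]; apply Rinv_le_contravar; [lra |].
    eapply Rle_trans; [| apply im_le_Cmod].
    replace (Im (1 - (sg, t))) with (- t) by (unfold Im; simpl; ring).
    rewrite Rabs_Ropp, Rabs_right; lra.
Qed.

Lemma ln_ge_1 T : 3 <= T -> 1 <= ln T.
Proof.
  intros HT; rewrite <- (ln_exp 1); apply ln_le; [apply exp_pos |].
  generalize exp_le_3; lra.
Qed.

Lemma twisted_zeta (T sg : R) (k : nat) :
  3 <= T -> 1 / 5 <= sg <= 1 / 2 -> (1 <= k)%nat ->
  Cmod (CI (fun t => osc (ln (INR k)) t * zeta (sg, t))%C 1 T
        - RtoC (T * Rpower (INR k) (- sg)))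
  <= 3000 * (Rpower T (1 - sg) * ln T).
Proof.
  intros HT Hs Hk; assert (HT1 : 1 <= T) by lra.
  destruct (nfloor_ex T) as [y [y1 y2]]; [lra |].
  set (Y := INR (S y)).
  assert (HY : T <= Y <= 2 * T) by (unfold Y; rewrite S_INR; lra).
  set (w := ln (INR k)).
  assert (Hz : forall t, 1 <= t <= T -> (sg, t) <> RtoC 1).
  { intros t _ E; apply (f_equal Re) in E; unfold Re in E; simpl in E; lra. }
  assert (Hi : 0 < / sg <= 5).
  { split; [apply Rinv_0_lt_compat; lra |].
    replace 5 with (/ (1 / 5)) by field; apply Rinv_le_contravar; lra. }
  (* [m] may depend on [T] because the tail estimate is uniform in [m]. The 48 is [4 * (1 + 5)] from
     [zeta_tail] times 2 from [CI_bound]. *)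
  assert (Hm : exists m, 48 * (T * (1 + T)) * Rpower (INR (S (y + m))) (- sg) <= 1).
  { assert (L := lim_Rpower_neg sg ltac:(lra)).
    assert (P : 0 < / (48 * (T * (1 + T)))) by (apply Rinv_0_lt_compat; nra).
    apply is_lim_seq_spec in L; destruct (L (mkposreal _ P)) as [m Hm].
    exists m; specialize (Hm (y + m)%nat ltac:(lia)); simpl pos in Hm.
    rewrite Rminus_0_r, Rabs_right in Hm by (apply Rle_ge, Rlt_le, Rpower_pos).
    apply Rlt_le, (Rmult_le_compat_l (48 * (T * (1 + T)))) in Hm; [| nra].
    rewrite Rinv_r in Hm by nra; exact Hm. }
  destruct Hm as [m Hm].
  set (pole := fun t => (Rcpow Y (1 - (sg, t)) / (1 - (sg, t)))%C).
  set (head := fun t => Csum (fun n => Rcpow (INR (S n)) (- (sg, t))) (S y)).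
  set (tail := fun t => Csum (fun i => zeta_term (sg, t) (y + i)) m).
  set (rest := fun t => (zeta (sg, t) - zeta_approx (sg, t) (y + m))%C).
  assert (E : forall t, zeta (sg, t) = (head t - pole t + tail t + rest t)%C).
  { intros t; unfold rest; rewrite zeta_approx_add; unfold zeta_approx.
    rewrite Csum_sum_n; fold Y (pole t) (head t) (tail t); ring. }
  assert (Cpole : forall t, ccont pole t).
  { intros t; apply ccont_mult; [apply ccont_Rcpow_one_minus_line | apply ccont_inv_line; lra]. }
  assert (Chead : forall t, ccont head t).
  { intros t; apply ccont_Csum; intros; apply ccont_Rcpow_line. }
  assert (Cterm : forall i t, ccont (fun t => zeta_term (sg, t) (y + i)) t).
  { intros; apply ccont_zeta_term; lra. }
  assert (Ctail : forall t, ccont tail t) by (intros t; apply ccont_Csum; intros; apply Cterm).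
  assert (Crest : forall t, 1 <= t <= T -> ccont rest t).
  { intros t Ht.
    assert (H : ccont (fun t => zeta (sg, t) - (head t - pole t + tail t))%C t).
    { apply ccont_minus; [apply ccont_zeta_line; [lra | apply Hz, Ht] |].
      apply ccont_plus; [apply ccont_minus |]; auto. }
    destruct H as [h1 h2]; split; [eapply continuous_ext; [| exact h1] | eapply continuous_ext; [| exact h2]];
      intros u; cbv beta; f_equal; rewrite (E u) at 1; ring. }
  assert (Hrest : Cmod (CI (fun t => osc w t * rest t)%C 1 T) <= 1).
  { eapply Rle_trans; [| exact Hm].
    eapply Rle_trans; [apply (CI_bound 1 T HT1 _ (24 * (1 + T) * Rpower (INR (S (y + m))) (- sg))) |].
    - intros; apply ccont_mult; [apply ccont_osc | auto].
    - intros t Ht; rewrite Cmod_mult, Cmod_osc, Rmult_1_l.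
      assert (R1 : Re (sg, t) = sg) by reflexivity.
      assert (H := zeta_tail (sg, t) (y + m) ltac:(rewrite R1; lra) (Hz t Ht)).
      rewrite R1 in H; eapply Rle_trans; [exact H |].
      apply Rmult_le_compat_r; [apply Rlt_le, Rpower_pos |].
      assert (Cmod (sg, t) <= 1 + T).
      { eapply Rle_trans; [apply Cmod_le_sum |]; unfold Re, Im; simpl; rewrite !Rabs_right; lra. }
      generalize (Cmod_ge_0 (sg, t)); nra.
    - generalize (Rpower_pos (INR (S (y + m))) (- sg)); set (q := Rpower _ _); intros.
      assert (0 < q * (1 + T)) by nra; nra. }
  assert (Htail : Cmod (CI (fun t => osc w t * tail t)%C 1 T)
                  <= Rpower Y (1 - sg) * (1104 + 96 * ln Y)).
  { rewrite (CI_ext 1 T HT1 _ (fun t => Csum (fun i => osc w t * zeta_term (sg, t) (y + i))%C m)).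
    - rewrite CI_Csum; [| exact HT1 | intros; apply ccont_mult; [apply ccont_osc | apply Cterm]].
      eapply Rle_trans; [apply Cmod_Csum_le; intros; apply Rle_refl |].
      apply twisted_tail_sum; try assumption; fold Y; lra.
    - intros t _; unfold tail; now rewrite Csum_scal. }
  assert (Hpole := twisted_pole_le T sg Y w HT1 ltac:(lra) ltac:(lra)).
  assert (Hhead := twisted_head_sum T sg y k HT1 Hs ltac:(fold Y; lra) Hk); fold w Y in Hhead.
  assert (D : CI (fun t => osc w t * zeta (sg, t))%C 1 T
    = (CI (fun t => osc w t * head t) 1 T - CI (fun t => osc w t * pole t) 1 T
       + CI (fun t => osc w t * tail t) 1 T + CI (fun t => osc w t * rest t) 1 T)%C).
  { assert (Co : forall f t, ccont f t -> ccont (fun t => osc w t * f t)%C t)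
      by (intros; apply ccont_mult; [apply ccont_osc | assumption]).
    rewrite <- CI_minus, <- !CI_plus; auto.
    - apply CI_ext; [exact HT1 |]; intros t _; rewrite E; ring.
    - intros; apply ccont_plus; [apply ccont_minus |]; auto.
    - intros; apply ccont_minus; auto. }
  rewrite D.
  set (A1 := CI (fun t => osc w t * head t)%C 1 T) in *.
  change (fun t => osc w t * Csum (fun n => Rcpow (INR (S n)) (- (sg, t))) (S y))%C
    with (fun t => osc w t * head t)%C in Hhead; fold A1 in Hhead.
  change (fun t => osc w t * (Rcpow Y (1 - (sg, t)) / (1 - (sg, t))))%C
    with (fun t => osc w t * pole t)%C in Hpole.
  set (A2 := CI (fun t => osc w t * pole t)%C 1 T) in *.
  set (A3 := CI (fun t => osc w t * tail t)%C 1 T) in *.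
  set (A4 := CI (fun t => osc w t * rest t)%C 1 T) in *.
  set (z := RtoC (T * Rpower (INR k) (- sg))) in *.
  replace (A1 - A2 + A3 + A4 - z)%C with ((A1 - z) + (A3 + A4 - A2))%C by ring.
  assert (W1 := Cmod_triangle (A1 - z) (A3 + A4 - A2)).
  assert (W2 := Cmod_triangle_sub (A3 + A4) A2).
  assert (W3 := Cmod_triangle A3 A4).
  assert (HL := ln_ge_1 T HT).
  assert (HLY : ln Y <= 2 * ln T).
  { apply Rle_trans with (ln (T * T)); [apply ln_le; nra |].
    rewrite ln_mult by lra; lra. }
  assert (HL0 : ln T <= ln Y) by (apply ln_le; lra).
  assert (HYp : Rpower Y (1 - sg) <= 2 * Rpower T (1 - sg)).
  { eapply Rle_trans; [apply (Rpower_mono_base Y (2 * T)); lra |].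
    rewrite <- Rpower_mult_distr by lra.
    apply Rmult_le_compat_r; [apply Rlt_le, Rpower_pos |].
    apply Rle_trans with (Rpower 2 1); [apply Rpower_mono_exp; lra | rewrite Rpower_1; lra]. }
  assert (HV1 : 1 <= Rpower Y (1 - sg)).
  { apply Rle_trans with (Rpower Y 0); [rewrite Rpower_O; lra | apply Rpower_mono_exp; lra]. }
  set (V := Rpower Y (1 - sg)) in *; set (U := Rpower T (1 - sg)) in *.
  (* Head, tail and rest give [9 + 1104 + 1] and [4 + 96], the pole term [2 ln T]. With
     [ln Y <= 2 ln T] and [1 <= ln T] the bracket is at most [1500 ln T], and [V <= 2 U]. *)
  apply Rle_trans with (V * (1114 + 100 * ln Y + 2 * ln T)); [lra |].
  apply Rle_trans with (2 * U * (1500 * ln T)); [| lra].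
  apply Rmult_le_compat; lra.
Qed.

(** * The shifted line *)

Lemma zeta_dirichlet_tail (s : C) M :
  1 < Re s ->
  Cmod (zeta s - Csum (fun n => Rcpow (INR (S n)) (- s)) M)
  <= (1 + / (Re s - 1)) * Rpower (INR (S M)) (- (Re s - 1)).
Proof.
  intros Hs.
  apply (Clim_le (sum_n (fun n => Rcpow (INR (S n)) (- s) : C_NormedModule)) _ _ _ M).
  - apply zeta_dirichlet, Hs.
  - intros n Hn.
    replace (sum_n _ n) with (Csum (fun n => Rcpow (INR (S n)) (- s)) (S n))
      by (symmetry; apply Csum_sum_n).
    replace (S n) with (M + (S n - M))%nat at 1 by lia.
    rewrite Csum_add.
    assert (E : forall u v : C, (u + v - u)%C = v) by (intros; ring); rewrite E.
    eapply Rle_trans; [| apply (Rsum_Rpower_le (Re s - 1) M (S n - M)); lra].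
    apply Cmod_Csum_le; intros i _; rewrite Cmod_Rcpow, re_opp.
    right; f_equal; ring.
Qed.

Lemma Dirichlet_partial_le (s : C) M :
  1 < Re s -> Cmod (Csum (fun n => Rcpow (INR (S n)) (- s)) M) <= 1 + / (Re s - 1).
Proof.
  intros Hs.
  eapply Rle_trans; [apply Cmod_Csum_le; intros; rewrite Cmod_Rcpow, re_opp; apply Rle_refl |].
  assert (H := Rsum_Rpower_le (Re s - 1) 0 M ltac:(lra)).
  rewrite Rpower_base1, Rmult_1_r in H.
  eapply Rle_trans; [right | exact H].
  apply Rsum_ext; intros i _; change (0 + i)%nat with i; f_equal; ring.
Qed.

Lemma zeta_le_right (s : C) : 1 < Re s -> Cmod (zeta s) <= 1 + / (Re s - 1).
Proof.
  intros Hs; assert (H := zeta_dirichlet_tail s 0 Hs).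
  rewrite Rpower_base1, Rmult_1_r in H; simpl Csum in H.
  replace (zeta s - 0)%C with (zeta s) in H by ring; exact H.
Qed.

(** In centred form [1/2 - b (s - 1/2)]: moving [s] to the left moves this argument [b] times as far
    to the right. *)
Definition dual_line (b : nat) (s : C) : C := (RtoC ((1 + INR b) / 2) - INR b * s)%C.

Lemma dual_line_pair n (x t : R) : dual_line n (x, t) = (1 / 2 + INR n * (1 / 2 - x), - INR n * t).
Proof. unfold dual_line, Cminus, Cplus, Copp, Cmult, RtoC; simpl; f_equal; field. Qed.

Lemma ccont_zeta_dual_line n (x t : R) :
  0 < 1 / 2 + INR n * (1 / 2 - x) -> dual_line n (x, t) <> RtoC 1 ->
  ccont (fun t => zeta (dual_line n (x, t))) t.
Proof.
  intros Hn H1.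
  rewrite dual_line_pair in H1.
  destruct (ccont_zeta_line _ _ Hn H1) as [h1 h2].
  assert (L : continuous (fun t => - INR n * t) t).
  { apply (@ex_derive_continuous R_AbsRing R_NormedModule); auto_derive; trivial. }
  split.
  - eapply continuous_ext; [intros u; rewrite dual_line_pair; reflexivity |].
    exact (continuous_comp (fun t => - INR n * t) _ t L h1).
  - eapply continuous_ext; [intros u; rewrite dual_line_pair; reflexivity |].
    exact (continuous_comp (fun t => - INR n * t) _ t L h2).
Qed.

Lemma Re_dual_line b x t : Re (dual_line b (x, t)) = 1 / 2 + INR b * (1 / 2 - x).
Proof. unfold dual_line, Re; simpl; field. Qed.

Lemma Rcpow_dual_line m b (x t : R) :
  0 < m ->
  Rcpow m (- dual_line b (x, t))
  = (RtoC (Rpower m (- ((1 + INR b) / 2 - INR b * x))) * osc (INR b * ln m) t)%C.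
Proof.
  intros Hm; unfold Rcpow, osc, Rpower, dual_line; rewrite <- Cexp_RtoC, <- Cexp_plus; f_equal.
  rewrite RtoC_mult, RtoC_opp, RtoC_minus, !RtoC_mult, pair_im; ring.
Qed.

Lemma product_gap (p q p' q' : C) (e e' m m' : R) :
  Cmod (p - p') <= e -> Cmod (q - q') <= e' -> Cmod q <= m' -> Cmod p' <= m ->
  Cmod (p * q - p' * q') <= e * m' + m * e'.
Proof.
  intros H1 H2 H3 H4.
  replace (p * q - p' * q')%C with ((p - p') * q + p' * (q - q'))%C by ring.
  eapply Rle_trans; [apply Cmod_triangle |]; rewrite !Cmod_mult.
  apply Rplus_le_compat; apply Rmult_le_compat; try assumption; apply Cmod_ge_0.
Qed.

Lemma le_lim_const (A : R) (u : nat -> R) (l : R) :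
  (forall n, A <= u n) -> is_lim_seq u l -> A <= l.
Proof.
  intros H Hu; exact (is_lim_seq_le _ _ A l H (is_lim_seq_const A) Hu).
Qed.

(* The two Dirichlet series expand the integral into twists by [k = m^b n^c]; the
   main terms [T k^(-x)] recombine because [k^(-x)] undoes the shift of the exponents. *)
Lemma shifted_line_integral (T x E : R) (b c : nat) :
  1 <= T -> 0 < x < 1 ->
  1 < 1 / 2 + INR b * (1 / 2 - x) -> 1 < 1 / 2 + INR c * (1 / 2 - x) ->
  1 < (1 + INR b) / 2 -> 1 < (1 + INR c) / 2 ->
  (forall k, (1 <= k)%nat ->
     Cmod (CI (fun t => osc (ln (INR k)) t * zeta (x, t))%C 1 T
           - RtoC (T * Rpower (INR k) (- x))) <= E) ->
  Cmod (CI (fun t => zeta (x, t) * zeta (dual_line b (x, t)) * zeta (dual_line c (x, t)))%C 1 T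
        - zeta ((1 + INR b) / 2)%R * zeta ((1 + INR c) / 2)%R * T)
  <= E * ((1 + / (1 / 2 + INR b * (1 / 2 - x) - 1)) * (1 + / (1 / 2 + INR c * (1 / 2 - x) - 1))).
Proof.
  intros HT Hx Hb Hc Hb' Hc' HE.
  set (be := 1 / 2 + INR b * (1 / 2 - x)) in *; set (ga := 1 / 2 + INR c * (1 / 2 - x)) in *.
  set (be' := (1 + INR b) / 2) in *; set (ga' := (1 + INR c) / 2) in *.
  set (D := fun s M => Csum (fun n => Rcpow (INR (S n)) (- s)) M).
  set (q := fun a M => (1 + / (a - 1)) * Rpower (INR (S M)) (- (a - 1))).
  assert (Hq : forall a, 1 < a -> is_lim_seq (q a) 0).
  { intros a Ha; unfold q.
    replace (Finite 0) with (Rbar_mult (1 + / (a - 1)) 0) by (simpl; f_equal; ring).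
    apply is_lim_seq_scal_l, lim_Rpower_neg; lra. }
  set (Z := 1 + / (1 - x) + 4 * (1 + T) * (1 + / x)).
  assert (Hnz : forall t, (x, t) <> RtoC 1).
  { intros t e; apply (f_equal Re) in e; unfold Re in e; simpl in e; lra. }
  assert (HZ : forall t, 1 <= t <= T -> Cmod (zeta (x, t)) <= Z).
  { intros t Ht; eapply Rle_trans; [apply zeta_crude; [unfold Re; simpl; lra | apply Hnz] |].
    change (Re (x, t)) with x; unfold Z.
    assert (Cmod (x, t) <= 1 + T).
    { eapply Rle_trans; [apply Cmod_le_sum |]; unfold Re, Im; simpl; rewrite !Rabs_right; lra. }
    assert (/ Cmod (1 - (x, t)) <= / (1 - x)).
    { apply Rinv_le_contravar; [lra |].
      eapply Rle_trans; [| apply Re_le_Cmod]; unfold Re; simpl; lra. }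
    assert (0 < / x) by (apply Rinv_0_lt_compat; lra).
    generalize (Cmod_ge_0 (x, t)); intros.
    assert (4 * Cmod (x, t) * (1 + / x) <= 4 * (1 + T) * (1 + / x)) by (apply Rmult_le_compat_r; lra).
    lra. }
  assert (HZ0 : 0 <= Z) by (eapply Rle_trans; [apply Cmod_ge_0 | apply (HZ 1); lra]).
  set (Sb := 1 + / (be - 1)); set (Sc := 1 + / (ga - 1)).
  set (Sb' := 1 + / (be' - 1)); set (Sc' := 1 + / (ga' - 1)).
  assert (Hinv : forall a, 1 < a -> 0 < 1 + / (a - 1)).
  { intros a Ha; generalize (Rinv_0_lt_compat (a - 1)); lra. }
  assert (Cz : forall t, ccont (fun t => zeta (x, t)) t).
  { intros t; apply ccont_zeta_line; [lra | apply Hnz]. }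
  assert (Cd : forall n M t, ccont (fun t => D (dual_line n (x, t)) M) t).
  { intros n M t; apply (ccont_Csum (fun i t => Rcpow (INR (S i)) (- dual_line n (x, t)))).
    intros i _; eapply cder_ccont, (cder_Rcpow_exponent _ (fun t => - dual_line n (x, t))%C), cder_opp,
      cder_minus; [apply cder_const | apply cder_scal, cder_vertical]. }
  assert (Czd : forall n t, 1 < 1 / 2 + INR n * (1 / 2 - x) -> ccont (fun t => zeta (dual_line n (x, t))) t).
  { intros n t Hn; apply ccont_zeta_dual_line; [lra |].
    intros e; apply (f_equal Re) in e; rewrite Re_dual_line in e; unfold Re in e; simpl in e; lra. }
  set (A := CI (fun t => zeta (x, t) * zeta (dual_line b (x, t)) * zeta (dual_line c (x, t)))%C 1 T).
  (* Sums and integral are exchanged only for a finite truncation [M]. The truncation errors vanish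
     as [M] grows with [T] fixed, so the crude bound [Z] may depend on [T]. *)
  set (AM := fun M => CI (fun t => zeta (x, t) * D (dual_line b (x, t)) M * D (dual_line c (x, t)) M)%C 1 T).
  assert (C3 : forall f g h : R -> C, (forall t, ccont f t) -> (forall t, ccont g t) ->
    (forall t, ccont h t) -> forall t, ccont (fun t => f t * g t * h t)%C t).
  { intros f g h Hf Hg Hh t; apply ccont_mult; [apply ccont_mult |]; auto. }
  assert (CA : forall t, ccont (fun t => zeta (x, t) * zeta (dual_line b (x, t)) * zeta (dual_line c (x, t)))%C t).
  { apply (C3 (fun t => zeta (x, t)) (fun t => zeta (dual_line b (x, t)))); auto. }
  assert (CB : forall M t, ccont (fun t => zeta (x, t) * D (dual_line b (x, t)) M * D (dual_line c (x, t)) M)%C t).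
  { intros M; apply (C3 (fun t => zeta (x, t)) (fun t => D (dual_line b (x, t)) M)); auto. }
  assert (H1 : forall M, Cmod (A - AM M) <= 2 * (Z * (q be M * Sc + Sb * q ga M)) * (T - 1)).
  { intros M; unfold A, AM; rewrite <- CI_minus; try assumption.
    - apply CI_bound; [exact HT | |].
      + intros; apply ccont_minus; auto.
      + intros t Ht.
        replace (_ - _)%C with (zeta (x, t) * (zeta (dual_line b (x, t)) * zeta (dual_line c (x, t))
          - D (dual_line b (x, t)) M * D (dual_line c (x, t)) M))%C by ring.
        rewrite Cmod_mult; apply Rmult_le_compat; try apply Cmod_ge_0; [apply HZ, Ht |].
        apply product_gap.
        * unfold D, q, be; rewrite <- (Re_dual_line b x t); apply zeta_dirichlet_tail;
            rewrite Re_dual_line; exact Hb.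
        * unfold D, q, ga; rewrite <- (Re_dual_line c x t); apply zeta_dirichlet_tail;
            rewrite Re_dual_line; exact Hc.
        * unfold Sc, ga; rewrite <- (Re_dual_line c x t); apply zeta_le_right;
            rewrite Re_dual_line; exact Hc.
        * unfold Sb, be; rewrite <- (Re_dual_line b x t); apply Dirichlet_partial_le;
            rewrite Re_dual_line; exact Hb.
    - intros; apply CA.
    - intros; apply CB. }
  set (zM := fun a M => D (RtoC a) M).
  assert (H2 : forall M, Cmod (zeta (RtoC be') * zeta (RtoC ga') - zM be' M * zM ga' M)
            <= q be' M * Sc' + Sb' * q ga' M).
  { intros M; apply product_gap.
    - exact (zeta_dirichlet_tail (RtoC be') M Hb').
    - exact (zeta_dirichlet_tail (RtoC ga') M Hc').
    - exact (zeta_le_right (RtoC ga') Hc').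
    - exact (Dirichlet_partial_le (RtoC be') M Hb'). }
  assert (H3 : forall M, Cmod (AM M - zM be' M * zM ga' M * T) <= E * (Sb * Sc)).
  { intros M.
    assert (EA : AM M = Csum (fun i => Csum (fun j =>
       RtoC (Rpower (INR (S i)) (- be) * Rpower (INR (S j)) (- ga))
       * CI (fun t => osc (ln (INR (S i ^ b * S j ^ c))) t * zeta (x, t)) 1 T)%C M) M).
    { unfold AM; rewrite (CI_ext 1 T HT _ (fun t => Csum (fun i => Csum (fun j =>
        RtoC (Rpower (INR (S i)) (- be) * Rpower (INR (S j)) (- ga))
         * (osc (ln (INR (S i ^ b * S j ^ c))) t * zeta (x, t)))%C M) M)).
      - assert (Ct : forall i j t, ccont (fun t => (osc (ln (INR (S i ^ b * S j ^ c))) t * zeta (x, t)))%C t).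
        { intros; apply ccont_mult; [apply ccont_osc | apply Cz]. }
        rewrite CI_Csum; [| exact HT |].
        + apply Csum_ext; intros i _; rewrite CI_Csum; [| exact HT |].
          * apply Csum_ext; intros j _; rewrite CI_scal; auto.
          * intros; apply ccont_mult; [apply ccont_const | apply Ct].
        + intros; apply (ccont_Csum (fun j t => RtoC (Rpower (INR (S i)) (- be) * Rpower (INR (S j)) (- ga))
            * (osc (ln (INR (S i ^ b * S j ^ c))) t * zeta (x, t)))%C).
          intros; apply ccont_mult; [apply ccont_const | apply Ct].
      - intros t _; unfold D.
        rewrite <- Cmult_assoc, Csum_mult, <- Csum_scal.
        apply Csum_ext; intros i _; rewrite <- Csum_scal; apply Csum_ext; intros j _.
        rewrite !Rcpow_dual_line by apply INR_S_pos.
        replace (ln (INR (S i ^ b * S j ^ c))) with (INR b * ln (INR (S i)) + INR c * ln (INR (S j))).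
        2: { rewrite mult_INR, !pow_INR, ln_mult, !ln_pow by (try apply pow_lt; apply INR_S_pos);
             reflexivity. }
        rewrite osc_plus, RtoC_mult.
        replace ((1 + INR b) / 2 - INR b * x) with be by (unfold be; field).
        replace ((1 + INR c) / 2 - INR c * x) with ga by (unfold ga; field).
        ring. }
    assert (Ez : (zM be' M * zM ga' M * T)%C = Csum (fun i => Csum (fun j =>
       RtoC (Rpower (INR (S i)) (- be) * Rpower (INR (S j)) (- ga))
       * RtoC (T * Rpower (INR (S i ^ b * S j ^ c)) (- x)))%C M) M).
    { unfold zM, D; rewrite Csum_mult, Cmult_comm, <- Csum_scal.
      apply Csum_ext; intros i _; rewrite <- Csum_scal; apply Csum_ext; intros j _.
      assert (R1 : forall m a, Rcpow m (- RtoC a) = RtoC (Rpower m (- a))).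
      { intros m a; unfold Rcpow, Rpower; rewrite <- Cexp_RtoC; f_equal.
        now rewrite RtoC_mult, RtoC_opp. }
      rewrite !R1, <- !RtoC_mult; f_equal.
      rewrite mult_INR, !pow_INR, <- Rpower_mult_distr by (apply pow_lt, INR_S_pos).
      rewrite <- !Rpower_pow, !Rpower_mult by apply INR_S_pos.
      replace (- be') with (- be + INR b * - x) by (unfold be, be'; field).
      replace (- ga') with (- ga + INR c * - x) by (unfold ga, ga'; field).
      rewrite !Rpower_plus; ring. }
    rewrite EA, Ez.
    replace (_ - _)%C with (Csum (fun i => Csum (fun j =>
       RtoC (Rpower (INR (S i)) (- be) * Rpower (INR (S j)) (- ga))
       * (CI (fun t => osc (ln (INR (S i ^ b * S j ^ c))) t * zeta (x, t)) 1 T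
          - RtoC (T * Rpower (INR (S i ^ b * S j ^ c)) (- x))))%C M) M).
    2: { symmetry.
         assert (Q : forall u v : C, (u - v)%C = (u + - (1) * v)%C) by (intros; ring).
         rewrite Q, <- Csum_scal, <- Csum_plus; apply Csum_ext; intros i _.
         rewrite <- Csum_scal, <- Csum_plus; apply Csum_ext; intros j _; ring. }
    apply Rle_trans with (Rsum (fun i => Rsum (fun j =>
      E * (Rpower (INR (S i)) (- be) * Rpower (INR (S j)) (- ga))) M) M).
    - apply Cmod_Csum_le; intros i _; apply Cmod_Csum_le; intros j _.
      assert (P : 0 < Rpower (INR (S i)) (- be) * Rpower (INR (S j)) (- ga)).
      { apply Rmult_lt_0_compat; apply Rpower_pos. }
      rewrite Cmod_mult, Cmod_R, Rabs_right by lra; rewrite Rmult_comm.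
      apply Rmult_le_compat_r; [lra |]; apply HE.
      assert (forall i b, (1 <= S i ^ b)%nat) as P1 by (intros k e; induction e; simpl; lia).
      generalize (P1 i b) (P1 j c); nia.
    - assert (HE0 : 0 <= E) by (eapply Rle_trans; [apply Cmod_ge_0 | apply (HE 1%nat); lia]).
      rewrite (Rsum_ext _ (fun i => E * Rsum (fun j => Rpower (INR (S j)) (- ga)) M * Rpower (INR (S i)) (- be))).
      2: { intros i _; rewrite Rsum_scal, Rsum_scal; ring. }
      rewrite Rsum_scal.
      assert (S1 : forall a, 1 < a -> Rsum (fun i => Rpower (INR (S i)) (- a)) M <= 1 + / (a - 1)).
      { intros a Ha; assert (H := Rsum_Rpower_le (a - 1) 0 M ltac:(lra)).
        rewrite Rpower_base1, Rmult_1_r in H.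
        eapply Rle_trans; [right | exact H].
        apply Rsum_ext; intros i _; change (0 + i)%nat with i; f_equal; ring. }
      assert (S0 : forall a, 0 <= Rsum (fun i => Rpower (INR (S i)) (- a)) M).
      { intros; apply Rsum_nonneg; intros; apply Rlt_le, Rpower_pos. }
      rewrite Rmult_assoc; apply Rmult_le_compat_l; [exact HE0 |].
      rewrite Rmult_comm; apply Rmult_le_compat; auto; apply S1; assumption. }
  apply (le_lim_const _ (fun M => 2 * (Z * (q be M * Sc + Sb * q ga M)) * (T - 1)
     + E * (Sb * Sc) + T * (q be' M * Sc' + Sb' * q ga' M))).
  - intros M.
    replace (A - zeta (RtoC be') * zeta (RtoC ga') * T)%C with
      ((A - AM M) + (AM M - zM be' M * zM ga' M * T)
       - T * (zeta (RtoC be') * zeta (RtoC ga') - zM be' M * zM ga' M))%C by ring.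
    eapply Rle_trans; [apply Cmod_triangle_sub |].
    apply Rplus_le_compat.
    + eapply Rle_trans; [apply Cmod_triangle | apply Rplus_le_compat; auto].
    + rewrite Cmod_mult, Cmod_R, Rabs_right by lra.
      apply Rmult_le_compat_l; [lra | auto].
  - assert (L1 := Hq be Hb); assert (L2 := Hq ga Hc).
    assert (L3 := Hq be' Hb'); assert (L4 := Hq ga' Hc').
    assert (Q : 2 * (Z * (0 * Sc + Sb * 0)) * (T - 1) + E * (Sb * Sc) + T * (0 * Sc' + Sb' * 0)
                = E * (Sb * Sc)) by ring.
    refine (eq_rect _ (fun l : R => is_lim_seq _ (Finite l)) _ _ Q).
    apply is_lim_seq_plus'; [apply is_lim_seq_plus' |].
    + apply is_lim_seq_mult'; [| apply is_lim_seq_const].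
      apply is_lim_seq_mult'; [apply is_lim_seq_const |].
      apply is_lim_seq_mult'; [apply is_lim_seq_const |].
      apply is_lim_seq_plus'; apply is_lim_seq_mult'; (assumption || apply is_lim_seq_const).
    + apply is_lim_seq_const.
    + apply is_lim_seq_mult'; [apply is_lim_seq_const |].
      apply is_lim_seq_plus'; apply is_lim_seq_mult'; (assumption || apply is_lim_seq_const).
Qed.

(** * The theorem *)

Definition zeta_triple (b c : nat) (s : C) : C :=
  (zeta s * zeta (dual_line b s) * zeta (dual_line c s))%C.

(** * The integrand on the sides of the rectangle *)

Lemma zeta_crude_bounded (s : C) (B : R) :
  1 / 5 <= Re s -> 1 <= Rabs (Im s) -> Cmod s <= B -> Cmod (zeta s) <= 2 + 24 * B.
Proof.
  intros H1 H2 H3.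
  assert (Hi : 1 <= Cmod (1 - s)).
  { eapply Rle_trans; [exact H2 |]; eapply Rle_trans; [| apply im_le_Cmod].
    replace (Im (1 - s)) with (- Im s) by (unfold Im; simpl; ring); rewrite Rabs_Ropp; lra. }
  eapply Rle_trans; [apply zeta_crude; [lra |] |].
  - intros E; subst s; unfold Im in H2; simpl in H2; rewrite Rabs_R0 in H2; lra.
  - assert (/ Cmod (1 - s) <= 1)
      by (apply Rle_trans with (/ 1); [apply Rinv_le_contravar; lra | rewrite Rinv_1; lra]).
    assert (/ Re s <= 5) by (replace 5 with (/ (1 / 5)) by field; apply Rinv_le_contravar; lra).
    assert (0 < / Re s) by (apply Rinv_0_lt_compat; lra).
    generalize (Cmod_ge_0 s); nra.
Qed.

Lemma Cmod_pair_le (x t : R) : Cmod (x, t) <= Rabs x + Rabs t.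
Proof. apply Cmod_le_sum. Qed.

(** At height 1 the three arguments stay in a fixed bounded set away from the pole, so the crude
    bound is enough. *)
Lemma zeta_triple_bottom_bound (b c : nat) :
  (2 <= c)%nat -> (c <= b)%nat ->
  exists K, forall x, 1 / 5 <= x <= 1 / 2 -> Cmod (zeta_triple b c (x, 1)) <= K.
Proof.
  intros Hc Hb.
  set (B := 1 + 2 * INR b).
  assert (HB : forall n, (2 <= n)%nat -> (n <= b)%nat -> 2 <= INR n <= INR b).
  { intros n h1 h2; split; [apply (le_INR 2), h1 | apply le_INR, h2]. }
  assert (HB0 := HB b ltac:(lia) ltac:(lia)).
  assert (Hn : forall n x, (2 <= n)%nat -> (n <= b)%nat -> 1 / 5 <= x <= 1 / 2 ->
            Cmod (zeta (dual_line n (x, 1))) <= 2 + 24 * B).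
  { intros n x h1 h2 Hx; assert (N := HB n h1 h2).
    rewrite dual_line_pair; apply zeta_crude_bounded; unfold Re, Im; simpl fst; simpl snd.
    - nra.
    - rewrite Rabs_left; lra.
    - eapply Rle_trans; [apply Cmod_pair_le |].
      rewrite Rabs_right, Rabs_left by nra; unfold B; nra. }
  exists ((2 + 24 * B) * (2 + 24 * B) * (2 + 24 * B)); intros x Hx.
  assert (H1 : Cmod (zeta (x, 1)) <= 2 + 24 * B).
  { apply zeta_crude_bounded; unfold Re, Im; simpl fst; simpl snd.
    - lra.
    - rewrite Rabs_R1; lra.
    - eapply Rle_trans; [apply Cmod_pair_le |]; rewrite !Rabs_right by lra; unfold B; lra. }
  unfold zeta_triple; rewrite !Cmod_mult.
  apply Rmult_le_compat; [apply Rmult_le_pos; apply Cmod_ge_0 | apply Cmod_ge_0 | |].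
  - apply Rmult_le_compat; [apply Cmod_ge_0 | apply Cmod_ge_0 | exact H1 | apply Hn; auto; lia].
  - apply Hn; auto.
Qed.

(** For [x <= 1/2] the larger exponent of [zeta (x, T)] is [1 - 3 x / 2]; for the other factors,
    with [tau >= 1/2], it is [(1 - tau) / 2]. The loss of the first factor to the left is offset by
    the gain of the other two. *)
Lemma zeta_triple_top_bound (b c : nat) :
  (2 <= c)%nat -> (c <= b)%nat ->
  exists K, forall x T, 2 <= T -> 24 / 100 <= x <= 1 / 2 ->
    Cmod (zeta_triple b c (x, T)) <= K * Rpower T (3 / 4).
Proof.
  intros Hc Hb.
  destruct (zeta_vertical_bound (1 + INR b)) as [K [HK Hz]].
  assert (HB : forall n, (2 <= n)%nat -> (n <= b)%nat -> 2 <= INR n <= INR b).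
  { intros n h1 h2; split; [apply (le_INR 2), h1 | apply le_INR, h2]. }
  assert (HB0 := HB b ltac:(lia) ltac:(lia)).
  exists (2 * K * (2 * K * INR b) * (2 * K * INR b)); intros x T HT Hx.
  (* The real part of [dual_line n] is smallest for [n = 2], so one [tau] serves both factors; the
     cap [9/10] is the limit of [zeta_vertical_bound]. *)
  set (tau := Rmin (1 / 2 + 2 * (1 / 2 - x)) (9 / 10)).
  assert (T1 := Rmin_l (1 / 2 + 2 * (1 / 2 - x)) (9 / 10)).
  assert (T2 := Rmin_r (1 / 2 + 2 * (1 / 2 - x)) (9 / 10)).
  assert (T3 : 1 / 2 <= tau) by (unfold tau; apply Rmin_glb; lra).
  (* Equality holds at [x = 1/2], where each factor contributes [1/4]. *)
  assert (T4 : 1 - 3 * x / 2 + (1 - tau) / 2 + (1 - tau) / 2 <= 3 / 4).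
  { unfold tau, Rmin; destruct (Rle_dec _ _); lra. }
  fold tau in T1, T2.
  assert (Hn : forall n, (2 <= n)%nat -> (n <= b)%nat ->
            Cmod (zeta (dual_line n (x, T))) <= 2 * K * INR b * Rpower T ((1 - tau) / 2)).
  { intros n h1 h2; assert (N := HB n h1 h2); rewrite dual_line_pair.
    eapply Rle_trans; [apply (Hz _ tau (INR n * T)) |]; unfold Re, Im; simpl fst; simpl snd.
    - rewrite Rabs_left by nra; ring.
    - nra.
    - lra.
    - split; nra.
    - assert (M1 : Rpower (INR n * T) (1 - 3 * tau / 2) <= Rpower (INR n * T) ((1 - tau) / 2)).
      { apply Rpower_mono_exp; [nra | lra]. }
      assert (M2 : Rpower (INR n * T) ((1 - tau) / 2) <= INR b * Rpower T ((1 - tau) / 2)).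
      { rewrite <- Rpower_mult_distr by lra.
        apply Rmult_le_compat_r; [apply Rlt_le, Rpower_pos |].
        apply Rle_trans with (Rpower (INR n) 1); [apply Rpower_mono_exp; lra | rewrite Rpower_1; lra]. }
      nra. }
  assert (H1 : Cmod (zeta (x, T)) <= 2 * K * Rpower T (1 - 3 * x / 2)).
  { eapply Rle_trans; [apply (Hz _ x T) |]; unfold Re, Im; simpl fst; simpl snd.
    - rewrite Rabs_right; lra.
    - lra.
    - lra.
    - lra.
    - assert (M1 : Rpower T ((1 - x) / 2) <= Rpower T (1 - 3 * x / 2)).
      { apply Rpower_mono_exp; lra. }
      nra. }
  unfold zeta_triple; rewrite !Cmod_mult.
  set (U := Rpower T (1 - 3 * x / 2)) in *; set (V := Rpower T ((1 - tau) / 2)) in *.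
  apply Rle_trans with (2 * K * U * (2 * K * INR b * V) * (2 * K * INR b * V)).
  - apply Rmult_le_compat; [apply Rmult_le_pos; apply Cmod_ge_0 | apply Cmod_ge_0 | |].
    + apply Rmult_le_compat; [apply Cmod_ge_0 | apply Cmod_ge_0 | exact H1 | apply Hn; auto; lia].
    + apply Hn; auto.
  - replace (2 * K * U * (2 * K * INR b * V) * (2 * K * INR b * V))
      with (2 * K * (2 * K * INR b) * (2 * K * INR b) * (U * V * V)) by ring.
    apply Rmult_le_compat_l; [repeat apply Rmult_le_pos; lra |].
    unfold U, V; rewrite <- !Rpower_plus; apply Rpower_mono_exp; lra.
Qed.

(** [contour_shift] needs a margin around the rectangle. To the right of [1/2] it is [1 / (100 b)],
    so that the arguments [dual_line] keep real part at least [1/2 - 1/100]; since their slope is at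
    least 2, their imaginary parts stay at most [- 1]. *)
Lemma Quad_zeta_triple (b c : nat) (T : R) :
  (2 <= c)%nat -> (c <= b)%nat -> 1 <= T ->
  exists f', Quad (fun s => 1 / 5 <= Re s <= 1 / 2 + / (100 * INR b) /\ 1 / 2 <= Im s <= T + 1)
               (zeta_triple b c) f'.
Proof.
  intros Hc Hb HT.
  set (P := fun s : C => 1 / 5 <= Re s <= 1 / 2 + / (100 * INR b) /\ 1 / 2 <= Im s <= T + 1).
  assert (HB : forall n, (2 <= n)%nat -> (n <= b)%nat -> 2 <= INR n <= INR b).
  { intros n h1 h2; split; [apply (le_INR 2), h1 | apply le_INR, h2]. }
  assert (HB0 := HB b ltac:(lia) ltac:(lia)).
  assert (Hi : 0 < / (100 * INR b)) by (apply Rinv_0_lt_compat; lra).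
  assert (Hi2 : INR b * / (100 * INR b) = 1 / 100) by (field; lra).
  assert (Q1 : Quad P zeta (C_derive zeta)).
  { eapply Quad_weaken; [| apply (Quad_zeta (1 / 5) (T + 3)); lra].
    intros [x t]; unfold P, Re, Im; simpl fst; simpl snd; intros [H1 H2].
    split; [lra | split; [rewrite Rabs_right; lra |]].
    eapply Rle_trans; [apply Cmod_pair_le |]; rewrite !Rabs_right by lra.
    nra. }
  assert (Q2 : forall n, (2 <= n)%nat -> (n <= b)%nat ->
    Quad P (fun s => zeta (dual_line n s)) (fun s => - INR n * C_derive zeta (dual_line n s))%C).
  { intros n h1 h2; assert (N := HB n h1 h2).
    eapply (Quad_affine P); [lra | | apply (Quad_zeta (1 / 5) (1 + 2 * INR b + INR b * (T + 1))); lra].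
    intros [x t]; unfold P, Re, Im; simpl fst; simpl snd; intros [H1 H2].
    fold (dual_line n (x, t)); rewrite dual_line_pair; simpl fst; simpl snd.
    assert (X1 : - (1 / 100) <= INR n * (1 / 2 - x)).
    { assert (INR n * (- / (100 * INR b)) <= INR n * (1 / 2 - x)) by (apply Rmult_le_compat_l; lra).
      assert (INR n * / (100 * INR b) <= INR b * / (100 * INR b)) by (apply Rmult_le_compat_r; lra).
      lra. }
    split; [lra | split].
    - rewrite Rabs_left; nra.
    - eapply Rle_trans; [apply Cmod_pair_le |].
      rewrite Rabs_right, Rabs_left by nra.
      assert (INR n * (1 / 2 - x) <= INR b * 1) by (apply Rle_trans with (INR n * 1); nra).
      assert (INR n * t <= INR b * (T + 1)) by (apply Rmult_le_compat; lra).
      lra. }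
  eexists; unfold zeta_triple; apply Quad_mult; [apply Quad_mult; [exact Q1 |] |].
  - apply (Q2 b); lia.
  - apply (Q2 c); lia.
Qed.

(** On the critical line all three arguments have real part [1/2], so no pole is met, not even at
    [t = 0]. *)
Lemma ccont_zeta_triple_critical (b c : nat) (t : R) : ccont (fun t => zeta_triple b c (1 / 2, t)) t.
Proof.
  assert (Hd : forall n, ccont (fun t => zeta (dual_line n (1 / 2, t))) t).
  { intros n; apply ccont_zeta_dual_line; [lra |].
    rewrite dual_line_pair; intros E; apply (f_equal Re) in E; unfold Re in E; simpl in E; lra. }
  unfold zeta_triple; apply ccont_mult; [apply ccont_mult |]; auto.
  apply ccont_zeta_line; [lra |].
  intros E; apply (f_equal Re) in E; unfold Re in E; simpl in E; lra.
Qed.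

Lemma zeta_triple_integral_eq (b c : nat) (T : R) :
  0 <= T ->
  zeta_triple_integral 1 (INR b) (INR c) T = CI (fun t => zeta_triple b c (1 / 2, t)) 0 T.
Proof.
  intros HT; unfold zeta_triple_integral.
  rewrite <- CI_RInt by (auto; intros; apply ccont_zeta_triple_critical).
  apply (@RInt_ext C_R_CompleteNormedModule); intros t _; unfold zeta_triple.
  assert (H2 : (1 / 2)%C = RtoC (1 / 2)) by (rewrite RtoC_div; [reflexivity | lra]).
  assert (E1 : (1 / 2 + Ci * (1 * t))%C = (1 / 2, t)).
  { rewrite H2, pair_im; ring. }
  assert (E2 : forall n, (1 / 2 - Ci * (INR n * t))%C = dual_line n (1 / 2, t)).
  { intros n; rewrite H2, dual_line_pair; unfold Cminus, Cplus, Copp, Cmult, Ci, RtoC; simpl.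
    f_equal; field. }
  now rewrite E1, !E2.
Qed.

Theorem theorem1p2 (b c : nat) (hc : (1 < c)%nat) (hcb : (c <= b)%nat)
    (eps : R) (heps : 0 < eps) :
  exists K T0 : R, forall T : R, T0 <= T ->
    Cmod (zeta_triple_integral 1 (INR b) (INR c) T
          - zeta ((1 + INR b) / 2)%R * zeta ((1 + INR c) / 2)%R * T)%C
    <= K * (Rpower T (3 / 4) * (ln T) ^ 2
            + Rpower T (1 / 2 + 1 / (2 * INR b) + eps)).
Proof.
  destruct (zeta_triple_bottom_bound b c hc hcb) as [K1 HK1].
  destruct (zeta_triple_top_bound b c hc hcb) as [K2 HK2].
  set (K0 := Cmod (CI (fun t => zeta_triple b c (1 / 2, t)) 0 1)).
  assert (HK0 : 0 <= K0) by apply Cmod_ge_0.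
  (* The cube of the constant in [ln T <= (3 / eps) T^(eps / 3)], to absorb the third power of the
     logarithm. *)
  set (K3 := 3 / eps * (3 / eps) * (3 / eps)).
  assert (He : 0 < 3 / eps) by (apply Rdiv_lt_0_compat; lra).
  assert (HK3 : 0 < K3) by (unfold K3; apply Rmult_lt_0_compat; [apply Rmult_lt_0_compat |]; exact He).
  (* In order: the segment below height 1, the horizontal sides, the case [b >= 3] with
     [3000 * 3 * 5], the case [b = 2] with [3000 * 3 * K3]. From [T >= exp 100] the new abscissa is
     at least [24/100], as the bound on the top side requires. *)
  exists (K0 + 4 * (Rabs K1 + Rabs K2) + 45000 + 9000 * K3), (exp 100); intros T HT.
  assert (HL : 100 <= ln T) by (rewrite <- (ln_exp 100); apply ln_le; [apply exp_pos | exact HT]).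
  assert (HT3 : 3 <= T) by (generalize (exp_ineq1_le 100); lra).
  set (L := ln T) in *.
  set (dl := / L).
  assert (Hdl : 0 < dl <= 1 / 100).
  { unfold dl; split; [apply Rinv_0_lt_compat; lra |].
    replace (1 / 100) with (/ 100) by field; apply Rinv_le_contravar; lra. }
  assert (HdL : dl * L = 1) by (unfold dl; field; lra).
  set (x := 1 / 4 - dl).
  set (V := Rpower T (3 / 4)).
  assert (HV : 1 <= V).
  { apply Rle_trans with (Rpower T 0); [rewrite Rpower_O; lra | apply Rpower_mono_exp; lra]. }
  assert (Hbc : 2 <= INR c <= INR b) by (split; [apply (le_INR 2), hc | apply le_INR, hcb]).
  set (f := fun t => zeta_triple b c (1 / 2, t)).
  rewrite zeta_triple_integral_eq by lra; fold f.
  rewrite (CI_Chasles f 0 1 T) by (try lra; intros; apply ccont_zeta_triple_critical).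
  set (Am := CI f 1 T).
  set (Al := CI (fun t => zeta_triple b c (x, t)) 1 T).
  set (mn := (zeta ((1 + INR b) / 2)%R * zeta ((1 + INR c) / 2)%R * T)%C).
  assert (Hshift : Cmod (Am - Al) <= 4 * (Rabs K1 + Rabs K2) * V).
  { destruct (Quad_zeta_triple b c T hc hcb ltac:(lra)) as [f' Hf'].
    assert (Hi : 0 < / (100 * INR b) <= 1 / 200).
    { split; [apply Rinv_0_lt_compat; lra |].
      replace (1 / 200) with (/ 200) by field; apply Rinv_le_contravar; lra. }
    assert (P1 := Rabs_pos K1); assert (P2 := Rabs_pos K2).
    assert (Q1 := Rle_abs K1); assert (Q2 := Rle_abs K2).
    eapply Rle_trans.
    { apply (contour_shift _ _ _ x (1 / 2) (/ (100 * INR b)) T ((Rabs K1 + Rabs K2) * V) Hf');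
        unfold x; try lra.
      - intros y t Hy Ht; unfold Re, Im; simpl; lra.
      - intros y Hy; eapply Rle_trans; [apply HK2; lra |]; fold V; nra.
      - intros y Hy; eapply Rle_trans; [apply HK1; lra |]; nra. }
    assert (0 <= (Rabs K1 + Rabs K2) * V) by (apply Rmult_le_pos; lra).
    unfold x; nra. }
  (* [T^(1 / ln T) = e]. *)
  assert (Hx1 : Rpower T (1 - x) <= 3 * V).
  { unfold x; replace (1 - (1 / 4 - dl)) with (dl + 3 / 4) by lra.
    rewrite Rpower_plus; fold V; apply Rmult_le_compat_r; [lra |].
    unfold Rpower; fold L; rewrite HdL; apply exp_le_3. }
  assert (Hleft : Cmod (Al - mn) <= 3000 * (3 * V * L)
     * ((1 + / (1 / 2 + INR b * (1 / 2 - x) - 1)) * (1 + / (1 / 2 + INR c * (1 / 2 - x) - 1)))).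
  { apply shifted_line_integral; unfold x; try lra; try nra.
    fold x; intros k Hk; eapply Rle_trans; [apply twisted_zeta; [lra | unfold x; lra | exact Hk] |].
    apply Rmult_le_compat_l; [lra |]; fold L; apply Rmult_le_compat_r; lra. }
  (* The real part exceeds 1 by at least [2 dl], with near equality only for [n = 2]; then
     [1 + L / 2 <= L]. *)
  assert (Hlog : forall n, (2 <= n)%nat -> 0 < 1 + / (1 / 2 + INR n * (1 / 2 - x) - 1) <= L).
  { intros n Hn; assert (N : 2 <= INR n) by (apply (le_INR 2), Hn).
    assert (G : 2 * dl <= 1 / 2 + INR n * (1 / 2 - x) - 1) by (unfold x; nra).
    assert (0 < / (1 / 2 + INR n * (1 / 2 - x) - 1)) by (apply Rinv_0_lt_compat; lra).
    assert (/ (1 / 2 + INR n * (1 / 2 - x) - 1) <= L / 2).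
    { replace (L / 2) with (/ (2 * dl)) by (unfold dl; field; lra).
      apply Rinv_le_contravar; lra. }
    lra. }
  destruct (Hlog b ltac:(lia)) as [Lb0 Lb]; destruct (Hlog c ltac:(lia)) as [Lc0 Lc].
  set (Sb := 1 + / (1 / 2 + INR b * (1 / 2 - x) - 1)) in *.
  set (Sc := 1 + / (1 / 2 + INR c * (1 / 2 - x) - 1)) in *.
  set (W := Rpower T (1 / 2 + 1 / (2 * INR b) + eps)).
  assert (HW : 0 < W) by apply Rpower_pos.
  assert (HLL : 1 <= L ^ 2) by (rewrite <- Rsqr_pow2; unfold Rsqr; nra).
  assert (HVL : V <= V * L ^ 2) by (rewrite <- (Rmult_1_r V) at 1; apply Rmult_le_compat_l; lra).
  assert (Hfin : 3000 * (3 * V * L) * (Sb * Sc) <= 45000 * (V * L ^ 2) + 9000 * K3 * W).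
  { assert (HVL0 : 0 < V * L) by (apply Rmult_lt_0_compat; lra).
    (* [b = 2] forces [c = 2]; then both series may cost a logarithm, and [W] is exactly
       [V * T^eps]. *)
    destruct (Nat.eq_dec b 2) as [e | e].
    - apply Rle_trans with (9000 * (V * (L * L * L))).
      { assert (Sb * Sc <= L * L) by (apply Rmult_le_compat; lra).
        replace (9000 * (V * (L * L * L))) with (3000 * (3 * V * L) * (L * L)) by ring.
        apply Rmult_le_compat_l; lra. }
      assert (A : L <= 3 / eps * exp (eps / 3 * L)).
      { replace (3 / eps) with (/ (eps / 3)) by (field; lra); apply le_exp_div; lra. }
      assert (B : L * L * L <= K3 * Rpower T eps).
      { set (g := exp (eps / 3 * L)) in *.
        replace (Rpower T eps) with (g * g * g).
        2: { unfold g, Rpower; rewrite <- !exp_plus; f_equal; fold L; field. }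
        replace (K3 * (g * g * g)) with (3 / eps * g * (3 / eps * g) * (3 / eps * g))
          by (unfold K3; ring).
        apply Rmult_le_compat; [nra | lra | apply Rmult_le_compat; lra | exact A]. }
      assert (EW : W = V * Rpower T eps).
      { unfold W, V; rewrite <- Rpower_plus; f_equal; rewrite e; simpl; field. }
      rewrite EW.
      assert (0 <= V * L ^ 2) by lra.
      assert (V * (L * L * L) <= V * (K3 * Rpower T eps)) by (apply Rmult_le_compat_l; lra).
      lra.
    - assert (Hb3 : 3 <= INR b).
      { replace 3 with (INR 3) by (simpl; ring); apply le_INR; lia. }
      assert (Sb5 : Sb <= 5).
      (* For [b >= 3] the real part is at least [5/4], so only the series belonging to [c] can cost
         a logarithm. *)
      { assert (1 / 4 <= 1 / 2 + INR b * (1 / 2 - x) - 1) by (unfold x; nra).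
        assert (/ (1 / 2 + INR b * (1 / 2 - x) - 1) <= / (1 / 4)) by (apply Rinv_le_contravar; lra).
        unfold Sb; lra. }
      assert (Sb * Sc <= 5 * L) by (apply Rmult_le_compat; lra).
      apply Rle_trans with (3000 * (3 * V * L) * (5 * L)); [apply Rmult_le_compat_l; lra |].
      assert (0 < K3 * W) by (apply Rmult_lt_0_compat; lra).
      simpl; lra. }
  replace (CI f 0 1 + Am - mn)%C with (CI f 0 1 + ((Am - Al) + (Al - mn)))%C by ring.
  assert (W1 := Cmod_triangle (CI f 0 1) ((Am - Al) + (Al - mn))).
  assert (W2 := Cmod_triangle (Am - Al) (Al - mn)).
  change (Cmod (CI f 0 1)) with K0 in W1.
  assert (Z1 : K0 <= K0 * (V * L ^ 2)) by nra.
  assert (Z2 : 4 * (Rabs K1 + Rabs K2) * V <= 4 * (Rabs K1 + Rabs K2) * (V * L ^ 2)).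
  { apply Rmult_le_compat_l; [generalize (Rabs_pos K1) (Rabs_pos K2); lra | lra]. }
  assert (Z3 : 0 <= (K0 + 4 * (Rabs K1 + Rabs K2) + 45000) * W).
  { apply Rmult_le_pos; [generalize (Rabs_pos K1) (Rabs_pos K2); lra | lra]. }
  assert (Z4 : 0 <= 9000 * K3 * (V * L ^ 2)) by (apply Rmult_le_pos; lra).
  lra.
Qed.
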